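(* Let $d\ge 2$, let $p_1,\dots,p_d\in(0,1)$ with $\sum_{i=1}^d p_i=1$, and let $\mathbf{W}=(w_{ij})$ be an irreducible $d\times d$ stochastic matrix. Let $C(z)$ be the cycle exponential generating function of the $d$-partite random mapping governed by $\mathbf{W}$ and $(p_1,\dots,p_d)$, and let $\rho$ be the dominant singularity of the associated tree system. Then $C(z)$ exhibits a logarithmic singularity with parameter $\theta=1/2$ at $\rho$, that is, $$C(z)\sim\frac12\ln\left(\frac{1}{1-z/\rho}\right)\qquad\text{as } z\to\rho.$$ In particular, the parameter is $1/2$ whatever the dimension $d$, the irreducible matrix $\mathbf{W}$ and the distribution $(p_1,\dots,p_d)$.
   Context: A finite set $V$ is partitioned into $S_1,\dots,S_d$, with $p_i$ the proportion of nodes in $S_i$ and $w_{ij}$ the probability that an element of $S_i$ is mapped into $S_j$. Irreducible means that the directed graph on $\{1,\dots,d\}$ with an edge $i\to j$ whenever $w_{ij}>0$ is strongly connected. The tree generating functions $\mathbf{T}(z)=(T_1(z),\dots,T_d(z))^T$ are the unique formal power series solutions of $$T_i(z)=p_i z\exp\left(\sum_{j=1}^d w_{ij}T_j(z)\right),\qquad 1\le i\le d.$$ They share a common radius of convergence $\rho\in(0,\infty)$, which is their unique dominant singularity. The transfer matrix is $\mathbf{A}(z)=\operatorname{diag}(\mathbf{T}(z))\mathbf{W}$, and the cycle exponential generating function is $$C(z)=\sum_{k\ge1}\frac{\operatorname{Tr}(\mathbf{A}(z)^k)}{k}=-\ln\det(\mathbf{I}-\mathbf{A}(z)).$$ The asymptotic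 relation as $z\to\rho$ is understood for (the analytic continuation of) $C$ in a neighbourhood of $\rho$ slit along the ray $[\rho,\infty)$. *)

(* Defs.v *)
(* Mixed setting: Stdlib's concrete reals R, seen as a MathComp ring through
   Rstruct (for matrices and finite sums), and Coquelicot for complex analysis.
   Coquelicot is imported first so that the MathComp names prevail. *)
From Stdlib Require Import Reals.
From Coquelicot Require Import Coquelicot.
From mathcomp Require Import all_boot all_order all_algebra.
From mathcomp Require Import Rstruct.

Set Implicit Arguments.
Unset Strict Implicit.
Unset Printing Implicit Defensive.

Import GRing.Theory.
Local Open Scope ring_scope.

Definition stochastic d (W : 'M[R]_d) : Prop :=
  (forall i j, 0 <= W i j) /\ (forall i, \sum_j W i j = 1).

Definition irreducible d (W : 'M[R]_d) : Prop :=
  forall i j, connect (fun k l => 0 < W k l) i j.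

(* A formal power series is its sequence of coefficients [nat -> A].  The
   coefficient ring A may be a matrix ring, whence the Cauchy product below. *)
Section FormalPowerSeries.
Variable A : pzSemiRingType.
Implicit Types a b : nat -> A.

Definition fps_one : nat -> A := fun n => (n == 0)%:R.

Definition fps_mul a b : nat -> A :=
  fun n => \sum_(k < n.+1) a k * b (n - k)%N.

Definition fps_pow a (k : nat) : nat -> A := iter k (fps_mul a) fps_one.

Definition fps_mulX a : nat -> A := fun n => if n is m.+1 then a m else 0.

End FormalPowerSeries.

(* exp(a) = sum_k a^k / k!, for a with a 0 = 0 only: the n-th coefficient of
   a^k then vanishes for k > n, so that the sum over k can stop at k = n. *)
Definition fps_exp (a : nat -> R) : nat -> R :=
  fun n => \sum_(k < n.+1) fps_pow a k n / (k`!)%:R.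

(* T_i(z) = p_i z exp(sum_j w_ij T_j(z)).  The factor z forces T_j(0) = 0, so
   fps_exp is applied to a series without constant term. *)
Definition tree_system d (p : 'I_d -> R) (W : 'M[R]_d)
    (T : 'I_d -> nat -> R) : Prop :=
  forall i n,
    T i n = p i * fps_mulX (fps_exp (fun m => \sum_j W i j * T j m)) n.

Definition transfer_matrix d (W : 'M[R]_d) (T : 'I_d -> nat -> R) :
    nat -> 'M[R]_d :=
  fun n => diag_mx (\row_i T i n) *m W.

(* C(z) = sum_(k >= 1) Tr(A(z)^k) / k.  Since A(0) = 0, only the terms with
   k <= n contribute to the n-th coefficient. *)
Definition cycle_egf d (W : 'M[R]_d) (T : 'I_d -> nat -> R) : nat -> R :=
  fun n => \sum_(1 <= k < n.+1) \tr (fps_pow (transfer_matrix W T) k n) / k%:R.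

Local Open Scope R_scope.

(* Principal argument, in (-PI, PI], and principal logarithm of a nonzero
   complex number. *)
Definition Carg (z : C) : R :=
  if Rlt_dec (Im z) 0 then - acos (Re z / Cmod z) else acos (Re z / Cmod z).

Definition Clog (z : C) : C := (ln (Cmod z), Carg z).

(* The disc of centre rho and radius r, slit along the ray [rho, +oo). *)
Definition slit_disc (rho r : R) (z : C) : Prop :=
  Cmod (z - rho)%C < r /\ ~ (Im z = 0 /\ rho <= Re z).

(* F is an analytic continuation, to the disc of centre 0 and radius rho
   together with [slit_disc rho r], of the sum of the power series c, which is
   required to converge on the former disc. *)
Definition slit_continuation (c : nat -> R) (rho r : R) (F : C -> C) : Prop :=
  (forall z : C, Cmod z < rho -> is_pseries (fun n => RtoC (c n)) z (F z)) /\
  (forall z : C, Cmod z < rho \/ slit_disc rho r z -> ex_derive F z).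

(* f(z) ~ theta ln (1 / (1 - z / rho)) as z tends to rho inside the slit disc;
   there 1 / (1 - z / rho) avoids the cut (-oo, 0] of the logarithm. *)
Definition log_singularity (theta rho r : R) (F : C -> C) : Prop :=
  is_equiv (within (slit_disc rho r) (locally (RtoC rho)))
    F (fun z => (theta * Clog (1 / (1 - z / rho)))%C).

(* Main.v *)
Require Import Defs.
From Stdlib Require Import Reals FunctionalExtensionality.
From Stdlib Require Lra.
From Coquelicot Require Import Coquelicot.
From HB Require Import structures.
From mathcomp Require Import all_boot all_order all_algebra perm.
From mathcomp Require Import Rstruct.
From mathcomp Require Import ring lra.

(** Let A(z) = diag(T(z)) W.  The logarithm in C = - ln det(1 - A) is caused by
    a simple zero of the determinant, in a variable s that is a square root of
    1 - z / rho.

    At the critical point.  For x < y < rho the increments D of the T_i between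
    x and y satisfy D > A(x) D.  Taken at an index where D is minimal, this
    gives T_i(x) <= 1 since the rows of W sum to 1, and irreducibility carries
    the bound to every index; so tau = T(rho) is finite and solves the system.
    With y = rho the inequality says that A(x) has spectral radius below 1 for
    x < rho, hence A = A(rho) has spectral radius at most 1.  It is not below 1,
    for a positive w with A w < w would give a supersolution tau + e w of the
    system at some rho' > rho, and T would converge beyond rho.  Thus 1 is the
    Perron eigenvalue of A (lemmas perron and critical_point): A v = v and
    u A = u with v, u > 0, and the eigenvalue is simple.

    Uniformization.  With z = rho (1 - s^2) and y = tau + s x, the system
    y_i = p_i z exp((W y)_i) becomes (1 - A) x = s m(s, x) with m entire.  It is
    solvable at first order in s only if u m(0, x) = 0; along x = - alpha v this
    is a quadratic equation for alpha, with a nonzero root because the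
    exponential has a nonzero second derivative.  The implicit function theorem
    then produces x(s) near s = 0 (lemma uniformization).

    Identification.  If |z| < rho, then |s| is at most sqrt 2 times Re s, and
    tau + s x(s) lies in the polydisc |y_i| <= tau_i for small s.  There the
    system has only one solution, because its right-hand side contracts the
    distance weighted by u by the factor |z| / rho (lemma polydisc_unique).
    So tau + s x(s) is T(z), which it continues to a slit disc.

    The determinant.  Its derivative at s = 0 is a nonzero multiple of
    u diag(x(0)) W v, so that det(1 - A) = s E(s) with E(0) <> 0 (lemma
    simple_zero).  On the disc, Jacobi's formula shows that det(1 - A) and
    exp(- C) solve the same linear equation, so they are equal (lemma
    det_transfer_disc).  Therefore - Log s - Log E(s) continues C, and E being
    bounded and bounded away from 0, C is - ln s up to a bounded term, that is
    1/2 ln (1 / (1 - z / rho)) (lemma log_singularity_of_simple_zero).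

    Analytic continuation is never argued by an identity theorem: functions are
    identified by the uniqueness of solutions, or because the derivative of a
    difference or of a product vanishes along segments. *)

Set Implicit Arguments.
Unset Strict Implicit.
Unset Printing Implicit Defensive.

Import Order.TTheory GRing.Theory Num.Theory.
Local Open Scope ring_scope.

Bind Scope ring_scope with C R.
Notation Re := Coquelicot.Complex.Re.
Notation Im := Coquelicot.Complex.Im.
Arguments Cmod _%_ring_scope.
Arguments Re _%_ring_scope.
Arguments Im _%_ring_scope.
Arguments Cconj _%_ring_scope.
Arguments RtoC _%_ring_scope.

(** * The field of complex numbers *)

(** The field structure makes matrices and determinants available over the
    complex numbers. *)
HB.instance Definition _ := Choice.copy C (R * R)%type.
Fact CaddN : left_inverse (RtoC 0) Copp Cplus.
Proof. by move=> x; rewrite Cplus_comm Cplus_opp_r. Qed.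
HB.instance Definition _ :=
  GRing.isZmodule.Build C Cplus_assoc Cplus_comm Cplus_0_l CaddN.
Fact C1_neq0 : RtoC 1 != RtoC 0.
Proof. by apply/eqP; apply: C1_nz. Qed.
HB.instance Definition _ := GRing.Zmodule_isComNzRing.Build C
  Cmult_assoc Cmult_comm Cmult_1_l Cmult_plus_distr_r C1_neq0.
Fact CmulVf : forall x : C, x != 0 -> Cinv x * x = 1.
Proof. by move=> x /eqP x0; apply: Cinv_l. Qed.
Fact Cinv0 : Cinv 0 = 0.
Proof.
by apply: injective_projections => /=; rewrite ?RdivE ?RoppE ?oppr0 !mul0r.
Qed.
HB.instance Definition _ := GRing.ComNzRing_isField.Build C CmulVf Cinv0.

Fact RtoC_is_zmod_morphism : zmod_morphism RtoC.
Proof. by move=> x y; rewrite -[x - y]/(Rminus x y) RtoC_minus. Qed.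
HB.instance Definition _ :=
  GRing.isZmodMorphism.Build R C RtoC RtoC_is_zmod_morphism.
Fact RtoC_is_monoid_morphism : monoid_morphism RtoC.
Proof. by split=> // x y; rewrite -[x * y]/(Rmult x y) RtoC_mult. Qed.
HB.instance Definition _ :=
  GRing.isMonoidMorphism.Build R C RtoC RtoC_is_monoid_morphism.

(** * The modulus *)

Section ComplexCalculus.
Implicit Types (x y z w : C) (a b : R).

Lemma Cmod_ge0 x : 0 <= Cmod x. Proof. exact/RleP/Cmod_ge_0. Qed.
Lemma CmodM x y : Cmod (x * y) = Cmod x * Cmod y. Proof. exact: Cmod_mult. Qed.
Lemma CmodD x y : Cmod (x + y) <= Cmod x + Cmod y.
Proof. exact/RleP/Cmod_triangle. Qed.
Lemma CmodN x : Cmod (- x) = Cmod x. Proof. exact: Cmod_opp. Qed.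
Lemma Cmod0 : Cmod 0 = 0. Proof. exact: Cmod_0. Qed.
Lemma Cmod1 : Cmod 1 = 1. Proof. exact: Cmod_1. Qed.
Lemma CmodB x y : Cmod (x - y) = Cmod (y - x).
Proof. by rewrite -CmodN opprB. Qed.
Lemma CmodDB x y : Cmod (x - y) <= Cmod x + Cmod y.
Proof. by rewrite -(CmodN y) CmodD. Qed.
Lemma CmodX x n : Cmod (x ^+ n) = Cmod x ^+ n.
Proof. by elim: n => [|n IH]; rewrite ?Cmod1 // !exprS CmodM IH. Qed.
Lemma Cmod_eq0 x : (Cmod x == 0) = (x == 0).
Proof.
by apply/eqP/eqP => [/Cmod_eq_0 //|->]; rewrite Cmod0.
Qed.
Lemma Cmod_gt0 x : (0 < Cmod x) = (x != 0).
Proof. by rewrite lt0r Cmod_ge0 Cmod_eq0 andbT. Qed.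
Lemma CmodV x : Cmod x^-1 = (Cmod x)^-1.
Proof.
have [->|x0] := eqVneq x 0; first by rewrite invr0 Cmod0 invr0.
by have /= -> := Cmod_inv x (elimN eqP x0).
Qed.
Lemma CmodR a : Cmod (RtoC a) = `|a|. Proof. by rewrite Cmod_R RabsE. Qed.
Lemma CmodR_ge0 a : 0 <= a -> Cmod (RtoC a) = a.
Proof. by move=> a0; rewrite CmodR ger0_norm. Qed.
Lemma Cmod_sum (I : Type) (r : seq I) (P : pred I) (F : I -> C) :
  Cmod (\sum_(i <- r | P i) F i) <= \sum_(i <- r | P i) Cmod (F i).
Proof.
elim/big_ind2: _ => [|x1 x2 y1 y2 h1 h2|//]; first by rewrite Cmod0.
by rewrite (le_trans (CmodD _ _)) // lerD.
Qed.
Lemma Cmod_Re x : `|Re x| <= Cmod x.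
Proof. by have /RleP := re_le_Cmod x; rewrite RabsE. Qed.
Lemma Re_le_Cmod x : Re x <= Cmod x.
Proof. exact: le_trans (ler_norm _) (Cmod_Re x). Qed.
Lemma ReD x y : Re (x + y) = Re x + Re y. Proof. by []. Qed.
Lemma ReN x : Re (- x) = - Re x. Proof. by []. Qed.
Lemma ReM x y : Re (x * y) = Re x * Re y - Im x * Im y. Proof. by []. Qed.
Lemma ImD x y : Im (x + y) = Im x + Im y. Proof. by []. Qed.
Lemma ImN x : Im (- x) = - Im x. Proof. by []. Qed.
Lemma ImM x y : Im (x * y) = Re x * Im y + Im x * Re y. Proof. by []. Qed.
Lemma ReR a : Re (RtoC a) = a. Proof. by []. Qed.
Lemma ImR a : Im (RtoC a) = 0. Proof. by []. Qed.
Lemma C_ext x y : Re x = Re y -> Im x = Im y -> x = y.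
Proof. exact: injective_projections. Qed.
Lemma Re_sum (I : Type) (r : seq I) (P : pred I) (F : I -> C) :
  Re (\sum_(i <- r | P i) F i) = \sum_(i <- r | P i) Re (F i).
Proof. by elim/big_ind2: _ => // x1 x2 y1 y2 <- <-. Qed.
Lemma Im_sum (I : Type) (r : seq I) (P : pred I) (F : I -> C) :
  Im (\sum_(i <- r | P i) F i) = \sum_(i <- r | P i) Im (F i).
Proof. by elim/big_ind2: _ => // x1 x2 y1 y2 <- <-. Qed.
Lemma Cmod_sqr x : Cmod x ^+ 2 = Re x ^+ 2 + Im x ^+ 2.
Proof. by have := Cmod2_alt x; rewrite !RealsE. Qed.
Lemma Cmod_Im x : `|Im x| <= Cmod x.
Proof.
rewrite -(@ler_pXn2r _ 2) ?nnegrE ?Cmod_ge0 // Cmod_sqr real_normK ?num_real //.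
by rewrite lerDr sqr_ge0.
Qed.
Lemma Cmod_le_ReIm x : Cmod x <= `|Re x| + `|Im x|.
Proof.
rewrite -(@ler_pXn2r _ 2) ?nnegrE ?Cmod_ge0 ?addr_ge0 // Cmod_sqr sqrrD.
rewrite !real_normK ?num_real // -subr_ge0.
suff -> : Re x ^+ 2 + `|Re x| * `|Im x| *+ 2 + Im x ^+ 2
  - (Re x ^+ 2 + Im x ^+ 2) = `|Re x| * `|Im x| *+ 2 by rewrite mulrn_wge0 ?mulr_ge0.
ring.
Qed.
Lemma CconjM x : x * Cconj x = RtoC (Cmod x ^+ 2).
Proof. by rewrite Cmod_sqr; apply: C_ext => /=; rewrite !RealsE; ring. Qed.

(** * Complex derivatives *)

Definition ccont (f : C -> C) z := forall e, 0 < e -> exists2 d, 0 < d &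
  forall w, Cmod (w - z) < d -> Cmod (f w - f z) < e.

(** The derivative in epsilon-delta form, which is what the estimates below
    produce and consume; hol_ex_derive converts it. *)
Definition cderiv (f : C -> C) z l := forall e, 0 < e -> exists2 d, 0 < d &
  forall w, Cmod (w - z) < d -> Cmod (f w - f z - l * (w - z)) <= e * Cmod (w - z).

Definition hol (f : C -> C) z := exists l, cderiv f z l.

Lemma cderiv_cont f z l : cderiv f z l -> ccont f z.
Proof.
move=> df e e0; have [d d0 hd] := df _ ltr01.
have k0 : 0 < 1 + Cmod l by rewrite ltr_pwDl ?Cmod_ge0.
exists (Num.min d (e / (1 + Cmod l))); first by rewrite lt_min d0 divr_gt0.
move=> w; rewrite lt_min => /andP[/hd {}hd]; rewrite ltr_pdivlMr // => hw.
apply: le_lt_trans hw.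
have -> : f w - f z = f w - f z - l * (w - z) + l * (w - z) by ring.
by apply: le_trans (CmodD _ _) _; rewrite CmodM; lra.
Qed.

Lemma hol_cont f z : hol f z -> ccont f z.
Proof. by case=> l /cderiv_cont. Qed.

Lemma cderiv_ext f g z l r : 0 < r -> (forall w, Cmod (w - z) < r -> f w = g w) ->
  cderiv f z l -> cderiv g z l.
Proof.
move=> r0 fg df e e0; have [d d0 hd] := df e e0.
exists (Num.min d r); first by rewrite lt_min d0.
move=> w; rewrite lt_min => /andP[/hd {}hd hr].
by rewrite -!fg // subrr Cmod0.
Qed.

Lemma hol_ext f g z r : 0 < r -> (forall w, Cmod (w - z) < r -> f w = g w) ->
  hol f z -> hol g z.
Proof. by move=> r0 fg [l df]; exists l; exact: cderiv_ext r0 fg df. Qed.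

Lemma cderiv_eq f z l l' : cderiv f z l -> l = l' -> cderiv f z l'.
Proof. by move=> ? <-. Qed.

Lemma cderiv_const c z : cderiv (fun=> c) z 0.
Proof. by move=> e e0; exists 1 => // w _; rewrite mul0r !subrr Cmod0 mulr_ge0 ?Cmod_ge0 // ltW. Qed.

Lemma cderiv_id z : cderiv id z 1.
Proof. by move=> e e0; exists 1 => // w _; rewrite mul1r subrr Cmod0 mulr_ge0 ?Cmod_ge0 // ltW. Qed.

Lemma cderivD f g z l m : cderiv f z l -> cderiv g z m ->
  cderiv (fun w => f w + g w) z (l + m).
Proof.
move=> df dg e e0; have e20 : 0 < e / 2 by lra.
have [d d0 hd] := df _ e20; have [d' d'0 hd'] := dg _ e20.
exists (Num.min d d'); first by rewrite lt_min d0.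
move=> w; rewrite lt_min => /andP[/hd {}hd /hd' {}hd'].
have -> : f w + g w - (f z + g z) - (l + m) * (w - z) =
  (f w - f z - l * (w - z)) + (g w - g z - m * (w - z)) by ring.
by apply: le_trans (CmodD _ _) _; lra.
Qed.

Lemma cderivM f g z l m : cderiv f z l -> cderiv g z m ->
  cderiv (fun w => f w * g w) z (l * g z + f z * m).
Proof.
move=> df dg e e0.
set K := Cmod l + Cmod (f z) + Cmod (g z) + 1.
have K0 : 0 < K by rewrite ltr_wpDl ?addr_ge0 ?Cmod_ge0.
have e20 : 0 < e / (3 * K) by rewrite divr_gt0 // mulr_gt0.
have e2K : e / (3 * K) * K = e / 3 by field; rewrite gt_eqF.
have [d d0 hd] := df _ e20; have [d' d'0 hd'] := dg _ e20.
have m10 : 0 < Num.min 1 (e / (3 * K)) by rewrite lt_min ltr01.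
have [d2 d20 hd2] := cderiv_cont dg m10.
exists (Num.min (Num.min d d') d2); first by rewrite !lt_min d0 d'0.
move=> w; rewrite !lt_min => /andP[/andP[/hd {}hd /hd' {}hd'] /hd2].
rewrite lt_min => /andP[h1 h2].
have -> : f w * g w - f z * g z - (l * g z + f z * m) * (w - z) =
  (f w - f z - l * (w - z)) * g w + f z * (g w - g z - m * (w - z))
   + l * (w - z) * (g w - g z) by ring.
have gw : Cmod (g w) <= K.
  have -> : g w = g z + (g w - g z) by ring.
  apply: le_trans (CmodD _ _) _; rewrite /K.
  have := Cmod_ge0 l; have := Cmod_ge0 (f z); lra.
have fK : Cmod (f z) <= K.
  rewrite /K; have := Cmod_ge0 l; have := Cmod_ge0 (g z); lra.
have lK : Cmod l <= K.
  rewrite /K; have := Cmod_ge0 (f z); have := Cmod_ge0 (g z); lra.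
have W0 := Cmod_ge0 (w - z).
apply: le_trans (CmodD _ _) _.
apply: le_trans (lerD (CmodD _ _) (lexx _)) _; rewrite !CmodM.
have H1 := ler_pM (Cmod_ge0 _) (Cmod_ge0 _) hd gw.
have H2 := ler_pM (Cmod_ge0 _) (Cmod_ge0 _) fK hd'.
have H3 : Cmod l * Cmod (w - z) * Cmod (g w - g z) <= K * Cmod (w - z) * (e / (3 * K)).
  by apply: ler_pM; rewrite ?mulr_ge0 ?Cmod_ge0 ?(ltW h2) //; apply: ler_wpM2r.
have E1 : e / (3 * K) * Cmod (w - z) * K = e / 3 * Cmod (w - z) by rewrite mulrAC e2K.
have E2 : K * (e / (3 * K) * Cmod (w - z)) = e / 3 * Cmod (w - z) by rewrite mulrC E1.
have E3 : K * Cmod (w - z) * (e / (3 * K)) = e / 3 * Cmod (w - z) by rewrite mulrC -E1; ring.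
lra.
Qed.

Lemma cderiv_comp f g z l m : cderiv g z l -> cderiv f (g z) m ->
  cderiv (fun w => f (g w)) z (m * l).
Proof.
move=> dg df e e0.
set K := Cmod l + Cmod m + 1.
have K0 : 0 < K by rewrite ltr_wpDl ?addr_ge0 ?Cmod_ge0.
set t := Num.min 1 (e / (2 * K)).
have t0 : 0 < t by rewrite lt_min ltr01 divr_gt0 ?mulr_gt0.
have tK : t * K <= e / 2.
  have -> : e / 2 = e / (2 * K) * K by field; rewrite gt_eqF.
  by rewrite ler_pM2r // /t ge_min lexx orbT.
have t1 : t <= 1 by rewrite /t ge_min lexx.
have [d d0 hd] := df _ t0; have [d' d'0 hd'] := dg _ t0.
have [d2 d20 hd2] := cderiv_cont dg d0.
exists (Num.min d' d2); first by rewrite lt_min d'0.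
move=> w; rewrite lt_min => /andP[/hd' {}hd' /hd2 /hd {}hd].
have -> : f (g w) - f (g z) - m * l * (w - z) =
  (f (g w) - f (g z) - m * (g w - g z)) + m * (g w - g z - l * (w - z)) by ring.
have gw : Cmod (g w - g z) <= (Cmod l + 1) * Cmod (w - z).
  have -> : g w - g z = g w - g z - l * (w - z) + l * (w - z) by ring.
  apply: le_trans (CmodD _ _) _; rewrite CmodM.
  have := Cmod_ge0 (w - z); nra.
apply: le_trans (CmodD _ _) _; rewrite !CmodM.
have H1 := Cmod_ge0 (w - z); have H2 := Cmod_ge0 m; have H3 := Cmod_ge0 l.
have H4 : t * Cmod (g w - g z) <= t * ((Cmod l + 1) * Cmod (w - z)) by rewrite ler_pM2l.
have H5 := ler_wpM2l H2 hd'.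
have H6 : t * K * Cmod (w - z) <= e / 2 * Cmod (w - z) by rewrite ler_wpM2r.
have H7 : t * ((Cmod l + 1) * Cmod (w - z)) + Cmod m * (t * Cmod (w - z)) = t * K * Cmod (w - z).
  by rewrite /K; ring.
have H8 : 0 <= e / 2 * Cmod (w - z) by rewrite mulr_ge0 //; lra.
lra.
Qed.

Lemma cderivN f z l : cderiv f z l -> cderiv (fun w => - f w) z (- l).
Proof.
move=> df; have := cderivM (cderiv_const (-1) z) df => /(cderiv_ext ltr01) h.
by apply: cderiv_eq (h _ _) _ => [w _|]; ring.
Qed.

Lemma cderivB f g z l m : cderiv f z l -> cderiv g z m ->
  cderiv (fun w => f w - g w) z (l - m).
Proof. by move=> df dg; apply: cderivD df (cderivN dg). Qed.

Lemma cderivZ c f z l : cderiv f z l -> cderiv (fun w => c * f w) z (c * l).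
Proof.
move=> df; apply: cderiv_eq (cderivM (cderiv_const c z) df) _; ring.
Qed.

Lemma cderiv_sum (I : Type) (r : seq I) (P : pred I) (f : I -> C -> C) (l : I -> C) z :
  (forall i, P i -> cderiv (f i) z (l i)) ->
  cderiv (fun w => \sum_(i <- r | P i) f i w) z (\sum_(i <- r | P i) l i).
Proof.
move=> h; elim: r => [|i r IH].
  rewrite big_nil; apply: cderiv_ext ltr01 _ (cderiv_const 0 z) => w _.
  by rewrite big_nil.
rewrite big_cons; case: ifP => Pi.
  apply: cderiv_ext ltr01 _ (cderivD (h i Pi) IH) => w _.
  by rewrite big_cons Pi.
by apply: cderiv_ext ltr01 _ IH => w _; rewrite big_cons Pi.
Qed.

Lemma hol_const c z : hol (fun=> c) z.
Proof. by exists 0; apply: cderiv_const. Qed.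
Lemma hol_id z : hol id z.
Proof. by exists 1; apply: cderiv_id. Qed.
Lemma holD f g z : hol f z -> hol g z -> hol (fun w => f w + g w) z.
Proof. by case=> l df [m dg]; exists (l + m); apply: cderivD. Qed.
Lemma holN f z : hol f z -> hol (fun w => - f w) z.
Proof. by case=> l df; exists (- l); apply: cderivN. Qed.
Lemma holB f g z : hol f z -> hol g z -> hol (fun w => f w - g w) z.
Proof. by case=> l df [m dg]; exists (l - m); apply: cderivB. Qed.
Lemma holM f g z : hol f z -> hol g z -> hol (fun w => f w * g w) z.
Proof. by case=> l df [m dg]; eexists; apply: cderivM df dg. Qed.
Lemma hol_comp f g z : hol g z -> hol f (g z) -> hol (fun w => f (g w)) z.
Proof. by case=> l dg [m df]; eexists; apply: cderiv_comp dg df. Qed.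
Lemma hol_sum (I : Type) (r : seq I) (P : pred I) (f : I -> C -> C) z :
  (forall i, P i -> hol (f i) z) -> hol (fun w => \sum_(i <- r | P i) f i w) z.
Proof.
move=> h; elim: r => [|i r IH].
  by apply: hol_ext ltr01 _ (hol_const 0 z) => w _; rewrite big_nil.
case Pi: (P i).
  by apply: hol_ext ltr01 _ (holD (h i Pi) IH) => w _; rewrite big_cons Pi.
by apply: hol_ext ltr01 _ IH => w _; rewrite big_cons Pi.
Qed.
Lemma hol_prod (I : Type) (r : seq I) (P : pred I) (f : I -> C -> C) z :
  (forall i, P i -> hol (f i) z) -> hol (fun w => \prod_(i <- r | P i) f i w) z.
Proof.
move=> h; elim: r => [|i r IH].
  by apply: hol_ext ltr01 _ (hol_const 1 z) => w _; rewrite big_nil.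
case Pi: (P i).
  by apply: hol_ext ltr01 _ (holM (h i Pi) IH) => w _; rewrite big_cons Pi.
by apply: hol_ext ltr01 _ IH => w _; rewrite big_cons Pi.
Qed.
Lemma hol_det n (A : C -> 'M[C]_n) z :
  (forall i j, hol (fun w => A w i j) z) -> hol (fun w => \det (A w)) z.
Proof.
move=> h; apply: hol_sum => s _.
by apply: holM; [apply: hol_const|apply: hol_prod => i _; apply: h].
Qed.

Lemma hol_ex_derive (f : C -> C) z : hol f z -> ex_derive f z.
Proof.
case=> l df; exists l; split; first exact: is_linear_scal_l.
move=> x hx; have -> : x = z.
  by rewrite (is_filter_lim_locally_unique _ _ hx).
move=> eps; have [d d0 hd] := df eps (introT RltP (cond_pos eps)).
exists (mkposreal d (elimT RltP d0)) => w hw.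
have {}hw : Cmod (w - z) < d by apply/RltP; exact: hw.
have /RleP := hd w hw.
congr (Rle (Cmod _) _).
by rewrite -[scal _ _]/((w - z) * l) -[minus (minus _ _) _]/(f w - f z - (w - z) * l) mulrC.
Qed.

(** The equation w - z = h (g w) - h (g z) = m (g w - g z) + o(g w - g z) first
    bounds g w - g z by a multiple of w - z, after which it is solved for
    g w - g z; this is why mere continuity of g is enough. *)
Lemma cderiv_inverse (g h : C -> C) z m r : 0 < r ->
  (forall w, Cmod (w - z) < r -> h (g w) = w) -> ccont g z ->
  cderiv h (g z) m -> m != 0 -> cderiv g z m^-1.
Proof.
move=> r0 hg cg dh m0 e e0.
have M0 : 0 < Cmod m by rewrite Cmod_gt0.
set t := Num.min (Cmod m / 2) (e * Cmod m ^+ 2 / 2).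
have t0 : 0 < t by rewrite lt_min !divr_gt0 ?mulr_gt0 ?exprn_gt0.
have tm : t <= Cmod m / 2 by rewrite /t ge_min lexx.
have te : t <= e * Cmod m ^+ 2 / 2 by rewrite /t ge_min lexx orbT.
have [d d0 hd] := dh t t0; have [d' d'0 hd'] := cg d d0.
exists (Num.min d' r); first by rewrite lt_min d'0.
move=> w; rewrite lt_min => /andP[/hd' /hd {}hd hw].
move: hd; rewrite !hg //; last by rewrite subrr Cmod0.
set k := g w - g z => hd.
have K0 := Cmod_ge0 k.
have hk : Cmod k * Cmod m <= 2 * Cmod (w - z).
  have : Cmod (m * k) <= Cmod (w - z) + Cmod (w - z - m * k).
    have {1}-> : m * k = (w - z) - (w - z - m * k) by ring.
    exact: CmodDB.
  rewrite CmodM; nra.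
have -> : k - m^-1 * (w - z) = - (m^-1 * (w - z - m * k)) by field.
rewrite CmodN CmodM CmodV mulrC ler_pdivrMr //.
apply: le_trans hd _.
have H1 : t * Cmod k <= e * Cmod m ^+ 2 / 2 * Cmod k by rewrite ler_wpM2r.
have H2 : e * Cmod m / 2 * (Cmod k * Cmod m) <= e * Cmod m / 2 * (2 * Cmod (w - z)).
  by rewrite ler_wpM2l // !mulr_ge0 ?(ltW e0) ?(ltW M0) // invr_ge0.
have H3 : e * Cmod m ^+ 2 / 2 * Cmod k = e * Cmod m / 2 * (Cmod k * Cmod m) by ring.
have H4 : e * Cmod m / 2 * (2 * Cmod (w - z)) = e * Cmod (w - z) * Cmod m by field.
lra.
Qed.

(** The factor c selects a direction of the plane on which f is projected, so
    that theorems on real functions of a real variable apply. *)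
Lemma cderiv_line (f : C -> C) c x u t l : cderiv f (x + RtoC t * u) l ->
  derivable_pt_lim (fun s => Re (c * f (x + RtoC s * u))) t (Re (c * (l * u))).
Proof.
move=> df e /RltP e0.
have k0 : 0 < Cmod c * Cmod u + 1 by rewrite ltr_wpDl ?mulr_ge0 ?Cmod_ge0.
have ek : 0 < e / (Cmod c * Cmod u + 1) / 2 by rewrite !divr_gt0.
have [d d0 hd] := df _ ek.
have d'0 : 0 < d / (Cmod u + 1) by rewrite divr_gt0 // ltr_wpDl ?Cmod_ge0.
exists (mkposreal _ (elimT RltP d'0)) => s /eqP s0 /RltP /=.
rewrite RabsE ltr_pdivlMr ?ltr_wpDl ?Cmod_ge0 // => hs.
apply/RltP; rewrite !RealsE.
set a' := f _; set b' := f _.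
have -> : (Re (c * a') - Re (c * b')) / s - Re (c * (l * u)) =
   Re (c * (a' - b' - l * (RtoC s * u))) / s.
  have -> : c * (a' - b' - l * (RtoC s * u)) =
    c * a' - c * b' - RtoC s * (c * (l * u)) by ring.
  rewrite !ReD !ReN; set rc := Re (c * (l * u)).
  have -> : Re (RtoC s * (c * (l * u))) = s * rc by rewrite ReM /= mul0r subr0.
  by move: (Re (c * a')) (Re (c * b')) rc => ra rb rc; field.
have E : x + RtoC (t + s) * u - (x + RtoC t * u) = RtoC s * u.
  by rewrite rmorphD; ring.
have := hd (x + RtoC (t + s) * u); rewrite E CmodM CmodR => /(_ _) hd2.
have {}hd2 := hd2 ltac:(have := normr_ge0 s; nra).
rewrite normrM normfV ltr_pdivrMr ?normr_gt0 //.
apply: le_lt_trans (Cmod_Re _) _; rewrite CmodM.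
apply: le_lt_trans (ler_wpM2l (Cmod_ge0 _) hd2) _.
have S0 : 0 < `|s| by rewrite normr_gt0.
have -> : Cmod c * (e / (Cmod c * Cmod u + 1) / 2 * (`|s| * Cmod u)) =
  (e * `|s|) * (Cmod c * Cmod u / (Cmod c * Cmod u + 1) / 2).
  by move: (Cmod c) (Cmod u) `|s| k0 => rc ru rs k0; field; rewrite gt_eqF.
rewrite -[ltRHS]mulr1 ltr_pM2l ?mulr_gt0 //.
by rewrite !ltr_pdivrMr //; lra.
Qed.

(** The real mean value theorem, for the projection of f on the direction of
    f y - f x along the segment from x to y. *)
Lemma cmean_value (f : C -> C) (l : R -> C) x y M :
  (forall t, 0 <= t <= 1 -> cderiv f (x + RtoC t * (y - x)) (l t) /\ Cmod (l t) <= M) ->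
  Cmod (f y - f x) <= M * Cmod (y - x).
Proof.
move=> h; set u := Cconj (f y - f x).
pose g t := Re (u * f (x + RtoC t * (y - x))).
pose dg t := Re (u * (l t * (y - x))).
have Hg t : 0 <= t <= 1 -> derivable_pt_lim g t (dg t).
  by move=> /h[df _]; apply: cderiv_line.
have Hd t : 0 <= t <= 1 -> is_derive g t (dg t).
  by move=> ht; apply/is_derive_Reals; apply: Hg.
have [||t [ht E]] := MVT_gen g 0 1 dg.
- move=> t; rewrite RminE RmaxE; rewrite (min_l ler01) (max_r ler01).
  by case=> /RltP a0 /RltP a1; apply: Hd; rewrite !ltW.
- move=> t; rewrite RminE RmaxE; rewrite (min_l ler01) (max_r ler01).
  case=> /RleP a0 /RleP a1; apply: derivable_continuous_pt.
  by exists (dg t); apply: Hg; rewrite a0.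
have {}ht : 0 <= t <= 1.
  move: ht; rewrite RminE RmaxE (min_l ler01) (max_r ler01).
  by case=> /RleP -> /RleP.
have {}E : Cmod (f y - f x) ^+ 2 = dg t.
  move: E; rewrite !RealsE subr0 mulr1 => <-.
  have -> : g 1 = Re (u * f y) by rewrite /g rmorph1 mul1r addrC subrK.
  have -> : g 0 = Re (u * f x) by rewrite /g rmorph0 mul0r addr0.
  rewrite -ReN -ReD -mulrBr.
  by rewrite mulrC CconjM.
have [_ hM] := h t ht.
have [->|n0] := eqVneq (f y - f x) 0.
  by rewrite Cmod0 mulr_ge0 ?Cmod_ge0 // (le_trans _ hM) ?Cmod_ge0.
rewrite -(ler_pM2l (_ : 0 < Cmod (f y - f x))) ?Cmod_gt0 // -expr2 E.
apply: le_trans (Re_le_Cmod _) _; rewrite !CmodM Cmod_conj.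
by rewrite ler_wpM2l ?Cmod_ge0 // ler_wpM2r ?Cmod_ge0.
Qed.

(** This does duty for the identity theorem: holomorphic functions are
    identified below through a combination of them with zero derivative. *)
Lemma cderiv0_const (f : C -> C) x y :
  (forall t, 0 <= t <= 1 -> cderiv f (x + RtoC t * (y - x)) 0) -> f y = f x.
Proof.
move=> h; apply/eqP; rewrite -subr_eq0 -Cmod_eq0 eq_le Cmod_ge0 andbT.
rewrite -(mul0r (Cmod (y - x))).
by apply: (@cmean_value f (fun=> 0)) => t /h h'; rewrite Cmod0.
Qed.

End ComplexCalculus.

(** * Complex power series with real coefficients *)

Section PowerSeries.
Implicit Types (x y z w : C) (a b : nat -> R).

Definition ccvg (u : nat -> C) z := forall e, 0 < e -> exists N, forall n,
  (N <= n)%N -> Cmod (u n - z) < e.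

Lemma ccvg_le u z M : ccvg u z -> (forall n, Cmod (u n) <= M) -> Cmod z <= M.
Proof.
move=> h hM; apply/ler_addgt0Pr => e /h[N /(_ N (leqnn _)) hN].
have -> : z = u N - (u N - z) by ring.
by apply: le_trans (CmodDB _ _) _; have := hM N; lra.
Qed.

Lemma ccvg_ext u v z : ccvg u z -> (forall n, u n = v n) -> ccvg v z.
Proof. by move=> h uv e /h[N hN]; exists N => n /hN; rewrite uv. Qed.

Lemma ccvg_const z : ccvg (fun=> z) z.
Proof. by move=> e e0; exists 0%N => n _; rewrite subrr Cmod0. Qed.

Lemma ccvgD u v z w : ccvg u z -> ccvg v w -> ccvg (fun n => u n + v n) (z + w).
Proof.
move=> hu hv e e0; have e20 : 0 < e / 2 by lra.
have [N hN] := hu _ e20; have [N' hN'] := hv _ e20.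
exists (maxn N N') => n; rewrite geq_max => /andP[/hN h1 /hN' h2].
have -> : u n + v n - (z + w) = (u n - z) + (v n - w) by ring.
by apply: le_lt_trans (CmodD _ _) _; lra.
Qed.

Lemma ccvgZ c u z : ccvg u z -> ccvg (fun n => c * u n) (c * z).
Proof.
move=> hu e e0; have k0 : 0 < Cmod c + 1 by rewrite ltr_wpDl ?Cmod_ge0.
have [N hN] := hu (e / (Cmod c + 1)) (divr_gt0 e0 k0).
exists N => n /hN; rewrite ltr_pdivlMr // => h.
rewrite -mulrBr CmodM; have := Cmod_ge0 (u n - z); have := Cmod_ge0 c; nra.
Qed.

Lemma ccvgS u z : ccvg u z -> ccvg (fun n => u n.+1) z.
Proof. by move=> h e /h[N hN]; exists N => n Nn; apply/hN/leqW. Qed.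

Lemma ccvg_unique u z w : ccvg u z -> ccvg u w -> z = w.
Proof.
move=> hz hw; apply/eqP; rewrite -subr_eq0 -Cmod_eq0 eq_le Cmod_ge0 andbT.
apply: (@ccvg_le (fun=> z - w)); first exact: ccvg_const.
move=> _; apply/ler_addgt0Pr => e e0; have e20 : 0 < e / 2 by lra.
have [N hN] := hz _ e20; have [N' hN'] := hw _ e20.
have := hN _ (leq_maxl N N'); have := hN' _ (leq_maxr N N').
set n := maxn _ _ => h2 h1; have -> : z - w = (u n - w) - (u n - z) by ring.
by apply: le_trans (CmodDB _ _) _; lra.
Qed.

Definition csum a z N := \sum_(k < N.+1) RtoC (a k) * z ^+ k.

(** Two real series, so that the sum is a total function; it is meaningful
    inside the disc of convergence, where incv holds. *)
Definition cps a z : C := (Series (fun n => Re (RtoC (a n) * z ^+ n)),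
                           Series (fun n => Im (RtoC (a n) * z ^+ n))).

Definition incv a z := Rbar_lt (Cmod z) (CV_radius a).

Lemma ex_series_abs a z : incv a z ->
  ex_series (fun n => Rabs (a n * pow (Cmod z) n)).
Proof.
move=> h; apply: CV_disk_inside.
by rewrite Rabs_pos_eq //; apply: Cmod_ge_0.
Qed.

Lemma incv_term a z n : Cmod (RtoC (a n) * z ^+ n) = Rabs (a n * pow (Cmod z) n).
Proof. by rewrite CmodM CmodR CmodX !RealsE normrM normrX (ger0_norm (Cmod_ge0 z)). Qed.

Lemma ex_series_Re_abs a z : incv a z ->
  ex_series (fun n => Rabs (Re (RtoC (a n) * z ^+ n))).
Proof.
move=> /ex_series_abs; apply: ex_series_le => n.
rewrite -incv_term; apply/RleP.
by rewrite -[norm _]/(Rabs _) Rabs_Rabsolu RabsE Cmod_Re.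
Qed.

Lemma ex_series_Im_abs a z : incv a z ->
  ex_series (fun n => Rabs (Im (RtoC (a n) * z ^+ n))).
Proof.
move=> /ex_series_abs; apply: ex_series_le => n.
rewrite -incv_term; apply/RleP.
by rewrite -[norm _]/(Rabs _) Rabs_Rabsolu RabsE Cmod_Im.
Qed.

Lemma sum_nE (u : nat -> R) n : sum_n u n = \sum_(k < n.+1) u k.
Proof. by rewrite sum_n_Reals sum_f_R0E big_mkord. Qed.

Lemma is_series_seq (u : nat -> R) (l : R) : is_series u l <->
  forall e, 0 < e -> exists N, forall n, (N <= n)%N -> `|\sum_(k < n.+1) u k - l| < e.
Proof.
split=> [h e e0|h].
  have [N hN] := h _ (locally_ball l (mkposreal e (elimT RltP e0))).
  exists N => n /ssrnat.leP /hN h'; rewrite -RabsE -sum_nE; apply/RltP; exact: h'.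
move=> P [e he]; have [N hN] := h e (introT RltP (cond_pos e)).
exists N => n /ssrnat.leP /hN h'; apply: he.
by move: h'; rewrite -RabsE -sum_nE => /RltP.
Qed.

Lemma is_series_partial_le (u : nat -> R) (l : R) N : (forall n, 0 <= u n) ->
  is_series u l -> \sum_(k < N.+1) u k <= l.
Proof.
move=> u0 h; rewrite -sum_nE; apply/RleP; apply: (is_lim_seq_incr_compare _ _ h) => n.
by rewrite sum_Sn; apply/RleP; rewrite -[plus _ _]/(Rplus _ _) RplusE lerDl.
Qed.

Lemma cps_cvg a z : incv a z -> ccvg (csum a z) (cps a z).
Proof.
move=> h e e0; have e20 : 0 < e / 2 by lra.
have /is_series_seq /(_ _ e20)[N hN] := Series_correct _ (ex_series_Rabs _ (ex_series_Re_abs h)).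
have /is_series_seq /(_ _ e20)[N' hN'] := Series_correct _ (ex_series_Rabs _ (ex_series_Im_abs h)).
exists (maxn N N') => n; rewrite geq_max => /andP[/hN h1 /hN' h2].
apply: le_lt_trans (Cmod_le_ReIm _) _.
rewrite ReD ImD ReN ImN /csum Re_sum Im_sum.
move: h1 h2; rewrite -/(Re (cps a z)) -/(Im (cps a z)).
lra.
Qed.

Lemma pow_nE (z : C) n : @pow_n C_Ring z n = z ^+ n.
Proof. by elim: n => //= n ->; rewrite exprS. Qed.

Lemma cps_is_pseries a z : incv a z ->
  @is_pseries C_AbsRing C_NormedModule (fun n => RtoC (a n)) z (cps a z).
Proof.
move=> /cps_cvg h P [e he].
have e0 : 0 < (e : R) := introT RltP (cond_pos e).
have e20 : 0 < (e : R) / 2 by rewrite divr_gt0.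
have [N hN] := h _ e20.
exists N => n /ssrnat.leP /hN h'; apply: he.
have -> : sum_n (fun k => scal (pow_n (K:=C_Ring) z k) (RtoC (a k) : C_NormedModule)) n = csum a z n.
  elim: n {h'} => [|n IH].
    by rewrite sum_O /csum big_ord1 [RHS]mulrC -pow_nE.
  have -> : csum a z n.+1 = csum a z n + z ^+ n.+1 * RtoC (a n.+1).
    by rewrite /csum big_ord_recr mulrC.
  by rewrite sum_Sn IH -pow_nE.
split; rewrite /ball /= /AbsRing_ball /abs /minus /plus /opp /=.
  by apply/RltP; rewrite -[Rplus _ _]/(Re (csum a z n - cps a z)) RabsE; have := Cmod_Re (csum a z n - cps a z); lra.
by apply/RltP; rewrite -[Rplus _ _]/(Im (csum a z n - cps a z)) RabsE; have := Cmod_Im (csum a z n - cps a z); lra.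
Qed.

Lemma cps_ext a b z : (forall n, a n = b n) -> cps a z = cps b z.
Proof. by move=> ab; congr pair; apply: Series_ext => n; rewrite ab. Qed.

Lemma csum_bound a z r N : Cmod z <= r ->
  Cmod (csum a z N) <= \sum_(k < N.+1) `|a k| * r ^+ k.
Proof.
move=> zr; apply: le_trans (Cmod_sum _ _ _) _; apply: ler_sum => k _.
by rewrite CmodM CmodR CmodX ler_wpM2l // lerXn2r ?nnegrE ?Cmod_ge0 // (le_trans _ zr) ?Cmod_ge0.
Qed.

Lemma cps_bound a z r M : incv a z -> Cmod z <= r ->
  (forall N, \sum_(k < N.+1) `|a k| * r ^+ k <= M) -> Cmod (cps a z) <= M.
Proof.
move=> h zr hM; apply: ccvg_le (cps_cvg h) _ => n.
exact: le_trans (csum_bound _ _ zr) (hM n).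
Qed.

(** Mertens' theorem, for each of the four products of real and imaginary parts. *)
Lemma cps_mul a b z : incv a z -> incv b z ->
  cps (fps_mul a b) z = cps a z * cps b z.
Proof.
move=> ha hb.
have hcut n : \sum_(k < n.+1) (RtoC (a k) * z ^+ k) * (RtoC (b (n - k)%N) * z ^+ (n - k)) =
    RtoC (fps_mul a b n) * z ^+ n.
  rewrite rmorph_sum mulr_suml; apply: eq_bigr => k _.
  rewrite rmorphM -!mulrA; congr (_ * _); rewrite mulrCA; congr (_ * _).
  by rewrite -exprD subnKC // -ltnS.
have R1 := Series_correct _ (ex_series_Rabs _ (ex_series_Re_abs ha)).
have I1 := Series_correct _ (ex_series_Rabs _ (ex_series_Im_abs ha)).
have R2 := Series_correct _ (ex_series_Rabs _ (ex_series_Re_abs hb)).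
have I2 := Series_correct _ (ex_series_Rabs _ (ex_series_Im_abs hb)).
apply: C_ext; rewrite ?ReM ?ImM.
  have S1 := is_series_mult _ _ _ _ R1 R2 (ex_series_Re_abs ha) (ex_series_Re_abs hb).
  have S2 := is_series_mult _ _ _ _ I1 I2 (ex_series_Im_abs ha) (ex_series_Im_abs hb).
  rewrite -[LHS]/(Series (fun n => Re (RtoC (fps_mul a b n) * z ^+ n))).
  apply: is_series_unique.
  apply: is_series_ext (is_series_minus _ _ _ _ S1 S2) => n.
  rewrite -hcut Re_sum -[LHS]/(Rplus _ (Ropp _)) RplusE RoppE !sum_f_R0E !big_mkord -sumrB.
  by apply: eq_bigr => k _; rewrite [in RHS]ReM.
have S1 := is_series_mult _ _ _ _ R1 I2 (ex_series_Re_abs ha) (ex_series_Im_abs hb).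
have S2 := is_series_mult _ _ _ _ I1 R2 (ex_series_Im_abs ha) (ex_series_Re_abs hb).
rewrite -[LHS]/(Series (fun n => Im (RtoC (fps_mul a b n) * z ^+ n))).
apply: is_series_unique.
apply: is_series_ext (is_series_plus _ _ _ _ S1 S2) => n.
rewrite -hcut Im_sum -[LHS]/(Rplus _ _) RplusE !sum_f_R0E !big_mkord -big_split.
by apply: eq_bigr => k _; rewrite [in RHS]ImM.
Qed.

Lemma incv_derive a z : incv a z -> incv (PS_derive a) z.
Proof. by rewrite /incv CV_radius_derive. Qed.

(** The remainder is bounded by the coefficient of r ^ (n - 1) in a series that
    is differentiated twice, which makes it summable in cps_deriv. *)
Lemma pow_taylor2 z w r n : Cmod z <= r -> Cmod w <= r ->
  Cmod (w ^+ n.+1 - z ^+ n.+1 - n.+1%:R * z ^+ n * (w - z)) <=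
  Cmod (w - z) ^+ 2 * (n.+1%:R * n%:R * r ^+ n.-1).
Proof.
move=> zr wr; have r0 : 0 <= r := le_trans (Cmod_ge0 _) zr.
elim: n => [|n IH]; first by rewrite !expr1 expr0 mulr1 mul1r subrr Cmod0 mulr0 mul0r mulr0.
have -> : w ^+ n.+2 - z ^+ n.+2 - n.+2%:R * z ^+ n.+1 * (w - z) =
  w * (w ^+ n.+1 - z ^+ n.+1 - n.+1%:R * z ^+ n * (w - z)) +
  n.+1%:R * (w - z) ^+ 2 * z ^+ n.
  rewrite !exprS -[n.+2]addn1 -[n.+1]addn1 !natrD; ring.
apply: le_trans (CmodD _ _) _; rewrite !CmodM !CmodX.
have H1 : Cmod w * Cmod (w ^+ n.+1 - z ^+ n.+1 - n.+1%:R * z ^+ n * (w - z)) <=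
   r * (Cmod (w - z) ^+ 2 * (n.+1%:R * n%:R * r ^+ n.-1)).
  by apply: ler_pM; rewrite ?Cmod_ge0.
have H2 : Cmod n.+1%:R * Cmod (w - z) ^+ 2 * Cmod z ^+ n <= n.+1%:R * Cmod (w - z) ^+ 2 * r ^+ n.
  have -> : n.+1%:R = RtoC n.+1%:R by rewrite rmorph_nat.
  rewrite CmodR_ge0 ?ler0n // ler_wpM2l ?mulr_ge0 ?exprn_ge0 ?Cmod_ge0 //.
  by rewrite lerXn2r ?nnegrE ?Cmod_ge0.
apply: le_trans (lerD H1 H2) _.
have -> : r * (Cmod (w - z) ^+ 2 * (n.+1%:R * n%:R * r ^+ n.-1)) =
   Cmod (w - z) ^+ 2 * (n.+1%:R * n%:R * r ^+ n).
  by case: n {IH H1 H2} => [|n] /=; rewrite ?expr0 ?[r ^+ n.+1]exprS; ring.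
rewrite /= -subr_ge0.
have -> : Cmod (w - z) ^+ 2 * (n.+2%:R * n.+1%:R * r ^+ n) -
  (Cmod (w - z) ^+ 2 * (n.+1%:R * n%:R * r ^+ n) + n.+1%:R * Cmod (w - z) ^+ 2 * r ^+ n) =
  n.+1%:R * Cmod (w - z) ^+ 2 * r ^+ n.
  rewrite -[n.+2]addn1 -[n.+1]addn1 !natrD; ring.
by rewrite !mulr_ge0 ?exprn_ge0 ?Cmod_ge0.
Qed.

(** Fix r between |z| and the radius of convergence.  By pow_taylor2 the first
    order remainder at w is at most |w - z|^2 times the sum K at r of the
    absolute values of the series differentiated twice. *)
Lemma cps_deriv a z : incv a z -> cderiv (cps a) z (cps (PS_derive a) z).
Proof.
move=> hz.
have [r [zr hr]] : exists r : R, Cmod z < r /\ Rbar_lt r (CV_radius a).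
  move: hz; rewrite /incv; case: (CV_radius a) => [s /= /RltP s1| _|//].
    by exists ((Cmod z + s) / 2); split; [|apply/RltP]; lra.
  by exists (Cmod z + 1); split=> //; lra.
have r0 : 0 < r := le_lt_trans (Cmod_ge0 _) zr.
have hin w : Cmod w <= r -> incv a w.
  by move=> wr; apply: Rbar_le_lt_trans hr; apply/RleP.
pose b := PS_derive (PS_derive a).
have : ex_series (fun n => Rabs (b n * pow r n)).
  apply: CV_disk_inside; rewrite !CV_radius_derive Rabs_pos_eq //.
  exact/RleP/ltW.
move=> /Series_correct; set K := Series _ => hK.
have PK n : \sum_(k < n.+1) Rabs (b k * pow r k) <= K.
  by apply: is_series_partial_le hK => k; apply/RleP/Rabs_pos.
have K0 : 0 <= K by apply: le_trans (PK 0%N); rewrite big_ord1; apply/RleP/Rabs_pos.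
have bK N : \sum_(k < N.+1) (k.+1%:R * k%:R * r ^+ k.-1) * `|a k.+1| <= K.
  case: N => [|N]; first by rewrite big_ord1 mulr0 !mul0r.
  rewrite big_ord_recl mulr0 !mul0r add0r; apply: le_trans (PK N).
  apply: ler_sum => k _; rewrite /b /PS_derive !RealsE /= normrM normrX (gtr0_norm r0).
  by rewrite !normrM !normr_nat /bump leq0n add1n add0n; rewrite le_eqVlt; apply/orP; left; apply/eqP; ring.
move=> e e0; exists (Num.min (r - Cmod z) (e / (K + 1))).
  by rewrite lt_min subr_gt0 zr divr_gt0 // ltr_wpDl.
move=> w; rewrite lt_min => /andP[h1]; rewrite ltr_pdivlMr ?ltr_wpDl // => h2.
have wr : Cmod w <= r.
  have -> : w = z + (w - z) by ring.
  by apply: le_trans (CmodD _ _) _; lra.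
suff H : Cmod (cps a w - cps a z - cps (PS_derive a) z * (w - z)) <= Cmod (w - z) ^+ 2 * K.
  apply: le_trans H _; rewrite mulrC expr2 mulrA ler_wpM2r ?Cmod_ge0 //.
  by have := Cmod_ge0 (w - z); nra.
pose u n := csum a w n.+1 + (-1) * csum a z n.+1 + (- (w - z)) * csum (PS_derive a) z n.
apply: (@ccvg_le u).
  have -> : cps a w - cps a z - cps (PS_derive a) z * (w - z) =
    cps a w + (-1) * cps a z + (- (w - z)) * cps (PS_derive a) z by ring.
  have hzi := cps_cvg (hin z (ltW zr)); have hwi := cps_cvg (hin w wr).
  have hdi := cps_cvg (incv_derive hz).
  exact: ccvgD (ccvgD (ccvgS hwi) (ccvgZ _ (ccvgS hzi))) (ccvgZ _ hdi).
move=> n; have -> : u n = \sum_(k < n.+1) RtoC (a k.+1) *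
    (w ^+ k.+1 - z ^+ k.+1 - k.+1%:R * z ^+ k * (w - z)).
  have cs x : csum a x n.+1 = RtoC (a 0%N) + \sum_(k < n.+1) RtoC (a k.+1) * x ^+ k.+1.
    by rewrite /csum big_ord_recl /= expr0 mulr1.
  rewrite /u !cs /csum.
  have -> (A B D E : C) : A + B + (-1) * (A + D) + E = B + (-1) * D + E by ring.
  rewrite !mulr_sumr -!big_split; apply: eq_bigr => k _ /=.
  rewrite /PS_derive !RealsE rmorphM rmorph_nat; ring.
apply: le_trans (Cmod_sum _ _ _) _.
apply: le_trans (ler_wpM2l (exprn_ge0 _ (Cmod_ge0 _)) (bK n)).
rewrite mulr_sumr; apply: ler_sum => k _.
rewrite CmodM CmodR mulrC mulrA ler_wpM2r //.
by apply: pow_taylor2 => //; apply: ltW.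
Qed.

Lemma cps_hol a z : incv a z -> hol (cps a) z.
Proof. by move=> h; eexists; apply: cps_deriv. Qed.

End PowerSeries.

(** * The exponential function *)

Section Exponential.
Implicit Types (x y z w u : C).

Definition ecoef n : R := (n`!)%:R^-1.

Lemma is_pseries_exp (x : R) : is_pseries ecoef x (exp x).
Proof.
apply: is_series_ext (is_exp_Reals x) => n.
by rewrite -[ecoef n]/(Rinv _) /ecoef -factE -INRE.
Qed.

Lemma incv_infinite (a : nat -> R) : (forall x : R, ex_pseries a x) ->
  forall z, incv a z.
Proof.
move=> h z; apply: (Rbar_lt_le_trans _ (Cmod z + 1)).
  by rewrite /=; apply/RltP; rewrite ltrDl.
apply: Rbar_not_lt_le => hlt.
have C10 : Rle 0 (Cmod z + 1) by apply/RleP; rewrite addr_ge0 ?Cmod_ge0.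
have := CV_disk_outside a (Cmod z + 1).
rewrite Rabs_pos_eq // => /(_ hlt); apply.
apply: is_lim_seq_ext (ex_series_lim_0 _ (h (Cmod z + 1))) => n.
by rewrite /= pow_n_pow -[scal _ _]/(Rmult _ _) Rmult_comm.
Qed.

Lemma incv_exp z : incv ecoef z.
Proof. by apply: incv_infinite => x; exists (exp x); apply: is_pseries_exp. Qed.

Definition cexp z := cps ecoef z.

Lemma cexp_deriv z : cderiv cexp z (cexp z).
Proof.
apply: cderiv_eq (cps_deriv (incv_exp z)) _; apply: cps_ext => n.
rewrite /PS_derive /ecoef !RealsE factS natrM; field.
by rewrite [1 + _]addrC natr1 !pnatr_eq0 -lt0n fact_gt0.
Qed.

Lemma cpsR (a : nat -> R) (x : R) : cps a (RtoC x) = RtoC (PSeries a x).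
Proof.
have E n : RtoC (a n) * RtoC x ^+ n = RtoC (a n * x ^+ n).
  by rewrite -rmorphXn -rmorphM.
apply: C_ext.
  rewrite -[LHS]/(Series (fun n => Re (RtoC (a n) * RtoC x ^+ n))).
  by apply: Series_ext => n; rewrite E RpowE.
rewrite -[LHS]/(Series (fun n => Im (RtoC (a n) * RtoC x ^+ n))).
rewrite -[RHS](Rmult_0_l (Series a)) -Series_scal_l.
by apply: Series_ext => n; rewrite E /= Rmult_0_l.
Qed.

Lemma cps0 (a : nat -> R) : cps a 0 = RtoC (a 0%N).
Proof. by rewrite -[0]/(RtoC 0) cpsR PSeries_0. Qed.

Lemma cexpR (x : R) : cexp (RtoC x) = RtoC (exp x).
Proof. by rewrite /cexp cpsR (is_pseries_unique _ _ _ (@is_pseries_exp x)). Qed.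

Lemma cexp0 : cexp 0 = 1.
Proof. by rewrite -[0]/(RtoC 0) cexpR exp_0. Qed.

(** The derivative of t |-> cexp t * cexp (c - t) vanishes. *)
Lemma cexpD z w : cexp (z + w) = cexp z * cexp w.
Proof.
pose c := z + w; pose f t := cexp t * cexp (c - t).
suff H : f z = f 0.
  move: H; rewrite /f cexp0 mul1r subr0 => <-.
  by congr (_ * cexp _); rewrite /c; ring.
apply: cderiv0_const => t _; set p := 0 + _.
have d2 : cderiv (fun t => c - t) p (- 1).
  by apply: cderiv_eq (cderivB (cderiv_const c p) (cderiv_id p)) _; rewrite sub0r.
apply: cderiv_eq (cderivM (cexp_deriv p) (cderiv_comp d2 (cexp_deriv _))) _.
ring.
Qed.

Lemma cexp_neq0 z : cexp z != 0.
Proof.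
apply/negP => /eqP h; have := cexpD z (- z); rewrite h mul0r subrr cexp0.
by apply/eqP; rewrite oner_eq0.
Qed.

Lemma cexpN z : cexp (- z) = (cexp z)^-1.
Proof.
apply: (mulfI (cexp_neq0 z)); rewrite -cexpD subrr cexp0 divff //.
exact: cexp_neq0.
Qed.

(** The real and imaginary parts of cexp (i y) satisfy the same linear
    differential system as cos and sin; the two combinations that express that
    the phases agree have zero derivative. *)
Lemma cexp_im (y : R) : cexp (0, y) = (cos y, sin y).
Proof.
pose g s : C := cexp (0 + RtoC s * Ci).
have gE s : g s = cexp (0, s).
  rewrite /g; congr cexp; apply: C_ext; rewrite ?ReD ?ImD ?ReM ?ImM /= !RealsE; ring.
have dg s c : derivable_pt_lim (fun s => Re (c * g s)) s (Re (c * (g s * Ci))).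
  by apply: cderiv_line; apply: cexp_deriv.
pose al s := Re (1 * g s); pose be s := Re (- Ci * g s).
have alE s : al s = Re (g s) by rewrite /al mul1r.
have beE s : be s = Im (g s) by rewrite /be ReM /= !RealsE; ring.
have dal s : derivable_pt_lim al s (- be s).
  have := dg s 1; rewrite -[X in derivable_pt_lim X]/al; congr derivable_pt_lim.
  by rewrite beE !ReM /= !RealsE; ring.
have dbe s : derivable_pt_lim be s (al s).
  have := dg s (- Ci); rewrite -[X in derivable_pt_lim X]/be; congr derivable_pt_lim.
  by rewrite alE !ReM /= !RealsE; ring.
have const0 f : (forall s, derivable_pt_lim f s 0) -> f y = f 0.
  move=> df; have [||c [_]] := MVT_gen f 0 y (fun=> 0).
  - by move=> s _; apply/is_derive_Reals.
  - by move=> s _; apply: derivable_continuous_pt; exists 0; apply: df.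
  by rewrite !RealsE mul0r => /eqP; rewrite subr_eq0 => /eqP.
have H1 : al y * cos y + be y * sin y = 1.
  pose f := (al * cos + be * sin)%F.
  have -> : al y * cos y + be y * sin y = f y by [].
  rewrite const0 => [|s]; last first.
    have := derivable_pt_lim_plus _ _ _ _ _
      (derivable_pt_lim_mult _ _ _ _ _ (dal s) (derivable_pt_lim_cos s))
      (derivable_pt_lim_mult _ _ _ _ _ (dbe s) (derivable_pt_lim_sin s)).
    by congr derivable_pt_lim; rewrite !RealsE; ring.
  rewrite /f /plus_fct /mult_fct cos_0 sin_0 alE gE (cexpR 0) exp_0 /= !RealsE; ring.
have H2 : be y * cos y - al y * sin y = 0.
  pose f := (be * cos - al * sin)%F.
  have -> : be y * cos y - al y * sin y = f y by [].
  rewrite const0 => [|s]; last first.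
    have := derivable_pt_lim_minus _ _ _ _ _
      (derivable_pt_lim_mult _ _ _ _ _ (dbe s) (derivable_pt_lim_cos s))
      (derivable_pt_lim_mult _ _ _ _ _ (dal s) (derivable_pt_lim_sin s)).
    by congr derivable_pt_lim; rewrite !RealsE; ring.
  rewrite /f /minus_fct /mult_fct cos_0 sin_0 beE gE (cexpR 0) /= !RealsE; ring.
have cs : cos y ^+ 2 + sin y ^+ 2 = 1.
  by have := sin2_cos2 y; rewrite /Rsqr !RealsE => <-; ring.
rewrite -gE; apply: C_ext; rewrite -?alE -?beE /=.
  transitivity ((al y * cos y + be y * sin y) * cos y - (be y * cos y - al y * sin y) * sin y).
    by rewrite -[LHS]mulr1 -cs; ring.
  by rewrite H1 H2; ring.
transitivity ((al y * cos y + be y * sin y) * sin y + (be y * cos y - al y * sin y) * cos y).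
  by rewrite -[LHS]mulr1 -cs; ring.
by rewrite H1 H2; ring.
Qed.

Lemma cexpE z : cexp z = (exp (Re z) * cos (Im z), exp (Re z) * sin (Im z)).
Proof.
have {1}-> : z = RtoC (Re z) + (0, Im z).
  by apply: C_ext; rewrite ?ReD ?ImD /= ?addr0 ?add0r.
by rewrite cexpD cexpR cexp_im; apply: C_ext; rewrite ?ReM ?ImM /=; rewrite ?RealsE; ring.
Qed.

Lemma Cmod_cexp z : Cmod (cexp z) = exp (Re z).
Proof.
have e0 : 0 <= exp (Re z) by apply/RleP/Rlt_le/exp_pos.
apply/eqP; rewrite -(@eqrXn2 _ 2) ?Cmod_ge0 // Cmod_sqr cexpE /= !exprMn -mulrDr.
have -> : cos (Im z) ^+ 2 + sin (Im z) ^+ 2 = 1.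
  by have := sin2_cos2 (Im z); rewrite /Rsqr !RealsE => <-; ring.
by rewrite mulr1.
Qed.

Lemma exp_le_mono (a b : R) : a <= b -> exp a <= exp b.
Proof.
rewrite le_eqVlt => /orP[/eqP -> //|/RltP h].
by apply/ltW/RltP/exp_increasing.
Qed.

Lemma cexp_lip z w (M : R) : Re z <= M -> Re w <= M ->
  Cmod (cexp w - cexp z) <= exp M * Cmod (w - z).
Proof.
move=> zM wM; apply: (@cmean_value _ (fun t => cexp (z + RtoC t * (w - z)))).
move=> t /andP[t0 t1]; split; first exact: cexp_deriv.
rewrite Cmod_cexp; apply: exp_le_mono.
rewrite ReD ReM ReR ImR mul0r subr0 ReD ReN.
have -> : Re z + t * (Re w - Re z) = (1 - t) * Re z + t * Re w by ring.
have -> : M = (1 - t) * M + t * M by ring.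
by rewrite lerD // ler_wpM2l // subr_ge0.
Qed.

(** The entire function (exp u - 1 - u) / u ^ 2. *)
Definition cexp2 u := cps (fun n => ecoef n.+2) u.

Lemma incv_exp2 u : incv (fun n => ecoef n.+2) u.
Proof.
have := incv_exp u; rewrite /incv.
by rewrite -CV_radius_decr_1 -CV_radius_decr_1.
Qed.

Lemma cps_shift (a : nat -> R) z : incv a z ->
  cps a z = RtoC (a 0%N) + z * cps (fun n => a n.+1) z.
Proof.
move=> h; have h' : incv (fun n => a n.+1) z by move: h; rewrite /incv -CV_radius_decr_1.
apply: ccvg_unique (ccvgS (cps_cvg h)) _.
apply: ccvg_ext (ccvgD (ccvg_const _) (ccvgZ z (cps_cvg h'))) _ => n.
rewrite /csum [RHS]big_ord_recl expr0 mulr1 mulr_sumr; congr (_ + _).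
by apply: eq_bigr => k _; rewrite /= /bump leq0n exprS; ring.
Qed.

Lemma cexp2E u : cexp u = 1 + u + u ^+ 2 * cexp2 u.
Proof.
have h1 : incv (fun n => ecoef n.+1) u.
  by have := incv_exp u; rewrite /incv -CV_radius_decr_1.
rewrite /cexp (cps_shift (incv_exp u)) (cps_shift h1).
by rewrite /ecoef /= !invr1 rmorph1 /cexp2; ring.
Qed.

Lemma cexp2_0 : cexp2 0 = RtoC 2^-1.
Proof. by rewrite /cexp2 cps0. Qed.

Definition cexp2' u := cps (PS_derive (fun n => ecoef n.+2)) u.
Lemma cexp2_deriv u : cderiv cexp2 u (cexp2' u).
Proof. exact: cps_deriv (incv_exp2 u). Qed.
Lemma cexp2'_cont u : ccont cexp2' u.
Proof. exact/hol_cont/cps_hol/incv_derive/incv_exp2. Qed.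
Lemma cexp_cont u : ccont cexp u.
Proof. exact: cderiv_cont (cexp_deriv u). Qed.

(** * Real-valued continuous functions of a complex variable *)

Definition rcont (f : C -> R) z := forall e, 0 < e -> exists2 d, 0 < d &
  forall w, Cmod (w - z) < d -> `|f w - f z| < e.

Lemma rcont_Re z : rcont Re z.
Proof. by move=> e e0; exists e => // w; apply: le_lt_trans (Cmod_Re _). Qed.
Lemma rcont_Im z : rcont Im z.
Proof. by move=> e e0; exists e => // w; apply: le_lt_trans (Cmod_Im _). Qed.
Lemma rcont_Cmod z : rcont Cmod z.
Proof.
move=> e e0; exists e => // w; apply: le_lt_trans.
rewrite ler_norml; apply/andP; split.
  have : Cmod z <= Cmod w + Cmod (w - z); last by lra.
  have {1}-> : z = w - (w - z) by ring.
  exact: CmodDB.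
have : Cmod w <= Cmod z + Cmod (w - z); last by lra.
have {1}-> : w = z + (w - z) by ring.
exact: CmodD.
Qed.
Lemma rcont_comp (g : R -> R) f z : rcont f z -> continuity_pt g (f z) ->
  rcont (fun w => g (f w)) z.
Proof.
move=> hf hg e e0; have [d [/RltP d0 hd]] := hg e (elimT RltP e0).
have [d' d'0 hd'] := hf d d0; exists d' => // w /hd' h.
have [E|n0] := eqVneq (f w) (f z); first by rewrite E subrr normr0.
have := hd (f w); rewrite /= /Rdist !RabsE => hh; apply/RltP/hh.
split; last exact/RltP.
by split=> //; apply/eqP; rewrite eq_sym.
Qed.
Lemma rcontD f g z : rcont f z -> rcont g z -> rcont (fun w => f w + g w) z.
Proof.
move=> hf hg e e0; have e20 : 0 < e / 2 by lra.
have [d d0 hd] := hf _ e20; have [d' d'0 hd'] := hg _ e20.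
exists (Num.min d d'); first by rewrite lt_min d0.
move=> w; rewrite lt_min => /andP[/hd {}hd /hd' {}hd'].
have -> : f w + g w - (f z + g z) = (f w - f z) + (g w - g z) by ring.
by apply: le_lt_trans (ler_normD _ _) _; lra.
Qed.
Lemma rcontM f g z : rcont f z -> rcont g z -> rcont (fun w => f w * g w) z.
Proof.
move=> hf hg e e0; pose K := `|f z| + `|g z| + 1.
have K0 : 0 < K by rewrite ltr_wpDl ?addr_ge0.
have e20 : 0 < Num.min 1 (e / (2 * K)) by rewrite lt_min ltr01 divr_gt0 ?mulr_gt0.
have [d d0 hd] := hf _ e20; have [d' d'0 hd'] := hg _ e20.
exists (Num.min d d'); first by rewrite lt_min d0.
move=> w; rewrite lt_min => /andP[/hd {}hd /hd' {}hd'].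
move: hd hd'; rewrite !lt_min => /andP[a1 a2] /andP[b1 b2].
have -> : f w * g w - f z * g z = (f w - f z) * (g w - g z) + (f w - f z) * g z + f z * (g w - g z) by ring.
move: a2 b2; rewrite !ltr_pdivlMr ?mulr_gt0 // => a2 b2.
apply: le_lt_trans (ler_normD _ _) _; apply: le_lt_trans (lerD (ler_normD _ _) (lexx _)) _.
rewrite !normrM; move: a1 a2 b1 b2; rewrite /K.
have := normr_ge0 (f w - f z); have := normr_ge0 (g w - g z).
have := normr_ge0 (f z); have := normr_ge0 (g z).
move: `|_| `|_| `|_| `|_| => A B D E *.
nra.
Qed.
Lemma ccont_ReIm f z : rcont (fun w => Re (f w)) z -> rcont (fun w => Im (f w)) z -> ccont f z.
Proof.
move=> hf hg e e0; have e20 : 0 < e / 2 by lra.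
have [d d0 hd] := hf _ e20; have [d' d'0 hd'] := hg _ e20.
exists (Num.min d d'); first by rewrite lt_min d0.
move=> w; rewrite lt_min => /andP[/hd {}hd /hd' {}hd'].
by apply: le_lt_trans (Cmod_le_ReIm _) _; rewrite ReD ImD ReN ImN; lra.
Qed.

End Exponential.

(** * Logarithm and square root *)

Section LogarithmAndRoot.
Implicit Types (x y z w u : C).

(** Used on the right half-plane only, where atan gives the argument without any
    case distinction. *)
Definition Log w : C := (ln (Cmod w), atan (Im w / Re w)).

Lemma Log_Im w : `|Im (Log w)| <= 2.
Proof.
have h := atan_bound (Im w / Re w); have h3 := PI_4.
rewrite ler_norml /=; have E : 2 = IZR 2 :> R by [].
by apply/andP; split; apply/RleP; rewrite E -?RoppE; Lra.lra.
Qed.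

Lemma Re_gt0_Cmod w : 0 < Re w -> 0 < Cmod w.
Proof. by move=> h; apply: lt_le_trans h (Re_le_Cmod w). Qed.

Lemma cexp_Log w : 0 < Re w -> cexp (Log w) = w.
Proof.
move=> a0; have m0 := Re_gt0_Cmod a0.
rewrite cexpE /Log /= exp_ln; last exact/RltP.
rewrite cos_atan sin_atan /Rsqr !RealsE.
have -> : Num.sqrt (1 + Im w / Re w * (Im w / Re w)) = Cmod w / Re w.
  have -> : 1 + Im w / Re w * (Im w / Re w) = (Cmod w / Re w) ^+ 2.
    by rewrite expr_div_n Cmod_sqr; field; rewrite gt_eqF.
  by rewrite sqrtr_sqr ger0_norm // divr_ge0 // ltW.
apply: C_ext => /=; rewrite ?RealsE; move: (Cmod w) (Re w) (Im w) m0 a0 => m a b m0 a0.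
  by field; rewrite !gt_eqF.
by field; rewrite !gt_eqF.
Qed.

Lemma Re_near w z : Cmod (w - z) < Re z -> 0 < Re w.
Proof.
move=> h; have := Cmod_Re (w - z); rewrite ReD ReN ler_norml => /andP[h1 _]; lra.
Qed.

Lemma Log_deriv w : 0 < Re w -> cderiv Log w w^-1.
Proof.
move=> a0; have m0 := Re_gt0_Cmod a0.
apply: (@cderiv_inverse _ cexp _ _ (Re w)) => //.
- by move=> z /Re_near; apply: cexp_Log.
- apply: ccont_ReIm; rewrite /Log /=.
    apply: rcont_comp (rcont_Cmod w) _.
    apply: derivable_continuous_pt; exists (/ Cmod w)%R.
    exact/derivable_pt_lim_ln/RltP.
  apply: (@rcont_comp atan); last first.
    exact: derivable_continuous_pt (derivable_pt_atan _).
  apply: rcontM (rcont_Im w) _; apply: (@rcont_comp Rinv _ _ (rcont_Re w)).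
  apply: continuity_pt_inv; first exact: derivable_continuous_pt (derivable_pt_id _).
  by apply/eqP; rewrite gt_eqF.
- by rewrite -[X in cderiv _ _ X]cexp_Log //; apply: cexp_deriv.
- by rewrite -Cmod_gt0.
Qed.

(** The complement of the half-line of nonpositive reals, in a form that is
    visibly open and gives the sign of the radicand below. *)
Definition offcut w := 0 < Cmod w + Re w.

(** The principal root, with positive real part. *)
Definition Csqrt w : C :=
  (Num.sqrt ((Cmod w + Re w) / 2), Im w / (2 * Num.sqrt ((Cmod w + Re w) / 2))).

Lemma Csqrt_Re w : offcut w -> 0 < Re (Csqrt w).
Proof. by move=> h; rewrite sqrtr_gt0 divr_gt0. Qed.

Lemma Csqrt_sqr w : offcut w -> Csqrt w ^+ 2 = w.
Proof.
move=> h; have := Csqrt_Re h; rewrite /Csqrt /=; set s := Num.sqrt _ => s0.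
have s2 : s ^+ 2 = (Cmod w + Re w) / 2 by rewrite sqr_sqrtr // ltW // divr_gt0.
have n0 : s != 0 by rewrite gt_eqF.
apply: C_ext; rewrite expr2 ?ReM ?ImM /= ?RealsE; last by field.
have -> : s * s - Im w / (2 * s) * (Im w / (2 * s)) = s ^+ 2 - Im w ^+ 2 / (4 * s ^+ 2).
  by move: (Im w) => b; field.
have -> : Im w ^+ 2 = Cmod w ^+ 2 - Re w ^+ 2 by rewrite Cmod_sqr; ring.
rewrite s2; move: h; rewrite /offcut; move: (Cmod w) (Re w) => m a h.
field; have : m + a != 0 by rewrite gt_eqF.
by move=> ->.
Qed.

Lemma rcont_offcut z : offcut z -> exists2 r, 0 < r & forall w, Cmod (w - z) < r -> offcut w.
Proof.
move=> h; have [d d0 hd] := rcontD (rcont_Cmod z) (rcont_Re z) h.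
exists d => // w /hd; rewrite /offcut ltr_norml => /andP[h1 _]; lra.
Qed.

Lemma Csqrt_hol w : offcut w -> hol Csqrt w.
Proof.
move=> h; have [r r0 hr] := rcont_offcut h; have s0 := Csqrt_Re h.
have n0 : Csqrt w != 0 by rewrite -Cmod_gt0; apply: Re_gt0_Cmod.
exists (2 * Csqrt w)^-1.
apply: (@cderiv_inverse _ (fun u => u * u) _ _ r) => //.
- by move=> z /hr /Csqrt_sqr; rewrite expr2.
- have hs : rcont (fun w => Num.sqrt ((Cmod w + Re w) / 2)) w.
    suff hs0 : rcont (fun w => sqrt ((Cmod w + Re w) / 2)) w.
      move=> e e0; have [d d0 hd] := hs0 e e0.
      by exists d => // z /hd; rewrite !RsqrtE.
    apply: (@rcont_comp sqrt); last first.
      by apply: continuity_pt_sqrt; apply/RleP; rewrite divr_ge0 // ltW.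
    apply: rcontM; first exact: rcontD (rcont_Cmod w) (rcont_Re w).
    by move=> e e0; exists 1 => // z _; rewrite subrr normr0.
  apply: ccont_ReIm => //.
  apply: rcontM (rcont_Im w) _; apply: (@rcont_comp Rinv).
    apply: rcontM => //.
    by move=> e e0; exists 1 => // z _; rewrite subrr normr0.
  apply: continuity_pt_inv; first exact: derivable_continuous_pt (derivable_pt_id _).
  by apply/eqP; rewrite gt_eqF // mulr_gt0.
- apply: cderiv_eq (cderivM (cderiv_id _) (cderiv_id _)) _; ring.
- rewrite mulf_neq0 //.
  by rewrite -[2]/(RtoC 1 + RtoC 1) -rmorphD -Cmod_gt0 CmodR normr_gt0; lra.
Qed.

Lemma Csqrt_mod w : offcut w -> Cmod (Csqrt w) ^+ 2 = Cmod w.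
Proof. by move=> h; rewrite -CmodX Csqrt_sqr. Qed.

End LogarithmAndRoot.

(** * Strict differentiability *)

Lemma notunit_ker (F : fieldType) n (A : 'M[F]_n) : A \notin unitmx ->
  exists2 y : 'cV[F]_n, y != 0 & A *m y = 0.
Proof.
rewrite -unitmx_tr -row_free_unit -kermx_eq0 => /rowV0Pn[v vK v0].
exists v^T; first by rewrite -(inj_eq trmx_inj) trmxK trmx0.
by apply: trmx_inj; rewrite trmx_mul trmxK trmx0; apply/sub_kermxP.
Qed.

Lemma sum_option (V : nmodType) (I : finType) (F : option I -> V) :
  \sum_j F j = F None + \sum_i F (Some i).
Proof.
rewrite (bigD1 None) //=; congr (_ + _).
rewrite (reindex_omap Some id); last by case.
by apply: eq_bigl => i; rewrite eqxx.
Qed.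

Lemma common_radius (I : finType) (P : I -> R -> Prop) :
  (forall i d d', 0 < d' -> d' <= d -> P i d -> P i d') ->
  (forall i, exists2 d, 0 < d & P i d) -> exists2 d, 0 < d & forall i, P i d.
Proof.
move=> mP hP.
have [d d0 hd] : exists2 d, 0 < d & forall i, i \in enum I -> P i d.
  elim: (enum I) => [|j s [d d0 hd]]; first by exists 1.
  have [d' d'0 hd'] := hP j.
  have m0 : 0 < Num.min d d' by rewrite lt_min d0.
  exists (Num.min d d') => // i; rewrite in_cons => /orP[/eqP ->|/hd].
    by apply: mP hd' => //; rewrite ge_min lexx orbT.
  by apply: mP => //; rewrite ge_min lexx.
by exists d => // i; apply: hd; rewrite mem_enum.
Qed.

Lemma common_rank (I : finType) (P : I -> nat -> Prop) :
  (forall i, exists N, forall n, (N <= n)%N -> P i n) ->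
  exists N, forall n, (N <= n)%N -> forall i, P i n.
Proof.
case/fin_all_exists => N hN; exists (\max_i N i)%N => n Nn i.
exact: hN (leq_trans (leq_bigmax i) Nn).
Qed.

Section StrictDiff.
Variable J : finType.
Implicit Types (f g : (J -> C) -> C) (a b c : J -> C) (l m : J -> C).

Definition cdist b c := \sum_j Cmod (b j - c j).

(** Both points are allowed to move.  With a fixed second point one would not get
    a contraction near a from a vanishing derivative at a alone. *)
Definition sdiff f a l := forall e, 0 < e -> exists2 d, 0 < d & forall b c,
  cdist b a < d -> cdist c a < d ->
  Cmod (f b - f c - \sum_j l j * (b j - c j)) <= e * cdist b c.

Lemma cdist_ge0 b c : 0 <= cdist b c.
Proof. by apply: sumr_ge0 => j _; apply: Cmod_ge0. Qed.

Lemma cdistxx b : cdist b b = 0.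
Proof. by apply: big1 => j _; rewrite subrr Cmod0. Qed.

Lemma cdistC b c : cdist b c = cdist c b.
Proof. by apply: eq_bigr => j _; rewrite CmodB. Qed.

Lemma cdist_tri c b a : cdist a b <= cdist a c + cdist c b.
Proof.
rewrite -big_split; apply: ler_sum => j _ /=.
have -> : a j - b j = (a j - c j) + (c j - b j) by ring.
exact: CmodD.
Qed.

Lemma cdist_coord b c j : Cmod (b j - c j) <= cdist b c.
Proof.
by rewrite /cdist (bigD1 j) //= lerDl sumr_ge0 // => k _; apply: Cmod_ge0.
Qed.

Lemma cdist_lin l b c : Cmod (\sum_j l j * (b j - c j)) <= (\sum_j Cmod (l j)) * cdist b c.
Proof.
apply: le_trans (Cmod_sum _ _ _) _; rewrite mulr_suml; apply: ler_sum => j _.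
by rewrite CmodM ler_wpM2l ?Cmod_ge0 ?cdist_coord.
Qed.

Lemma sdiff_eq f a l m : sdiff f a l -> (forall j, l j = m j) -> sdiff f a m.
Proof.
move=> h lm e /h[d d0 hd]; exists d => // b c hb hc.
by under eq_bigr do rewrite -lm; apply: hd.
Qed.

Lemma sdiff_ext f g a l : sdiff f a l -> (forall b, f b = g b) -> sdiff g a l.
Proof. by move=> h fg e /h[d d0 hd]; exists d => // b c; rewrite -!fg; apply: hd. Qed.

Lemma sdiff_const z a : sdiff (fun=> z) a (fun=> 0).
Proof.
move=> e e0; exists 1 => // b c _ _.
by rewrite subrr big1 ?subr0 ?Cmod0 ?mulr_ge0 ?cdist_ge0 ?ltW // => j _; rewrite mul0r.
Qed.

Lemma sdiff_proj i a : sdiff (fun b => b i) a (fun j => (j == i)%:R).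
Proof.
move=> e e0; exists 1 => // b c _ _.
rewrite (bigD1 i) //= eqxx mul1r big1 ?addr0 => [|j /negbTE->]; last by rewrite mul0r.
by rewrite subrr Cmod0 mulr_ge0 ?cdist_ge0 ?ltW.
Qed.

Lemma sdiffD f g a l m : sdiff f a l -> sdiff g a m ->
  sdiff (fun b => f b + g b) a (fun j => l j + m j).
Proof.
move=> hf hg e e0; have e20 : 0 < e / 2 by lra.
have [d d0 hd] := hf _ e20; have [d' d'0 hd'] := hg _ e20.
exists (Num.min d d'); first by rewrite lt_min d0.
move=> b c; rewrite !lt_min => /andP[b1 b2] /andP[c1 c2].
have {}hd := hd _ _ b1 c1; have {}hd' := hd' _ _ b2 c2.
under eq_bigr do rewrite mulrDl.
rewrite big_split /=; set S1 := (\sum_j l j * (b j - c j)) in hd *.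
set S2 := (\sum_j m j * (b j - c j)) in hd' *.
have -> : f b + g b - (f c + g c) - (S1 + S2) = (f b - f c - S1) + (g b - g c - S2) by ring.
by apply: le_trans (CmodD _ _) _; lra.
Qed.

Lemma sdiff_lip f a l : sdiff f a l ->
  exists2 d, 0 < d & forall b c, cdist b a < d -> cdist c a < d ->
    Cmod (f b - f c) <= (1 + \sum_j Cmod (l j)) * cdist b c.
Proof.
move=> /(_ 1 ltr01)[d d0 hd]; exists d => // b c hb hc.
have {}hd := hd b c hb hc.
have -> : f b - f c = (f b - f c - \sum_j l j * (b j - c j)) + \sum_j l j * (b j - c j) by ring.
apply: le_trans (CmodD _ _) _; rewrite mulrDl; apply: lerD => //.
exact: cdist_lin.
Qed.

Lemma sdiff_cont f a l : sdiff f a l -> forall e, 0 < e ->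
  exists2 d, 0 < d & forall b, cdist b a < d -> Cmod (f b - f a) < e.
Proof.
move=> /sdiff_lip; set K := 1 + _ => -[d d0 hd] e e0.
have K0 : 0 < K by rewrite ltr_wpDr // sumr_ge0 // => j _; apply: Cmod_ge0.
exists (Num.min d (e / K)); first by rewrite lt_min d0 divr_gt0.
move=> b; rewrite lt_min ltr_pdivlMr // => /andP[h1 h2].
by apply: le_lt_trans (hd _ _ h1 _) _; rewrite ?cdistxx // mulrC.
Qed.

Lemma sdiffM f g a l m : sdiff f a l -> sdiff g a m ->
  sdiff (fun b => f b * g b) a (fun j => l j * g a + f a * m j).
Proof.
move=> hf hg e e0.
pose L := 1 + \sum_j Cmod (l j); pose M := 1 + \sum_j Cmod (m j).
have L1 : 1 <= L by rewrite /L lerDl sumr_ge0 // => j _; apply: Cmod_ge0.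
have M1 : 1 <= M by rewrite /M lerDl sumr_ge0 // => j _; apply: Cmod_ge0.
pose K := L + M + Cmod (f a) + Cmod (g a) + 1.
have K0 : 0 < K by have := Cmod_ge0 (f a); have := Cmod_ge0 (g a); rewrite /K; lra.
pose t := Num.min 1 (e / (4 * K)).
have t0 : 0 < t by rewrite lt_min ltr01 divr_gt0 ?mulr_gt0.
have t1 : t <= 1 by rewrite /t ge_min lexx.
have tK : t * K <= e / 4.
  have -> : e / 4 = e / (4 * K) * K by field; rewrite gt_eqF.
  by rewrite ler_pM2r // /t ge_min lexx orbT.
have [d d0 hd] := hf _ t0; have [d' d'0 hd'] := hg _ t0.
have [c1 c10 hc1] := sdiff_cont hf t0; have [c2 c20 hc2] := sdiff_cont hg t0.
have [k1 k10 hk1] := sdiff_lip hf; have [k2 k20 hk2] := sdiff_lip hg.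
exists (Num.min (Num.min (Num.min d d') (Num.min c1 c2)) (Num.min k1 k2)).
  by rewrite !lt_min d0 d'0 c10 c20 k10 k20.
move=> b c; rewrite !lt_min.
case/andP => /andP[/andP[b1 b2] /andP[b3 b4]] /andP[b5 b6].
case/andP => /andP[/andP[a1 a2] /andP[a3 a4]] /andP[a5 a6].
have {}hd := hd _ _ b1 a1; have {}hd' := hd' _ _ b2 a2.
have {}hk1 := hk1 _ _ b5 a5; have {}hk2 := hk2 _ _ b6 a6.
have {}hc1 := hc1 _ a3; have {}hc2 := hc2 _ b4.
have -> : \sum_j (l j * g a + f a * m j) * (b j - c j) =
  (\sum_j l j * (b j - c j)) * g a + f a * (\sum_j m j * (b j - c j)).
  by rewrite mulr_suml mulr_sumr -big_split; apply: eq_bigr => j _ /=; ring.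
set S1 := (\sum_j l j * (b j - c j)) in hd *; set S2 := (\sum_j m j * (b j - c j)) in hd' *.
have -> : f b * g b - f c * g c - (S1 * g a + f a * S2) =
  ((f b - f c - S1) * g a + f a * (g b - g c - S2)) +
  ((f b - f c) * (g b - g a) + (f c - f a) * (g b - g c)) by ring.
have D0 := cdist_ge0 b c.
apply: le_trans (CmodD _ _) _.
apply: le_trans (lerD (CmodD _ _) (CmodD _ _)) _; rewrite !CmodM.
have E1 := ler_wpM2r (Cmod_ge0 (g a)) hd.
have E2 := ler_wpM2l (Cmod_ge0 (f a)) hd'.
have E3 : Cmod (f b - f c) * Cmod (g b - g a) <= L * cdist b c * t.
  by apply: ler_pM; rewrite ?Cmod_ge0 // ltW.
have E4 : Cmod (f c - f a) * Cmod (g b - g c) <= t * (M * cdist b c).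
  by apply: ler_pM; rewrite ?Cmod_ge0 // ltW.
have E5 : t * K * cdist b c <= e / 4 * cdist b c by rewrite ler_wpM2r.
have E6 : t * cdist b c * Cmod (g a) + Cmod (f a) * (t * cdist b c) +
  (L * cdist b c * t + t * (M * cdist b c)) + t * cdist b c = t * K * cdist b c.
  by rewrite /K; ring.
have E7 : 0 <= t * cdist b c by rewrite mulr_ge0 // ltW.
have E8 : 0 <= e * cdist b c by rewrite mulr_ge0 // ltW.
lra.
Qed.

Lemma sdiff_sum (I : Type) (r : seq I) (F : I -> (J -> C) -> C) (l : I -> J -> C) a :
  (forall i, sdiff (F i) a (l i)) ->
  sdiff (fun b => \sum_(i <- r) F i b) a (fun j => \sum_(i <- r) l i j).
Proof.
move=> h; elim: r => [|i r IH].
  apply: sdiff_ext (sdiff_eq (sdiff_const 0 a) _) _ => [j|b]; by rewrite big_nil.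
apply: sdiff_ext (sdiff_eq (sdiffD (h i) IH) _) _ => [j|b]; by rewrite big_cons.
Qed.

(** Strictness comes from the mean value inequality for z |-> phi z - phi' (f a) z,
    whose derivative is small near f a. *)
Lemma sdiff_comp (phi phi' : C -> C) f a l :
  (forall z, cderiv phi z (phi' z)) -> ccont phi' (f a) -> sdiff f a l ->
  sdiff (fun b => phi (f b)) a (fun j => phi' (f a) * l j).
Proof.
move=> dphi cphi hf e e0.
pose L := 1 + \sum_j Cmod (l j).
have L1 : 1 <= L by rewrite /L lerDl sumr_ge0 // => j _; apply: Cmod_ge0.
pose P := Cmod (phi' (f a)) + 1.
have P0 : 0 < P by rewrite ltr_wpDl ?Cmod_ge0.
have L0 : 0 < L by lra.
have e1 : 0 < e / (2 * L) by rewrite divr_gt0 ?mulr_gt0.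
have e2 : 0 < e / (2 * P) by rewrite divr_gt0 ?mulr_gt0.
have [r r0 hr] := cphi _ e1; have [d d0 hd] := hf _ e2.
have [c1 c10 hc1] := sdiff_cont hf r0; have [k1 k10 hk1] := sdiff_lip hf.
exists (Num.min (Num.min d c1) k1); first by rewrite !lt_min d0 c10 k10.
move=> b c; rewrite !lt_min => /andP[/andP[b1 /hc1 b2] b3] /andP[/andP[a1 /hc1 a2] a3].
have {}hd := hd _ _ b1 a1; have {}hk1 := hk1 _ _ b3 a3.
have -> : \sum_j phi' (f a) * l j * (b j - c j) = phi' (f a) * \sum_j l j * (b j - c j).
  by rewrite mulr_sumr; apply: eq_bigr => j _; rewrite mulrA.
set S1 := (\sum_j l j * (b j - c j)) in hd *.
have H : Cmod (phi (f b) - phi (f c) - phi' (f a) * (f b - f c)) <= e / (2 * L) * Cmod (f b - f c).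
  have -> : phi (f b) - phi (f c) - phi' (f a) * (f b - f c) =
    (phi (f b) - phi' (f a) * f b) - (phi (f c) - phi' (f a) * f c) by ring.
  pose G z := phi z - phi' (f a) * z.
  apply: (@cmean_value G (fun t => phi' (f c + RtoC t * (f b - f c)) - phi' (f a))).
  move=> t /andP[t0 t1]; split.
    apply: cderivB; first exact: dphi.
    by apply: cderiv_eq (cderivZ _ (cderiv_id _)) _; rewrite mulr1.
  apply/ltW/hr.
  have -> : f c + RtoC t * (f b - f c) - f a = RtoC (1 - t) * (f c - f a) + RtoC t * (f b - f a).
    by rewrite rmorphB rmorph1; ring.
  apply: le_lt_trans (CmodD _ _) _; rewrite !CmodM !CmodR_ge0 ?subr_ge0 //.
  apply: le_lt_trans (_ : Num.max (Cmod (f c - f a)) (Cmod (f b - f a)) < r); last by rewrite gt_max a2 b2.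
  set m' := Num.max _ _.
  have h1 : (1 - t) * Cmod (f c - f a) <= (1 - t) * m'.
    by rewrite ler_wpM2l ?subr_ge0 // /m' le_max lexx.
  have h2 : t * Cmod (f b - f a) <= t * m' by rewrite ler_wpM2l // /m' le_max lexx orbT.
  lra.
have -> : phi (f b) - phi (f c) - phi' (f a) * S1 =
  (phi (f b) - phi (f c) - phi' (f a) * (f b - f c)) + phi' (f a) * (f b - f c - S1) by ring.
apply: le_trans (CmodD _ _) _; rewrite CmodM.
have E1 : e / (2 * L) * Cmod (f b - f c) <= e / (2 * L) * (L * cdist b c) by rewrite ler_pM2l.
have E2 : e / (2 * L) * (L * cdist b c) = e / 2 * cdist b c by field; rewrite gt_eqF.
have E3 : Cmod (phi' (f a)) * Cmod (f b - f c - S1) <= P * (e / (2 * P) * cdist b c).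
  by apply: ler_pM; rewrite ?Cmod_ge0 // /P lerDl.
have E4 : P * (e / (2 * P) * cdist b c) = e / 2 * cdist b c by field; rewrite gt_eqF.
lra.
Qed.

End StrictDiff.

(** * Implicit functions *)

Definition clim (u : nat -> C) : C :=
  (Rbar.real (Lim_seq (fun n => Re (u n))), Rbar.real (Lim_seq (fun n => Im (u n)))).

Lemma is_lim_seqP (u : nat -> R) (l : R) : is_lim_seq u l <->
  forall e, 0 < e -> exists N, forall n, (N <= n)%N -> `|u n - l| < e.
Proof.
rewrite is_lim_seq_Reals; split=> h e e0.
  have [N hN] := h e (elimT RltP e0); exists N => n /ssrnat.leP /hN.
  by rewrite /Rdist RabsE => /RltP.
have [N hN] := h e (introT RltP e0); exists N => n /ssrnat.leP /hN.
by rewrite /Rdist RabsE => /RltP.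
Qed.

Section Geometric.
Variables (u : nat -> C) (c : R).
Hypothesis uc : forall n, Cmod (u n.+1 - u n) <= c / 2 ^+ n.

Let c_ge0 : 0 <= c.
Proof. by have := le_trans (Cmod_ge0 _) (uc 0%N); rewrite expr0 divr1. Qed.

Lemma geom_dist m k : Cmod (u (m + k)%N - u m) <= 2 * c / 2 ^+ m - 2 * c / 2 ^+ (m + k).
Proof.
elim: k => [|k IH]; first by rewrite addn0 !subrr Cmod0.
rewrite addnS.
have -> : u (m + k).+1 - u m = (u (m + k).+1 - u (m + k)%N) + (u (m + k)%N - u m) by ring.
apply: le_trans (CmodD _ _) _; have := uc (m + k).
have -> : 2 * c / 2 ^+ (m + k).+1 = c / 2 ^+ (m + k).
  by rewrite exprS; field; rewrite expf_neq0 // pnatr_eq0.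
move: IH; have -> : 2 * c / 2 ^+ (m + k) = 2 * (c / 2 ^+ (m + k)) by rewrite mulrA.
lra.
Qed.

Lemma geom_cvg : ccvg u (clim u).
Proof.
have small e : 0 < e -> exists N, forall n m, (N <= n)%N -> (N <= m)%N -> Cmod (u n - u m) < e.
  move=> e0; have /is_lim_seqP /(_ _ e0) [N hN] : is_lim_seq (fun n => Rmult (4 * c) (pow (/ IZR 2) n)) (Rbar.Finite 0).
    rewrite -[X in is_lim_seq _ X](Rbar_mult_0_r (Rbar.Finite (4 * c))); apply: is_lim_seq_scal_l.
    by apply: is_lim_seq_geom; rewrite Rabs_pos_eq; Lra.lra.
  exists N => n m Nn Nm.
  have hk k : (N <= k)%N -> Cmod (u k - u N) <= 2 * c / 2 ^+ N.
    move=> Nk; have := geom_dist N (k - N); rewrite subnKC //.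
    set t := 2 * c / 2 ^+ k; suff : 0 <= t by lra.
    by rewrite !mulr_ge0 // invr_ge0 exprn_ge0.
  have -> : u n - u m = (u n - u N) - (u m - u N) by ring.
  apply: le_lt_trans (CmodDB _ _) _.
  have := hN N (leqnn _); rewrite subr0 !RealsE => /(le_lt_trans (ler_norm _)).
  rewrite exprVn -[nat_of_pos 2]/2%N; have := hk n Nn; have := hk m Nm; lra.
have cv (f : C -> R) : (forall x y, f (x - y) = f x - f y) -> (forall x, `|f x| <= Cmod x) ->
   is_lim_seq (fun n => f (u n)) (Rbar.real (Lim_seq (fun n => f (u n)))).
  move=> fB fC; apply: Lim_seq_correct'; apply/ex_lim_seq_cauchy_corr => e.
  have [N hN] := small e (introT RltP (cond_pos e)); exists N => n m /ssrnat.leP Nn /ssrnat.leP Nm.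
  by apply/RltP; rewrite RabsE RminusE -fB (le_lt_trans (fC _)) // hN.
have hR := cv Re (fun x y => erefl) Cmod_Re; have hI := cv Im (fun x y => erefl) Cmod_Im.
move=> e e0; have e20 : 0 < e / 2 by lra.
have [N hN] := (is_lim_seqP _ _).1 hR _ e20.
have [N' hN'] := (is_lim_seqP _ _).1 hI _ e20.
exists (maxn N N') => n; rewrite geq_max => /andP[/hN h1 /hN' h2].
by apply: le_lt_trans (Cmod_le_ReIm _) _; rewrite ReD ImD ReN ImN -/(clim u); move: h1 h2 => /=; lra.
Qed.
End Geometric.

(** A point of C x C^d as a single family: None is the parameter and Some i the
    i-th unknown. *)
Definition cpt d (s : C) (x : 'I_d -> C) (o : option 'I_d) : C :=
  if o is Some i then x i else s.

Lemma cdist_cpt d s (x : 'I_d -> C) s' x' :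
  cdist (cpt s x) (cpt s' x') = Cmod (s - s') + cdist x x'.
Proof. by rewrite /cdist sum_option. Qed.

Section ImplicitFunction.
Variables (d : nat) (H : 'I_d -> (option 'I_d -> C) -> C) (s0 : C) (x0 : 'I_d -> C).
Variable l0 : 'I_d -> option 'I_d -> C.
Hypothesis Hsd : forall i a, exists l, sdiff (H i) a l.
Hypothesis Hl0 : forall i, sdiff (H i) (cpt s0 x0) (l0 i).
Hypothesis Hunit : \matrix_(i, j) l0 i (Some j) \in unitmx.
Hypothesis H0 : forall i, H i (cpt s0 x0) = 0.

Let K := invmx (\matrix_(i, j) l0 i (Some j)).
Let Phi i b := b (Some i) - \sum_k K i k * H k b.
Let SK := \sum_i \sum_k Cmod (K i k).

(** Newton's map with the Jacobian frozen at the base point: its derivative in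
    the unknowns vanishes there. *)
Let Phi_contr : exists r L, [/\ 0 < r, 0 <= L & forall s x s' x',
  cdist (cpt s x) (cpt s0 x0) < r -> cdist (cpt s' x') (cpt s0 x0) < r ->
  cdist (Phi^~ (cpt s x)) (Phi^~ (cpt s' x')) <= L * Cmod (s - s') + cdist x x' / 2].
Proof.
pose l i (j : option 'I_d) := (j == Some i)%:R + \sum_k (- K i k) * l0 k j.
have lS i j : l i (Some j) = 0.
  have := mulVmx Hunit => /matrixP /(_ i j); rewrite !mxE => E.
  rewrite /l; under eq_bigr do rewrite mulNr.
  rewrite sumrN; apply/eqP; rewrite subr_eq0; apply/eqP.
  by rewrite (inj_eq Some_inj) (eq_sym j i) -E; apply: eq_bigr => k _; rewrite mxE.
have dPhi i : sdiff (Phi i) (cpt s0 x0) (l i).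
  have h k : sdiff (fun b => - K i k * H k b) (cpt s0 x0) (fun j => - K i k * l0 k j).
    apply: sdiff_eq (sdiffM (sdiff_const (- K i k) _) (Hl0 k)) _ => j.
    by rewrite mul0r add0r.
  apply: sdiff_ext (sdiffD (sdiff_proj (Some i) _) (sdiff_sum _ h)) _ => b.
  by rewrite /Phi -sumrN; congr (_ + _); apply: eq_bigr => k _; rewrite mulNr.
pose e : R := (2 * (d.+1)%:R)^-1.
have e0 : 0 < e by rewrite invr_gt0 mulr_gt0 // ltr0n.
have [r r0 hr] : exists2 r, 0 < r & forall i b c,
    cdist b (cpt s0 x0) < r -> cdist c (cpt s0 x0) < r ->
    Cmod (Phi i b - Phi i c - \sum_j l i j * (b j - c j)) <= e * cdist b c.
  apply: common_radius => [i r r' r'0 rr' h b c hb hc|i]; last exact: dPhi.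
  by apply: h; apply: lt_le_trans rr'.
(* The tolerance e leaves the ratio 1/2 after summing over i. *)
exists r, (\sum_i Cmod (l i None) + 2^-1); split=> //.
  by rewrite addr_ge0 ?invr_ge0 // sumr_ge0 // => i _; apply: Cmod_ge0.
move=> s x s' x' hb hc; rewrite mulrDl mulr_suml -addrA.
apply: (@le_trans _ _ (\sum_i (Cmod (l i None) * Cmod (s - s') + e * cdist (cpt s x) (cpt s' x')))).
  apply: ler_sum => i _; have := hr i _ _ hb hc.
  rewrite sum_option (eq_bigr (fun=> 0)) => [|j _]; last by rewrite lS mul0r.
  rewrite big1_eq addr0 /= => h.
  have {1}-> : Phi i (cpt s x) - Phi i (cpt s' x') = l i None * (s - s') +
    (Phi i (cpt s x) - Phi i (cpt s' x') - l i None * (s - s')) by ring.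
  by apply: le_trans (CmodD _ _) _; rewrite CmodM lerD2l.
rewrite big_split /= lerD2l sumr_const card_ord cdist_cpt.
have D0 := cdist_ge0 x x'; have S0 := Cmod_ge0 (s - s').
apply: (@le_trans _ _ (d.+1%:R * (e * (Cmod (s - s') + cdist x x')))).
  by rewrite -[leLHS]mulr_natl ler_wpM2r ?ler_nat // mulr_ge0 ?addr_ge0 // ltW.
rewrite mulrA le_eqVlt; apply/orP; left; apply/eqP; rewrite /e; field.
by rewrite [1 + _]addrC natr1 pnatr_eq0.
Qed.

(** The solution X s is the limit of the iterates G s n of Phi; it is Lipschitz
    in s because Phi contracts with a ratio that does not depend on s.  Its
    differentiability at any s1 follows from the strict differentiability of H
    at (s1, X s1), once the Jacobian J1 there is known to be invertible.  This is
    also due to the contraction: along a vector y of the kernel of J1, Phi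
    would map the displacement t y to t y + o(t). *)
Lemma implicit_function : exists d0 (X : C -> 'I_d -> C), [/\ 0 < d0,
  X s0 =1 x0,
  forall s, Cmod (s - s0) < d0 -> forall i, H i (cpt s (X s)) = 0 &
  forall s, Cmod (s - s0) < d0 -> forall i, hol (fun s => X s i) s].
Proof.
have [r [L [r0 L0 hPhi]]] := Phi_contr.
pose G s n := iter n (fun x : 'I_d -> C => Phi^~ (cpt s x)) x0.
pose X s i := clim (fun n => G s n i).
pose M := 2 * L + 1.
have M0 : 0 < M by rewrite /M; lra.
pose d0 := r / (2 * M + 1).
have M1 : 0 < 2 * M + 1 by lra.
have d00 : 0 < d0 by rewrite divr_gt0.
have Phi0 i : Phi i (cpt s0 x0) = x0 i.
  by rewrite /Phi big1 ?subr0 // => k _; rewrite H0 mulr0.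
have dr s x : Cmod (s - s0) < d0 -> cdist x x0 <= 2 * (L * Cmod (s - s0)) ->
    cdist (cpt s x) (cpt s0 x0) < r.
  rewrite ltr_pdivlMr // cdist_cpt /M => h1 h2; have := Cmod_ge0 (s - s0); nra.
have GS s n : Cmod (s - s0) < d0 ->
   (cdist (G s n) x0 <= 2 * (L * Cmod (s - s0)) - 2 * (L * Cmod (s - s0)) / 2 ^+ n) /\
   (cdist (G s n.+1) (G s n) <= (L * Cmod (s - s0)) / 2 ^+ n).
  move=> hs; set q := L * Cmod (s - s0).
  have q0 : 0 <= q by rewrite mulr_ge0 ?Cmod_ge0.
  have p0 m : 0 <= q / 2 ^+ m by rewrite divr_ge0 ?exprn_ge0.
  elim: n => [|n [IH1 IH2]].
    rewrite /G /= expr0 !divr1 cdistxx subrr; split=> //.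
    have := hPhi s x0 s0 x0; rewrite (cdistxx x0) mul0r addr0.
    have -> : cdist (Phi^~ (cpt s x0)) (Phi^~ (cpt s0 x0)) = cdist (Phi^~ (cpt s x0)) x0.
      by apply: eq_bigr => i _; rewrite Phi0.
    apply; last by rewrite cdistxx.
    by apply: dr => //; rewrite cdistxx mulr_ge0 // mulr_ge0 // Cmod_ge0.
  have E2 : q / 2 ^+ n.+1 = q / 2 ^+ n / 2 by rewrite exprS; field; rewrite expf_neq0 // pnatr_eq0.
  have E1 m : 2 * q / 2 ^+ m = 2 * (q / 2 ^+ m) by rewrite mulrA.
  have B1 : cdist (G s n.+1) x0 <= 2 * q - 2 * q / 2 ^+ n.+1.
    apply: le_trans (cdist_tri (G s n) _ _) _.
    by move: IH1 IH2; rewrite !E1 E2; lra.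
  split=> //.
  have A1 : cdist (G s n) x0 <= 2 * q by move: IH1; rewrite E1; have := p0 n; lra.
  have A2 : cdist (G s n.+1) x0 <= 2 * q by move: B1; rewrite E1; have := p0 n.+1; lra.
  have := hPhi s (G s n.+1) s (G s n) (dr _ _ hs A2) (dr _ _ hs A1).
  rewrite subrr Cmod0 mulr0 add0r E2 => h; apply: le_trans h _.
  by rewrite ler_pM2r ?invr_gt0.
have GB s n : Cmod (s - s0) < d0 -> cdist (G s n) x0 <= 2 * (L * Cmod (s - s0)).
  move=> hs; have [h _] := GS s n hs; apply: le_trans h _.
  by rewrite gerBl divr_ge0 ?exprn_ge0 // !mulr_ge0 // Cmod_ge0.
have Xcv s i : Cmod (s - s0) < d0 -> ccvg (fun n => G s n i) (X s i).
  move=> hs; apply: (@geom_cvg _ (L * Cmod (s - s0))) => n.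
  exact: le_trans (cdist_coord (G s n.+1) (G s n) i) (GS s n hs).2.
have Xcd s e : Cmod (s - s0) < d0 -> 0 < e -> exists N, forall n, (N <= n)%N -> cdist (G s n) (X s) < e.
  move=> hs e0; pose e1 := e / d.+1%:R.
  have e10 : 0 < e1 by rewrite divr_gt0 // ltr0n.
  have [N hN] := common_rank (fun i => Xcv s i hs _ e10).
  exists N => n Nn; apply: (@le_lt_trans _ _ (\sum_(i < d) e1)).
    by apply: ler_sum => i _; apply/ltW; apply: (hN n Nn i).
  rewrite sumr_const card_ord -[ltLHS]mulr_natl /e1 mulrCA -[ltRHS]mulr1 ltr_pM2l //.
  by rewrite ltr_pdivrMr ?ltr0n // mul1r ltr_nat.
have XB s : Cmod (s - s0) < d0 -> cdist (X s) x0 <= 2 * (L * Cmod (s - s0)).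
  move=> hs; apply/ler_addgt0Pr => e e0; have [N hN] := Xcd s e hs e0.
  apply: le_trans (cdist_tri (G s N) _ _) _.
  by rewrite addrC lerD ?GB // cdistC ltW ?hN.
have Xin s : Cmod (s - s0) < d0 -> cdist (cpt s (X s)) (cpt s0 x0) < r.
  by move=> hs; apply: dr (XB s hs).
have Xfix s i : Cmod (s - s0) < d0 -> Phi i (cpt s (X s)) = X s i.
  move=> hs; apply/eqP; rewrite -subr_eq0 -Cmod_eq0 eq_le Cmod_ge0 andbT.
  apply: le_trans (cdist_coord (Phi^~ (cpt s (X s))) (X s) i) _.
  apply/ler_addgt0Pr => e e0; have e20 : 0 < e / 2 by lra.
  have [N hN] := Xcd s _ hs e20; rewrite add0r.
  apply: le_trans (cdist_tri (G s N.+1) _ _) _.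
  have := hPhi s (X s) s (G s N) (Xin s hs) (dr _ _ hs (GB s N hs)).
  rewrite subrr Cmod0 mulr0 add0r (cdistC (X s)).
  by have := hN N (leqnn _); have := hN N.+1 (leqnSn _); rewrite -/(G s N.+1) /=; lra.
have Hz s : Cmod (s - s0) < d0 -> forall i, H i (cpt s (X s)) = 0.
  move=> hs i.
  have KH : K *m (\col_k H k (cpt s (X s))) = 0.
    apply/matrixP => k j; rewrite !mxE; have := Xfix s k hs; rewrite /Phi.
    rewrite /= => /(congr1 (fun t => X s k - t)); rewrite subrr opprB addrC subrK => E.
    by rewrite -[RHS]E; apply: eq_bigr => m _; rewrite mxE.
  have : \col_k H k (cpt s (X s)) = 0.
    by rewrite -[LHS]mul1mx -(mulmxV Hunit) -mulmxA KH mulmx0.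
  by move=> /matrixP /(_ i ord0); rewrite !mxE.
have Xlip s s' : Cmod (s - s0) < d0 -> Cmod (s' - s0) < d0 ->
    cdist (X s) (X s') <= 2 * L * Cmod (s - s').
  move=> hs hs'; have := hPhi s (X s) s' (X s') (Xin s hs) (Xin s' hs').
  have -> : cdist (Phi^~ (cpt s (X s))) (Phi^~ (cpt s' (X s'))) = cdist (X s) (X s').
    by apply: eq_bigr => i _; rewrite !Xfix.
  lra.
exists d0, X; split=> //.
  move=> i; have hs : Cmod (s0 - s0) < d0 by rewrite subrr Cmod0.
  apply/eqP; rewrite -subr_eq0 -Cmod_eq0 eq_le Cmod_ge0 andbT.
  apply: le_trans (cdist_coord _ _ i) _; apply: le_trans (XB s0 hs) _.
  by rewrite subrr Cmod0 !mulr0.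
move=> s1 hs1 i0; set a1 := cpt s1 (X s1).
have [l hl] := fin_all_exists (fun i => Hsd i a1).
have hsd e : 0 < e -> exists2 r1, 0 < r1 & forall i b c, cdist b a1 < r1 -> cdist c a1 < r1 ->
    Cmod (H i b - H i c - \sum_j l i j * (b j - c j)) <= e * cdist b c.
  move=> e0; apply: common_radius => [i r1 r' r'0 rr' h b c hb hc|i]; last exact: hl.
  by apply: h; apply: lt_le_trans rr'.
pose J1 : 'M[C]_d := \matrix_(i, j) l i (Some j).
have SK0 : 0 <= SK by apply: sumr_ge0 => i _; apply: sumr_ge0 => k _; apply: Cmod_ge0.
have J1u : J1 \in unitmx.
  have [//|/notunit_ker[y y0 Jy]] := boolP (J1 \in unitmx); exfalso.
  pose ny := \sum_i Cmod (y i ord0).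
  have ny0 : 0 < ny.
    rewrite lt0r sumr_ge0 ?andbT => [|i _]; last exact: Cmod_ge0.
    apply: contraNneq y0 => /eqP; rewrite psumr_eq0 => [/allP h|i _]; last exact: Cmod_ge0.
    apply/eqP/matrixP => i j; rewrite ord1 mxE; apply/eqP.
    by rewrite -Cmod_eq0; apply: (implyP (h i _)) => //; rewrite mem_index_enum.
  have e0 : 0 < (4 * (SK + 1))^-1 by rewrite invr_gt0 mulr_gt0 // ltr_wpDl.
  have [r1 r10 hr1] := hsd _ e0.
  have t0 : 0 < r - cdist a1 (cpt s0 x0) by rewrite subr_gt0; apply: Xin.
  pose t := Num.min (r1 / (2 * ny)) ((r - cdist a1 (cpt s0 x0)) / (2 * ny)).
  have tp : 0 < t by rewrite lt_min !divr_gt0 ?mulr_gt0.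
  have tn : t * ny < r1 /\ t * ny < r - cdist a1 (cpt s0 x0).
    have h1 : t <= r1 / (2 * ny) by rewrite /t ge_min lexx.
    have h2 : t <= (r - cdist a1 (cpt s0 x0)) / (2 * ny) by rewrite /t ge_min lexx orbT.
    by move: h1 h2; rewrite !ler_pdivlMr ?mulr_gt0 //; split; lra.
  pose x1 i := X s1 i + RtoC t * y i ord0.
  have D1 : cdist x1 (X s1) = t * ny.
    rewrite /cdist /ny mulr_sumr; apply: eq_bigr => i _.
    by rewrite /x1 addrC addKr CmodM CmodR_ge0 // ltW.
  have D2 : cdist (cpt s1 x1) a1 = t * ny by rewrite cdist_cpt subrr Cmod0 add0r.
  have hb : cdist (cpt s1 x1) (cpt s0 x0) < r.
    by apply: le_lt_trans (cdist_tri a1 _ _) _; rewrite D2; have [_] := tn; lra.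
  have := hPhi s1 x1 s1 (X s1) hb (Xin s1 hs1); rewrite subrr Cmod0 mulr0 add0r D1.
  have : t * ny - t * ny / 4 <= cdist (Phi^~ (cpt s1 x1)) (Phi^~ a1).
    rewrite -{1}D1 lerBlDr.
    apply: le_trans (_ : cdist (Phi^~ (cpt s1 x1)) (Phi^~ a1) + \sum_i \sum_k Cmod (K i k) * ((4 * (SK + 1))^-1 * (t * ny)) <= _).
      rewrite -big_split; apply: ler_sum => i _.
      have -> : x1 i - X s1 i = (Phi i (cpt s1 x1) - Phi i a1) + \sum_k K i k * (H k (cpt s1 x1) - H k a1).
        have -> : \sum_k K i k * (H k (cpt s1 x1) - H k a1) =
            \sum_k K i k * H k (cpt s1 x1) - \sum_k K i k * H k a1.
          by rewrite -sumrB; apply: eq_bigr => k _; rewrite mulrBr.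
        by rewrite /Phi /=; ring.
      apply: le_trans (CmodD _ _) _; rewrite lerD2l.
      apply: le_trans (Cmod_sum _ _ _) _; apply: ler_sum => k _.
      rewrite CmodM ler_wpM2l ?Cmod_ge0 //.
      have := hr1 k (cpt s1 x1) a1; rewrite D2 cdistxx => /(_ tn.1 r10).
      rewrite sum_option subrr mulr0 add0r.
      suff -> : \sum_i1 l k (Some i1) * (cpt s1 x1 (Some i1) - a1 (Some i1)) = 0 by rewrite subr0.
      move/matrixP: Jy => /(_ k ord0); rewrite !mxE => E.
      rewrite -[RHS](mulr0 (RtoC t)) -[X in _ = _ * X]E mulr_sumr.
      by apply: eq_bigr => j _; rewrite mxE /= /x1; ring.
    rewrite lerD2l; under eq_bigr do rewrite -mulr_suml.
    rewrite -mulr_suml -/SK.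
    have n1 : SK + 1 != 0 by rewrite gt_eqF // ltr_wpDl.
    have -> : SK * ((4 * (SK + 1))^-1 * (t * ny)) = t * ny * (SK / (SK + 1)) / 4 by field.
    rewrite ler_pM2r ?invr_gt0 // -[leRHS]mulr1 ler_pM2l ?mulr_gt0 //.
    by rewrite ler_pdivrMr ?ltr_wpDl // mul1r lerDl.
  have : 0 < t * ny by rewrite mulr_gt0.
  lra.
pose N := invmx J1.
pose SN := \sum_k Cmod (N i0 k).
have SN0 : 0 <= SN by apply: sumr_ge0 => k _; apply: Cmod_ge0.
exists (- \sum_k N i0 k * l k None) => e e0.
have L1 : 0 < 1 + 2 * L by lra.
have k0 : 0 < (SN + 1) * (1 + 2 * L) by rewrite mulr_gt0 // ltr_wpDl.
have e1 : 0 < e / ((SN + 1) * (1 + 2 * L)) by rewrite divr_gt0.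
have [r1 r10 hr1] := hsd _ e1.
exists (Num.min (d0 - Cmod (s1 - s0)) (r1 / (1 + 2 * L))).
  by rewrite lt_min subr_gt0 hs1 divr_gt0.
move=> w; rewrite lt_min => /andP[h1]; rewrite ltr_pdivlMr // => h2.
have hw : Cmod (w - s0) < d0.
  have -> : w - s0 = (w - s1) + (s1 - s0) by ring.
  by apply: le_lt_trans (CmodD _ _) _; lra.
have Db : cdist (cpt w (X w)) a1 <= (1 + 2 * L) * Cmod (w - s1).
  by rewrite cdist_cpt; have := Xlip w s1 hw hs1; lra.
have Db1 : cdist (cpt w (X w)) a1 < r1 by apply: le_lt_trans Db _; lra.
pose E k := \sum_j l k j * (cpt w (X w) j - a1 j).
have hE k : Cmod (E k) <= e / ((SN + 1) * (1 + 2 * L)) * ((1 + 2 * L) * Cmod (w - s1)).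
  have := hr1 k _ a1 Db1; rewrite cdistxx => /(_ r10).
  rewrite Hz // Hz // subrr sub0r CmodN => h; apply: le_trans h _.
  by rewrite ler_pM2l.
have -> : X w i0 - X s1 i0 - (- \sum_k N i0 k * l k None) * (w - s1) = \sum_k N i0 k * E k.
  rewrite mulNr opprK mulr_suml.
  have -> : \sum_k N i0 k * E k = \sum_k N i0 k * l k None * (w - s1) +
      \sum_k N i0 k * \sum_j J1 k j * (X w j - X s1 j).
    rewrite -big_split; apply: eq_bigr => k _ /=.
    rewrite /E sum_option /= mulrDr mulrA; congr (_ + _ * _).
    by apply: eq_bigr => j _; rewrite mxE.
  rewrite addrC; congr (_ + _).
  pose V : 'cV[C]_d := \col_j (X w j - X s1 j).
  have : (N *m (J1 *m V)) i0 ord0 = V i0 ord0 by rewrite mulmxA mulVmx // mul1mx.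
  rewrite !mxE => <-; apply: eq_bigr => k _; rewrite mxE; congr (_ * _).
  by apply: eq_bigr => j _; rewrite !mxE.
apply: le_trans (Cmod_sum _ _ _) _.
set B := e / _ * _ in hE.
apply: (@le_trans _ _ (SN * B)).
  by rewrite mulr_suml; apply: ler_sum => k _; rewrite CmodM ler_wpM2l ?Cmod_ge0.
have n1 : SN + 1 != 0 by rewrite gt_eqF // ltr_wpDl.
have n2 : 1 + 2 * L != 0 by rewrite gt_eqF.
have -> : SN * B = e * Cmod (w - s1) * (SN / (SN + 1)) by rewrite /B; field; rewrite n1 n2.
rewrite -[leRHS]mulr1 ler_wpM2l ?mulr_ge0 ?Cmod_ge0 ?(ltW e0) //.
by rewrite ler_pdivrMr ?ltr_wpDl // mul1r lerDl.
Qed.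

End ImplicitFunction.

(** * Perron vectors of a critical nonnegative irreducible matrix *)

Section Perron.
Variables (d : nat) (A : 'M[R]_d) (i0 : 'I_d).
Hypothesis A0 : forall i j, 0 <= A i j.

Lemma mulmx_ge0 m (M : 'M[R]_(m, d)) (w : 'cV[R]_d) :
  (forall i j, 0 <= M i j) -> (forall i, 0 <= w i ord0) -> forall i, 0 <= (M *m w) i ord0.
Proof. by move=> M0 w0 i; rewrite mxE sumr_ge0 // => j _; rewrite mulr_ge0. Qed.

(** Otherwise take the least t such that z = w + t w' is nonnegative.  An entry of
    z vanishes, although z > M z >= 0 there. *)
Lemma nonneg_comparison (M : 'M[R]_d) (w' w : 'cV[R]_d) :
  (forall i j, 0 <= M i j) ->
  (forall i, 0 < w' i ord0) -> (forall i, (M *m w') i ord0 < w' i ord0) ->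
  (forall i, (M *m w) i ord0 < w i ord0) -> forall i, 0 <= w i ord0.
Proof.
move=> M0 w'0 hw' hw i.
pose f k := - w k ord0 / w' k ord0.
have [k _ hk] := @arg_maxP _ _ _ i predT f isT.
have {}hk j : f j <= f k by apply: hk.
have [t0|t0] := leP (f k) 0.
  have := le_trans (hk i) t0; rewrite /f ler_pdivrMr // mul0r.
  by rewrite oppr_le0.
pose z := w + f k *: w'.
have z0 j : 0 <= z j ord0.
  by have := hk j; rewrite {1}/f ler_pdivrMr // !mxE; lra.
have zk : z k ord0 = 0 by rewrite !mxE /f; field; rewrite gt_eqF.
have : (M *m z) k ord0 < z k ord0.
  rewrite mulmxDr -scalemxAr !mxE; have := hw k; have := hw' k.
  rewrite !mxE; have := t0; nra.
by rewrite zk ltNge mulmx_ge0.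
Qed.

Hypothesis Airr : forall i j, connect (fun k l => 0 < A k l) i j.

Lemma mxpow_ge0 k i j : 0 <= (A ^+ k) i j.
Proof.
elim: k i j => [|k IH] i j; first by rewrite expr0 mxE ler0n.
by rewrite exprS mxE sumr_ge0 // => l _; rewrite mulr_ge0.
Qed.

(** The sum of the first K powers of A, with K beyond the length of the paths
    that join any two indices. *)
Lemma irreducible_smoothing : exists K (B : 'M[R]_d), [/\ (0 < K)%N,
  forall i j, 0 < B i j, A *m B = B *m A,
  forall w : 'cV_d, A *m w = w -> B *m w = K%:R *: w &
  forall u : 'rV_d, u *m A = u -> u *m B = K%:R *: u].
Proof.
have hp i j : exists k, 0 < (A ^+ k) i j.
  have /connectP[p pp ->] := Airr i j; exists (size p).
  elim: p i pp => [|k p IH] i /=; first by rewrite mxE eqxx ltr01.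
  case/andP=> ik /IH h; rewrite exprS mxE (bigD1 k) //=.
  by rewrite ltr_pwDl ?mulr_gt0 // sumr_ge0 // => l _; rewrite mulr_ge0 ?mxpow_ge0.
have [f hf] := fin_all_exists (fun ij : 'I_d * 'I_d => hp ij.1 ij.2).
pose K := (\max_ij f ij).+1; exists K, (\sum_(k < K) A ^+ k); split=> //.
- move=> i j; have hK : (f (i, j) < K)%N by rewrite ltnS leq_bigmax.
  rewrite summxE (bigD1 (Ordinal hK)) //= ltr_pwDl ?(hf (i, j)) //.
  by rewrite sumr_ge0 // => k _; apply: mxpow_ge0.
- rewrite mulmx_sumr mulmx_suml; apply: eq_bigr => k _.
  by rewrite -[LHS]exprS exprSr.
- move=> w Aw; rewrite mulmx_suml (eq_bigr (fun=> w)) => [|k _].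
    by rewrite sumr_const card_ord scaler_nat.
  elim: (nat_of_ord k) => [|n IH]; first by rewrite expr0 mul1mx.
  by rewrite exprS -mulmxA IH.
move=> u uA; rewrite mulmx_sumr (eq_bigr (fun=> u)) => [|k _].
  by rewrite sumr_const card_ord scaler_nat.
elim: (nat_of_ord k) => [|n IH]; first by rewrite expr0 mulmx1.
by rewrite exprSr mulmxA IH.
Qed.

Lemma mulmx_gt0 (B : 'M[R]_d) (w : 'cV[R]_d) : (forall i j, 0 < B i j) ->
  (forall i, 0 <= w i ord0) -> w != 0 -> forall i, 0 < (B *m w) i ord0.
Proof.
move=> B0 w0 wn i; rewrite lt0r mulmx_ge0 ?andbT // => [|j k]; last exact: ltW.
apply: contraNneq wn; rewrite mxE => /eqP; rewrite psumr_eq0 => [/allP h|j _]; last first.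
  by rewrite mulr_ge0 // ltW.
apply/eqP/matrixP => j k; rewrite ord1 [RHS]mxE.
have := h j (mem_index_enum _); rewrite /= mulf_eq0 gt_eqF //= => /eqP //.
Qed.

Hypothesis Hsub : forall eta : R, 0 < eta < 1 -> exists2 w : 'cV[R]_d,
  forall i, 0 < w i ord0 & forall i, (1 - eta) * (A *m w) i ord0 < w i ord0.
Hypothesis Hsuper : forall w : 'cV[R]_d, (forall i, 0 < w i ord0) ->
  ~ (forall i, (A *m w) i ord0 < w i ord0).

(** If 1 - A were invertible, the solution w of w - A w = 1 would be nonnegative
    by comparison, hence a positive vector with A w < w. *)
Let det0 : 1%:M - A \notin unitmx.
Proof.
apply/negP => Iu; pose w := invmx (1%:M - A) *m (const_mx 1 : 'cV_d).
have Ew : (1%:M - A) *m w = const_mx 1 by rewrite mulmxA mulmxV // mul1mx.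
have {}Ew i : w i ord0 - (A *m w) i ord0 = 1.
  by move/matrixP: Ew => /(_ i ord0); rewrite mulmxBl mul1mx !mxE.
have [eta /andP[eta0 eta1] he] : exists2 eta, 0 < eta < 1 & forall i, eta * `|(A *m w) i ord0| < 1.
  have [|i|eta eta0 he] := @common_radius _ (fun (i : 'I_d) eta => eta * `|(A *m w) i ord0| < 1).
  - by move=> i e e' _ ee; apply: le_lt_trans; rewrite ler_wpM2r.
  - exists (`|(A *m w) i ord0| + 1)^-1; first by rewrite invr_gt0 ltr_wpDl.
    by rewrite mulrC ltr_pdivrMr ?ltr_wpDl // mul1r ltrDl.
  exists (Num.min eta 2^-1); first by rewrite lt_min eta0 invr_gt0 ltr0n /= gt_min; apply/orP; right; lra.
  by move=> i; apply: le_lt_trans (he i); rewrite ler_wpM2r // ge_min lexx.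
have [w' w'0 hw'] := Hsub (introT andP (conj eta0 eta1)).
have w0 : forall i, 0 <= w i ord0.
  apply: (@nonneg_comparison ((1 - eta) *: A) w') => // [i j|i|i].
  - by rewrite mxE mulr_ge0 // subr_ge0 ltW.
  - by rewrite -scalemxAl mxE.
  - rewrite -scalemxAl mxE; have := Ew i; have := he i.
    have := ler_norm (- (A *m w) i ord0); rewrite normrN; nra.
have w1 i : 1 <= w i ord0 by have := Ew i; have := mulmx_ge0 A0 w0 i; lra.
by apply: (Hsuper (w := w)) => i; [have := w1 i|have := Ew i]; lra.
Qed.

Let no_super (w : 'cV[R]_d) : (forall i, 0 < w i ord0) ->
  ~ (forall i, w i ord0 < (A *m w) i ord0).
Proof.
move=> w0 hw.
have [eta /andP[eta0 eta1] he] : exists2 eta, 0 < eta < 1 & forall i, w i ord0 < (1 - eta) * (A *m w) i ord0.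
  have [|i|eta eta0 he] := @common_radius _ (fun (i : 'I_d) eta => w i ord0 < (1 - eta) * (A *m w) i ord0).
  - move=> i e e' _ ee h; apply: lt_le_trans h _; rewrite ler_wpM2r ?mulmx_ge0 ?lerD2l ?lerN2 // => j.
    exact: ltW.
  - have a0 : 0 < (A *m w) i ord0 := lt_trans (w0 i) (hw i).
    exists (((A *m w) i ord0 - w i ord0) / (2 * (A *m w) i ord0)).
      by rewrite divr_gt0 ?subr_gt0 ?hw // mulr_gt0.
    have -> : (1 - ((A *m w) i ord0 - w i ord0) / (2 * (A *m w) i ord0)) * (A *m w) i ord0 =
       ((A *m w) i ord0 + w i ord0) / 2 by field; rewrite gt_eqF.
    have := hw i; lra.
  exists (Num.min eta 2^-1); first by rewrite lt_min eta0 invr_gt0 ltr0n /= gt_min; apply/orP; right; lra.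
  move=> i; apply: lt_le_trans (he i) _; rewrite ler_wpM2r ?mulmx_ge0 // => [j|]; first exact: ltW.
  by rewrite lerD2l lerN2 ge_min lexx.
have [w' w'0 hw'] := Hsub (introT andP (conj eta0 eta1)).
have : forall i, 0 <= (- w) i ord0.
  apply: (@nonneg_comparison ((1 - eta) *: A) w') => // [i j|i|i].
  - by rewrite mxE mulr_ge0 // subr_ge0 ltW.
  - by rewrite -scalemxAl mxE.
  - have -> : ((1 - eta) *: A *m - w) i ord0 = - ((1 - eta) * (A *m w) i ord0).
      by rewrite -scalemxAl mulmxN !mxE mulrN.
    by rewrite [ltRHS]mxE ltrN2.
by move=> /(_ i0); rewrite mxE oppr_ge0 leNgt w0.
Qed.

(** The hypotheses say that the spectral radius of A is neither above 1 (Hsub: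
    every smaller multiple of A has a positive vector that it decreases) nor
    below 1 (Hsuper).  By det0 there is a real y with A y = y, hence
    A |y| >= |y|.  Were this not an equality, smoothing |y| would give a positive
    w with A w > w, against no_super.  So |y| is the right eigenvector; pairing
    it with the absolute value of a left eigenvector gives the other one. *)
Lemma perron : exists (v : 'cV[R]_d) (u : 'rV[R]_d),
  [/\ forall i, 0 < v i ord0, forall i, 0 < u ord0 i, A *m v = v, u *m A = u &
      (u *m v) ord0 ord0 = 1 /\
      forall y : 'cV[R]_d, A *m y = y -> exists c : R, y = c *: v].
Proof.
have [K [B [K0 B0 AB BK uBK]]] := irreducible_smoothing.
have K0' : 0 < K%:R :> R by rewrite ltr0n.
have pos_eig (w : 'cV[R]_d) : A *m w = w -> (forall i, 0 <= w i ord0) -> w != 0 ->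
    forall i, 0 < w i ord0.
  move=> Aw w0 wn i; have := mulmx_gt0 B0 w0 wn i.
  by rewrite BK // mxE pmulr_rgt0.
have [y y0 Ay] := notunit_ker det0.
have {}Ay : A *m y = y by apply/esym/eqP; rewrite -subr_eq0 -{1}[y]mul1mx -mulmxBl Ay.
pose a : 'cV[R]_d := map_mx (fun t => `|t|) y.
have a0 i : 0 <= a i ord0 by rewrite mxE.
have an : a != 0.
  apply: contraNneq y0 => E; apply/eqP/matrixP => i j; rewrite ord1 [RHS]mxE.
  by apply/eqP; rewrite -normr_eq0; move/matrixP: E => /(_ i ord0); rewrite !mxE => ->.
have aA i : a i ord0 <= (A *m a) i ord0.
  rewrite mxE -{1}Ay !mxE; apply: le_trans (ler_norm_sum _ _ _) _.
  by apply: ler_sum => j _; rewrite normrM ger0_norm // mxE.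
have Av : A *m a = a.
  apply/eqP; rewrite -subr_eq0; apply: contraT => qn; exfalso.
  have q0 i : 0 <= (A *m a - a) i ord0 by have := aA i; rewrite !mxE; lra.
  apply: (@no_super (B *m a)) => i; first exact: mulmx_gt0.
  have := mulmx_gt0 B0 q0 qn i.
  by rewrite mulmxBr !mulmxA AB -!mulmxA [_ i _]mxE [X in _ + X]mxE subr_gt0.
have v0 := pos_eig a Av a0 an.
clearbody a.
have [z z0 Az] : exists2 z : 'cV[R]_d, z != 0 & (1%:M - A)^T *m z = 0.
  by apply: notunit_ker; rewrite unitmx_tr.
have {}Az : z^T *m A = z^T.
  apply/esym/eqP; rewrite -subr_eq0 -{1}[z^T]mulmx1 -mulmxBr.
  by rewrite -[_ - A]trmxK -trmx_mul Az trmx0.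
pose b : 'rV[R]_d := map_mx (fun t => `|t|) z^T.
have b0 i : 0 <= b ord0 i by rewrite !mxE.
have bn : b != 0.
  apply: contraNneq z0 => E; apply/eqP/matrixP => i j; rewrite ord1 [RHS]mxE.
  by apply/eqP; rewrite -normr_eq0; move/matrixP: E => /(_ ord0 i); rewrite !mxE => ->.
have bA i : b ord0 i <= (b *m A) ord0 i.
  rewrite mxE -{1}Az !mxE; apply: le_trans (ler_norm_sum _ _ _) _.
  by apply: ler_sum => j _; rewrite normrM [`|A _ _|]ger0_norm // !mxE.
have bAE : b *m A = b.
  have E : \sum_j ((b *m A) ord0 j - b ord0 j) * a j ord0 = 0.
    have : (b *m (A *m a)) ord0 ord0 - (b *m a) ord0 ord0 = 0 by rewrite Av subrr.
    rewrite mulmxA ![(_ *m a) _ _]mxE -sumrB => E; rewrite -[RHS]E.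
    by apply: eq_bigr => j _; rewrite mulrBl.
  move/eqP: E; rewrite psumr_eq0 => [/allP h|j _]; last by rewrite mulr_ge0 ?subr_ge0.
  apply/matrixP => i j; rewrite ord1.
  have := h j (mem_index_enum _); rewrite /= mulf_eq0 [a _ _ == 0]gt_eqF ?v0 // orbF subr_eq0.
  by move/eqP.
have bp i : 0 < b ord0 i.
  have : 0 < (B^T *m b^T) i ord0.
    apply: mulmx_gt0 => [j k|j|]; rewrite ?mxE //.
    by rewrite -(inj_eq trmx_inj) trmxK trmx0.
  by rewrite -trmx_mul uBK // !mxE pmulr_rgt0.
pose s := (b *m a) ord0 ord0.
have s0 : 0 < s.
  rewrite /s mxE (bigD1 i0) //= ltr_pwDl ?mulr_gt0 // sumr_ge0 // => j _.
  by rewrite mulr_ge0 // ltW.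
exists a, (s^-1 *: b); split=> //.
- by move=> i; rewrite mxE mulr_gt0 // invr_gt0.
- by rewrite -scalemxAl bAE.
split; first by rewrite -scalemxAl mxE mulVf // gt_eqF.
move=> x Ax; pose f k := x k ord0 / a k ord0.
have [k _ hk] := @arg_minP _ _ _ i0 predT f isT.
exists (f k); apply/eqP; rewrite -subr_eq0; apply: contraT => wn.
have : 0 < (x - f k *: a) k ord0.
  apply: pos_eig => // [|i]; first by rewrite mulmxBr -scalemxAr Ax Av.
  have fki : f k <= x i ord0 / a i ord0 := hk i isT.
  by move: fki; rewrite ler_pdivlMr // !mxE subr_ge0.
have -> : (x - f k *: a) k ord0 = 0.
  by rewrite /f !mxE; field; rewrite gt_eqF.
by rewrite ltxx.
Qed.

End Perron.

(** * Formal power series *)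

Lemma sum_triangle (V : nmodType) (F : nat -> nat -> V) N :
  \sum_(n < N) \sum_(k < n.+1) F k (n - k)%N = \sum_(k < N) \sum_(l < N - k) F k l.
Proof.
elim: N => [|N IH]; first by rewrite !big_ord0.
rewrite big_ord_recr IH /= [RHS]big_ord_recr /= subSnn big_ord1.
rewrite [X in _ + X]big_ord_recr /= subnn addrA -big_split /=.
congr (_ + _); apply: eq_bigr => k _.
by rewrite subSn ?big_ord_recr //= ltnW.
Qed.

Section FormalSeries.
Variable A : pzSemiRingType.
Implicit Types a b c : nat -> A.

Lemma fps_mulA a b c : fps_mul a (fps_mul b c) = fps_mul (fps_mul a b) c.
Proof.
apply: functional_extensionality => n; rewrite /fps_mul.
pose F k l := a k * b l * c (n - (k + l))%N.
transitivity (\sum_(k < n.+1) \sum_(l < n.+1 - k) F k l).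
  apply: eq_bigr => k _; rewrite mulr_sumr subSn -1?ltnS //.
  by apply: eq_bigr => l _; rewrite /F mulrA subnDA.
rewrite -sum_triangle; apply: eq_bigr => k _; rewrite mulr_suml.
by apply: eq_bigr => l _; rewrite /F subnKC // -ltnS.
Qed.

Lemma fps_mul1l a : fps_mul (fps_one A) a = a.
Proof.
apply: functional_extensionality => n.
by rewrite /fps_mul big_ord_recl big1 ?addr0 ?mul1r ?subn0 // => k _; rewrite mul0r.
Qed.

Lemma fps_mul1r a : fps_mul a (fps_one A) = a.
Proof.
apply: functional_extensionality => n.
rewrite /fps_mul big_ord_recr big1 /= ?add0r ?subnn ?mulr1 // => k _.
by rewrite /fps_one subn_eq0 leqNgt ltn_ord mulr0.
Qed.

Lemma fps_powS a k : fps_pow a k.+1 = fps_mul a (fps_pow a k).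
Proof. by []. Qed.

Lemma fps_powSr a k : fps_pow a k.+1 = fps_mul (fps_pow a k) a.
Proof.
elim: k => [|k IH]; first by rewrite /fps_pow /= fps_mul1l fps_mul1r.
by rewrite fps_powS {1}IH fps_mulA -fps_powS.
Qed.

Lemma fps_powD a j k : fps_mul (fps_pow a j) (fps_pow a k) = fps_pow a (j + k).
Proof.
elim: j => [|j IH]; first by rewrite fps_mul1l.
by rewrite fps_powS -fps_mulA IH.
Qed.

Lemma fps_pow_low a k n : a 0%N = 0 -> (n < k)%N -> fps_pow a k n = 0.
Proof.
move=> a0; elim: k n => [|k IH] n; first by rewrite ltn0.
rewrite ltnS => nk; rewrite fps_powS /fps_mul big_ord_recl a0 mul0r add0r.
apply: big1 => i _; rewrite IH ?mulr0 // (leq_trans _ nk) //.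
by case: n i nk => [|n] [i hi] // _; rewrite lift0 subSS ltnS leq_subr.
Qed.

Definition fps_deriv a n := a n.+1 *+ n.+1.

Lemma fps_deriv_mul a b n :
  fps_deriv (fps_mul a b) n = fps_mul (fps_deriv a) b n + fps_mul a (fps_deriv b) n.
Proof.
rewrite /fps_deriv /fps_mul -sumrMnl.
transitivity (\sum_(k < n.+2) (a k * b (n.+1 - k)%N *+ k + a k * b (n.+1 - k)%N *+ (n.+1 - k))).
  by apply: eq_bigr => k _; rewrite -mulrnDr subnKC // -ltnS.
rewrite big_split /=; congr (_ + _).
  rewrite big_ord_recl mulr0n add0r; apply: eq_bigr => k _.
  by rewrite lift0 subSS mulrnAl.
rewrite big_ord_recr /= subnn mulr0n addr0; apply: eq_bigr => k _.
by rewrite subSn -1?ltnS // mulrnAr.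
Qed.

End FormalSeries.

Lemma fps_mulC (A : comPzSemiRingType) (a b : nat -> A) : fps_mul a b = fps_mul b a.
Proof.
apply: functional_extensionality => n; rewrite /fps_mul.
rewrite (reindex_inj rev_ord_inj) /=; apply: eq_bigr => k _.
by rewrite subSS mulrC subKn // -ltnS.
Qed.

Lemma fps_deriv_pow (A : comPzSemiRingType) (a : nat -> A) k n :
  fps_deriv (fps_pow a k.+1) n = fps_mul (fps_deriv a) (fps_pow a k) n *+ k.+1.
Proof.
elim: k n => [|k IH] n.
  by rewrite fps_powS /fps_pow /= !fps_mul1r mulr1n.
rewrite fps_powS fps_deriv_mul [RHS]mulrS; congr (_ + _).
have -> : fps_deriv (fps_pow a k.+1) = fun n => fps_mul (fps_deriv a) (fps_pow a k) n *+ k.+1.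
  exact: functional_extensionality.
transitivity (fps_mul a (fps_mul (fps_deriv a) (fps_pow a k)) n *+ k.+1).
  by rewrite /fps_mul -sumrMnl; apply: eq_bigr => i _; rewrite mulrnAr.
by rewrite fps_mulA (fps_mulC a) -fps_mulA -fps_powS.
Qed.

(** The identity (exp a)' = a' exp a determines fps_exp a analytically below. *)
Lemma fps_exp_deriv (a : nat -> R) n : a 0%N = 0 ->
  fps_deriv (fps_exp a) n = fps_mul (fps_deriv a) (fps_exp a) n.
Proof.
move=> a0; rewrite /fps_deriv /fps_exp big_ord_recl.
rewrite (_ : fps_pow a 0 n.+1 = 0) // mul0r add0r -sumrMnl.
transitivity (\sum_(k < n.+1) \sum_(m < n.+1) (a m.+1 *+ m.+1) * (fps_pow a k (n - m) / k`!%:R)).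
  apply: eq_bigr => k _; rewrite lift0.
  rewrite -mulrnAl -[_ *+ n.+1]/(fps_deriv (fps_pow a k.+1) n) fps_deriv_pow.
  rewrite factS natrM -mulr_natl invfM mulrACA divff ?pnatr_eq0 // mul1r.
  by rewrite /fps_mul mulr_suml; apply: eq_bigr => m _; rewrite mulrA.
rewrite exchange_big; apply: eq_bigr => m _; rewrite -mulr_sumr; congr (_ * _).
rewrite /= [RHS](big_ord_widen n.+1 (fun k => fps_pow a k (n - m) / k`!%:R)) ?ltnS ?leq_subr //.
rewrite big_mkcond [RHS]big_mkcond; apply: eq_bigr => k _; case: ifP => // /negbT.
by rewrite -leqNgt => h; rewrite fps_pow_low ?mul0r.
Qed.

Section Trace.
Variables (d : nat) (A : nat -> 'M[R]_d).

Lemma tr_fps_mulC (B D : nat -> 'M[R]_d) n : \tr (fps_mul B D n) = \tr (fps_mul D B n).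
Proof.
rewrite /fps_mul !raddf_sum (reindex_inj rev_ord_inj) /=.
apply: eq_bigr => k _; rewrite subSS [in RHS]mxtrace_mulC subKn //.
by rewrite -ltnS.
Qed.

(** Although A and its derivative do not commute, the trace allows each of the
    k + 1 terms of the derivative of A^(k + 1) to be rotated to A^k A'. *)
Lemma tr_fps_deriv_pow j k n :
  \tr (fps_mul (fps_pow A j) (fps_deriv (fps_pow A k.+1)) n) =
  \tr (fps_mul (fps_pow A (j + k)) (fps_deriv A) n) *+ k.+1.
Proof.
elim: k j n => [|k IH] j n.
  by rewrite mulr1n addn0 fps_powS /fps_pow /= fps_mul1r.
have -> : fps_deriv (fps_pow A k.+2) =
   fun n => fps_mul (fps_deriv A) (fps_pow A k.+1) n + fps_mul A (fps_deriv (fps_pow A k.+1)) n.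
  by apply: functional_extensionality => m; rewrite fps_powS fps_deriv_mul.
transitivity (\tr (fps_mul (fps_pow A j) (fps_mul (fps_deriv A) (fps_pow A k.+1)) n) +
  \tr (fps_mul (fps_pow A j) (fps_mul A (fps_deriv (fps_pow A k.+1))) n)).
  rewrite -raddfD; congr (\tr _); rewrite /fps_mul -big_split.
  by apply: eq_bigr => i _; rewrite /= mulrDr.
rewrite fps_mulA tr_fps_mulC fps_mulA fps_powD [(k.+1 + j)%N]addnC.
by rewrite fps_mulA -fps_powSr IH addSnnS -mulrS.
Qed.

(** The series (1 - A)^-1, for A without constant term: powers beyond the n-th do
    not contribute to the n-th coefficient. *)
Definition fps_geom n := \sum_(k < n.+1) fps_pow A k n.

Hypothesis A0 : A 0%N = 0.

Lemma fps_geomE n : fps_geom n = fps_one _ n + fps_mul A fps_geom n.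
Proof.
rewrite /fps_geom big_ord_recl; congr (_ + _).
transitivity (\sum_(k < n) \sum_(m < n.+1) A m * fps_pow A k (n - m)%N) => //.
rewrite exchange_big /fps_mul; apply: eq_bigr => m _ /=.
rewrite -mulr_sumr; case: m => -[|m] hm /=; first by rewrite A0 !mul0r.
congr (_ * _); rewrite ltnS in hm.
have h : ((n - m.+1).+1 <= n)%N by rewrite subnSK // leq_subr.
rewrite [RHS](big_ord_widen n (fun k => fps_pow A k (n - m.+1))) //.
rewrite big_mkcond [RHS]big_mkcond; apply: eq_bigr => k _; case: ifP => // /negbT.
by rewrite -leqNgt => h'; rewrite fps_pow_low.
Qed.

End Trace.

(** The formal identity C' = tr ((1 - A)^-1 A'). *)
Lemma cycle_egf_deriv d (W : 'M[R]_d) (T : 'I_d -> nat -> R) n :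
  (forall i, T i 0%N = 0) ->
  fps_deriv (cycle_egf W T) n =
  \tr (fps_mul (fps_geom (transfer_matrix W T)) (fps_deriv (transfer_matrix W T)) n).
Proof.
move=> T0; set A := transfer_matrix W T.
have A0 : A 0%N = 0.
  apply/matrixP => i j; rewrite /A /transfer_matrix mul_diag_mx !mxE T0 mul0r //.
rewrite /fps_deriv /cycle_egf big_add1 /= big_mkord -/A -sumrMnl.
transitivity (\sum_(k < n.+1) \tr (fps_mul (fps_pow A k) (fps_deriv A) n)).
  apply: eq_bigr => k _; have := tr_fps_deriv_pow A 0 k n.
  rewrite fps_mul1l add0n /fps_deriv raddfMn /= => E.
  by rewrite -mulrnAl E -[X in X / _]mulr_natr mulfK // pnatr_eq0.
rewrite -raddf_sum; congr (\tr _); rewrite /fps_mul exchange_big; apply: eq_bigr => m _ /=.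
rewrite -mulr_suml; congr (_ * _); rewrite /fps_geom.
rewrite [RHS](big_ord_widen n.+1 (fun k => fps_pow A k m)) //.
rewrite big_mkcond [RHS]big_mkcond; apply: eq_bigr => k _; case: ifP => // /negbT.
by rewrite -leqNgt => h'; rewrite fps_pow_low.
Qed.

(** * The tree functions up to the critical point *)

Lemma fps_pow_ge0 (a : nat -> R) n k : (forall m, (m <= n)%N -> 0 <= a m) ->
  forall m, (m <= n)%N -> 0 <= fps_pow a k m.
Proof.
move=> a0; elim: k => [|k IH] m mn; first by rewrite ler0n.
rewrite fps_powS sumr_ge0 // => l _; rewrite mulr_ge0 ?a0 ?IH //.
  by rewrite (leq_trans _ mn) // -ltnS.
by rewrite (leq_trans (leq_subr _ _)).
Qed.

Lemma fps_exp_ge0 (a : nat -> R) n : (forall m, (m <= n)%N -> 0 <= a m) -> 0 <= fps_exp a n.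
Proof.
move=> a0; rewrite sumr_ge0 // => k _.
by rewrite divr_ge0 ?ler0n // (fps_pow_ge0 k a0).
Qed.

Definition psum (a : nat -> R) (x : R) N := \sum_(n < N.+1) a n * x ^+ n.

Lemma psum_ge0 a x N : (forall n, 0 <= a n) -> 0 <= x -> 0 <= psum a x N.
Proof. by move=> a0 x0; rewrite sumr_ge0 // => n _; rewrite mulr_ge0 ?exprn_ge0. Qed.

Lemma psum_mul_le a b x N : (forall n, 0 <= a n) -> (forall n, 0 <= b n) -> 0 <= x ->
  psum (fps_mul a b) x N <= psum a x N * psum b x N.
Proof.
move=> a0 b0 x0; pose F k l := (a k * x ^+ k) * (b l * x ^+ l).
have F0 k l : 0 <= F k l by rewrite !mulr_ge0 ?exprn_ge0.
have -> : psum (fps_mul a b) x N = \sum_(n < N.+1) \sum_(k < n.+1) F k (n - k)%N.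
  apply: eq_bigr => n _; rewrite /fps_mul mulr_suml; apply: eq_bigr => k _.
  rewrite /F mulrACA -exprD subnKC // -ltnS //.
rewrite sum_triangle /psum mulr_suml; apply: ler_sum => k _; rewrite mulr_sumr.
rewrite (big_ord_widen N.+1 (F k)) ?leq_subr // big_mkcond.
by apply: ler_sum => l _; case: ifP => // _; apply: F0.
Qed.

Lemma psum_pow_le a x N k : (forall n, 0 <= a n) -> 0 <= x ->
  psum (fps_pow a k) x N <= psum a x N ^+ k.
Proof.
move=> a0 x0; elim: k => [|k IH].
  rewrite expr0 /psum big_ord_recl big1 ?addr0 ?mulr1 // => n _.
  by rewrite mul0r.
rewrite exprS; apply: le_trans (psum_mul_le N a0 _ x0) _ => [n|].
  by apply: (@fps_pow_ge0 a n) => //.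
by rewrite ler_wpM2l ?psum_ge0.
Qed.

Lemma exp_partial (s : R) N : 0 <= s -> \sum_(k < N.+1) s ^+ k / k`!%:R <= exp s.
Proof.
move=> s0; have h := @is_pseries_exp s.
have E : \sum_(k < N.+1) s ^+ k / k`!%:R = sum_n (fun k => scal (pow_n (K := R_Ring) s k) (ecoef k)) N.
  by rewrite sum_nE; apply: eq_bigr => k _; rewrite pow_n_pow /= -[scal _ _]/(Rmult _ _) !RealsE.
rewrite E sum_nE; apply: is_series_partial_le h => n.
by rewrite pow_n_pow -[scal _ _]/(Rmult _ _) !RealsE mulr_ge0 ?exprn_ge0 // invr_ge0 ler0n.
Qed.

(** All the coefficients of the products of partial sums are nonnegative, and
    those of degree at most N are exact. *)
Lemma psum_exp_le a x N : (forall n, 0 <= a n) -> 0 <= x ->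
  psum (fps_exp a) x N <= exp (psum a x N).
Proof.
move=> a0 x0; apply: le_trans (exp_partial N (psum_ge0 N a0 x0)).
apply: (@le_trans _ _ (\sum_(k < N.+1) psum (fps_pow a k) x N / k`!%:R)); last first.
  by apply: ler_sum => k _; rewrite ler_wpM2r ?invr_ge0 ?ler0n // psum_pow_le.
rewrite /psum; under [leRHS]eq_bigr do rewrite mulr_suml.
rewrite exchange_big; apply: ler_sum => n _; rewrite /fps_exp mulr_suml.
rewrite (big_ord_widen N.+1 (fun k => fps_pow a k n / k`!%:R * x ^+ n)) //=.
rewrite big_mkcond; apply: ler_sum => k _ /=.
have h : 0 <= fps_pow a k n * x ^+ n / k`!%:R.
  by rewrite mulr_ge0 ?invr_ge0 ?ler0n // mulr_ge0 ?exprn_ge0 // (@fps_pow_ge0 a n).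
by case: ifP => // _; rewrite mulrAC.
Qed.

(** The radius of convergence is at least rho, in a form that passes at once to
    linear combinations and to smaller coefficients. *)
Definition rad (rho : R) (a : nat -> R) :=
  forall r : R, 0 <= r < rho -> exists M, forall n, `|a n| * r ^+ n <= M.

Lemma rad_incv rho a z : rad rho a -> Cmod z < rho -> incv a z.
Proof.
move=> ha zr; pose r := (Cmod z + rho) / 2.
have hr : Cmod z < r < rho by rewrite /r; apply/andP; split; lra.
case/andP: hr => h1 h2; have r0 : 0 <= r := le_trans (Cmod_ge0 _) (ltW h1).
have [|M hM] := ha r; first by rewrite r0.
apply: (@Rbar_lt_le_trans _ r); first exact/RltP.
apply: (proj1 (CV_radius_bounded a)); exists M => n.
by apply/RleP; rewrite !RealsE normrM normrX (ger0_norm r0).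
Qed.

Lemma incv_rad (rho : R) a : Rbar_le rho (CV_radius a) -> rad rho a.
Proof.
move=> h r /andP[r0 rr]; have hr : Rbar_lt (Rabs r) (CV_radius a).
  apply: Rbar_lt_le_trans h; rewrite Rabs_pos_eq; [exact/RltP|exact/RleP].
have /Series_correct := CV_disk_inside _ _ hr; set M := Series _ => hM; exists M => n.
have := is_series_partial_le n (fun n => introT RleP (Rabs_pos _)) hM.
apply: le_trans; rewrite big_ord_recr /= !RealsE normrM normrX (ger0_norm r0) lerDr.
by rewrite sumr_ge0 // => k _; apply/RleP/Rabs_pos.
Qed.

Lemma rad_lin rho (I : finType) (c : I -> R) (a : I -> nat -> R) :
  (forall i, rad rho (a i)) -> rad rho (fun n => \sum_i c i * a i n).
Proof.
move=> h r hr; have [M hM] := fin_all_exists (fun i => h i r hr).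
exists (\sum_i `|c i| * M i) => n; case/andP: hr => r0 _.
apply: le_trans (_ : (\sum_i `|c i| * `|a i n|) * r ^+ n <= _).
  rewrite ler_wpM2r ?exprn_ge0 //; apply: le_trans (ler_norm_sum _ _ _) _.
  by apply: ler_sum => i _; rewrite normrM.
by rewrite mulr_suml; apply: ler_sum => i _; rewrite -mulrA ler_wpM2l.
Qed.

Lemma cps_lin (I : finType) (c : I -> R) (a : I -> nat -> R) z :
  (forall i, incv (a i) z) -> incv (fun n => \sum_i c i * a i n) z ->
  cps (fun n => \sum_i c i * a i n) z = \sum_i RtoC (c i) * cps (a i) z.
Proof.
move=> ha hc; apply: ccvg_unique (cps_cvg hc) _.
have H : ccvg (fun n => \sum_i RtoC (c i) * csum (a i) z n) (\sum_i RtoC (c i) * cps (a i) z).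
  elim: (index_enum I) => [|i s IH].
    by apply: ccvg_ext (ccvg_const _) _ => n; rewrite !big_nil.
  apply: ccvg_ext (_ : ccvg (fun n => RtoC (c i) * csum (a i) z n + \sum_(i <- s) RtoC (c i) * csum (a i) z n) _) _.
    rewrite big_cons; apply: ccvgD IH; apply: ccvgZ; exact: cps_cvg.
  by move=> n; rewrite big_cons.
apply: ccvg_ext H _ => n; rewrite /csum.
under eq_bigr do rewrite mulr_sumr.
rewrite exchange_big; apply: eq_bigr => k _ /=.
by rewrite rmorph_sum mulr_suml; apply: eq_bigr => i _; rewrite rmorphM mulrA.
Qed.

Lemma rad_poly rho a (M : R) : 0 < rho -> 0 <= M -> (forall n, `|a n| * rho ^+ n <= M * n.+1%:R) -> rad rho a.
Proof.
move=> rho0 M0 h r /andP[r0 rr].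
have [->|rn] := eqVneq r 0.
  exists (`|a 0%N|) => -[|n]; first by rewrite expr0 mulr1.
  by rewrite expr0n mulr0.
have {rn}r0 : 0 < r by rewrite lt0r rn.
(* Bernoulli: (rho / r) ^ n grows at least like 1 + n / k. *)
pose k := (rho / r - 1)^-1.
have q1 : 0 < rho / r - 1 by rewrite subr_gt0 ltr_pdivlMr // mul1r.
have bern n : n.+1%:R <= (1 + k) * (rho / r) ^+ n.
  elim: n => [|n IH]; first by rewrite expr0 mulr1 lerDl invr_ge0 ltW.
  have h1 : 1 <= (rho / r) ^+ n by rewrite exprn_ege1 // -subr_ge0 ltW.
  have h2 : k * (rho / r - 1) = 1 by rewrite mulVf // gt_eqF.
  rewrite exprS -natr1.
  have -> : (1 + k) * (rho / r * (rho / r) ^+ n) =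
     (1 + k) * (rho / r) ^+ n + (rho / r - 1 + k * (rho / r - 1)) * (rho / r) ^+ n by ring.
  rewrite lerD // h2; nra.
exists (M * (1 + k)) => n.
have -> : `|a n| * r ^+ n = `|a n| * rho ^+ n * (r / rho) ^+ n.
  by rewrite expr_div_n mulrA; field; rewrite expf_neq0 // gt_eqF.
apply: le_trans (ler_wpM2r _ (h n)) _; first by rewrite exprn_ge0 // divr_ge0 // ltW.
rewrite -mulrA ler_wpM2l //; apply: le_trans (ler_wpM2r _ (bern n)) _.
  by rewrite exprn_ge0 // divr_ge0 // ltW.
rewrite -mulrA -exprMn mulrA divfK ?gt_eqF // divff ?gt_eqF // expr1n mulr1 //.
Qed.

Section Tree.
Variables (d : nat) (p : 'I_d -> R) (W : 'M[R]_d) (T : 'I_d -> nat -> R) (rho : R).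
Hypothesis p0 : forall i, 0 < p i.
Hypothesis W0 : forall i j, 0 <= W i j.
Hypothesis hT : tree_system p W T.
Hypothesis rho0 : 0 < rho.
Hypothesis hrad : forall i, CV_radius (T i) = Rbar.Finite rho.

Let a i n := \sum_j W i j * T j n.

Lemma tree0 i : T i 0%N = 0.
Proof. by rewrite hT mulr0. Qed.

Lemma treeS i n : T i n.+1 = p i * fps_exp (a i) n.
Proof. by rewrite hT. Qed.

Lemma tree_ge0 i n : 0 <= T i n.
Proof.
elim/ltn_ind: n i => -[|n] IH i; first by rewrite tree0.
rewrite treeS mulr_ge0 ?(ltW (p0 i)) // fps_exp_ge0 // => m mn.
by rewrite sumr_ge0 // => j _; rewrite mulr_ge0 // IH.
Qed.

Let a_ge0 i n : 0 <= a i n.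
Proof. by rewrite sumr_ge0 // => j _; rewrite mulr_ge0 // tree_ge0. Qed.

Let a00 i : a i 0%N = 0.
Proof. by rewrite /a big1 // => j _; rewrite tree0 mulr0. Qed.

Lemma tree_rad i : rad rho (T i).
Proof. by apply: incv_rad; rewrite hrad; apply: Rbar_le_refl. Qed.

Lemma a_rad i : rad rho (a i).
Proof. by apply: rad_lin => j; apply: tree_rad. Qed.

Lemma fexp_rad i : rad rho (fps_exp (a i)).
Proof.
move=> r hr; have [r1 /andP[h1 h2]] : exists r1 : R, r < r1 < rho.
  by case/andP: hr => _ h; exists ((r + rho) / 2); apply/andP; split; lra.
have r0 : 0 <= r by case/andP: hr.
have r10 : 0 < r1 by lra.
have [|M hM] := tree_rad i (r := r1); first by rewrite (ltW r10).
exists (M / (p i * r1)) => n; rewrite ler_pdivlMr ?mulr_gt0 //.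
apply: le_trans (hM n.+1); rewrite treeS normrM (gtr0_norm (p0 i)) exprS.
rewrite [leRHS](_ : _ = `|fps_exp (a i) n| * r1 ^+ n * (p i * r1)); last by ring.
by rewrite ler_wpM2r ?mulr_ge0 ?(ltW (p0 i)) ?(ltW r10) // ler_wpM2l // lerXn2r ?nnegrE // ltW.
Qed.

Definition Tc i z := cps (T i) z.

(** If f is the formal exponential of a, then f' = a' f by fps_exp_deriv, so that
    f exp(- a) is constant on the disc. *)
Lemma tree_system_disc i z : Cmod z < rho ->
  Tc i z = RtoC (p i) * z * cexp (\sum_j RtoC (W i j) * Tc j z).
Proof.
move=> hz.
have -> : \sum_j RtoC (W i j) * Tc j z = cps (a i) z.
  rewrite cps_lin // => [j|]; apply: rad_incv hz; [exact: tree_rad|exact: a_rad].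
have -> : Tc i z = RtoC (p i) * z * cps (fps_exp (a i)) z.
  rewrite /Tc cps_shift; last by apply: rad_incv hz; apply: tree_rad.
  rewrite tree0 rmorph0 add0r -mulrA mulrCA; congr (_ * _).
  have hf : incv (fps_exp (a i)) z by apply: rad_incv hz; apply: fexp_rad.
  have hf2 : incv (fun n => T i n.+1) z.
    have := rad_incv (@tree_rad i) hz; by rewrite /incv -CV_radius_decr_1.
  apply: ccvg_unique (cps_cvg hf2) _; apply: ccvg_ext (ccvgZ _ (cps_cvg hf)) _ => n.
  by rewrite /csum mulr_sumr; apply: eq_bigr => k _; rewrite treeS rmorphM mulrA.
congr (_ * _); pose f w := cps (fps_exp (a i)) w * cexp (- cps (a i) w).
have : f z = f 0.
  apply: cderiv0_const => t /andP[t0 t1]; set w := 0 + _.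
  have hw : Cmod w < rho.
    rewrite /w add0r subr0 CmodM CmodR_ge0 //; apply: le_lt_trans hz.
    by rewrite -[leRHS]mul1r ler_wpM2r ?Cmod_ge0.
  have d1 := cps_deriv (rad_incv (@fexp_rad i) hw).
  have ha := rad_incv (@a_rad i) hw.
  have d2 := cps_deriv ha.
  have d3 := cderiv_comp (cderivN d2) (cexp_deriv _).
  apply: cderiv_eq (cderivM d1 d3) _.
  have -> : cps (PS_derive (fps_exp (a i))) w = cps (PS_derive (a i)) w * cps (fps_exp (a i)) w.
    rewrite -cps_mul; [|exact: incv_derive|exact: (rad_incv (@fexp_rad i) hw)].
    apply: cps_ext => n; have := fps_exp_deriv n (a00 i).
    rewrite /PS_derive /fps_deriv !RealsE mulr_natl => ->.
    by apply: eq_bigr => k _; rewrite !RealsE mulr_natl.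
  ring.
rewrite /f !cps0 a00 rmorph0 oppr0 cexp0 mulr1 {2}/fps_exp big_ord1 cexpN.
rewrite divr1 => E; rewrite -[LHS](divfK (cexp_neq0 (cps (a i) z))) E.
by rewrite mul1r.
Qed.

End Tree.

Lemma exp_ge1D (t : R) : 1 + t <= exp t.
Proof. exact/RleP/exp_ineq1_le. Qed.

Lemma expRD (x y : R) : exp (x + y) = exp x * exp y.
Proof. exact: exp_plus. Qed.

Lemma expR_gt0 (x : R) : 0 < exp x.
Proof. exact/RltP/exp_pos. Qed.

Lemma bernoulli (s : R) n : 0 <= s <= 1 -> 1 - n%:R * s <= (1 - s) ^+ n.
Proof.
move=> /andP[s0 s1]; elim: n => [|n IH]; first by rewrite mul0r subr0 expr0.
rewrite exprS -natr1; apply: le_trans (_ : (1 - s) * (1 - n%:R * s) <= _).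
  have : 0 <= n%:R * s * s by rewrite !mulr_ge0.
  lra.
by rewrite ler_wpM2l // subr_ge0.
Qed.

(** * The critical point *)

Section Critical.
Variables (d : nat) (i0 : 'I_d) (p : 'I_d -> R) (W : 'M[R]_d) (T : 'I_d -> nat -> R) (rho : R).
Hypothesis p0 : forall i, 0 < p i.
Hypothesis W0 : forall i j, 0 <= W i j.
Hypothesis W1 : forall i, \sum_j W i j = 1.
Hypothesis Wirr : irreducible W.
Hypothesis hT : tree_system p W T.
Hypothesis rho0 : 0 < rho.
Hypothesis hrad : forall i, CV_radius (T i) = Rbar.Finite rho.

Let T0 := tree_ge0 p0 W0 hT.

Let S i (x : R) := PSeries (T i) x.

Let S_series i x : 0 <= x < rho -> is_series (fun n => T i n * x ^+ n) (S i x).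
Proof.
move=> /andP[x0 xr]; have h : Rbar_lt (Rabs x) (CV_radius (T i)).
  by rewrite hrad Rabs_pos_eq; [exact/RltP|exact/RleP].
have /Series_correct := ex_series_Rabs _ (CV_disk_inside _ _ h).
by apply: is_series_ext => n; rewrite !RealsE.
Qed.

Let term_ge0 i x n : 0 <= x -> 0 <= T i n * x ^+ n.
Proof. by move=> x0; rewrite mulr_ge0 ?exprn_ge0 // T0. Qed.

Let psum_S i x N : 0 <= x < rho -> psum (T i) x N <= S i x.
Proof.
by move=> hx; rewrite /psum; apply: (is_series_partial_le _ _ (@S_series i x hx)) => n; apply: term_ge0; case/andP: hx.
Qed.

Let S_le i x M : 0 <= x < rho -> (forall N, psum (T i) x N <= M) -> S i x <= M.
Proof.
move=> hx hM; apply/ler_addgt0Pr => e e0.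
have /is_series_seq /(_ e e0)[N /(_ N (leqnn _))] := @S_series i x hx.
by rewrite -/(psum (T i) x N) ltr_norml => /andP[h1 _]; have := hM N; lra.
Qed.

Let psum_mono i x y N : 0 <= x -> x <= y -> psum (T i) x N <= psum (T i) y N.
Proof.
move=> x0 xy; apply: ler_sum => n _; rewrite ler_wpM2l ?T0 // lerXn2r ?nnegrE //.
exact: le_trans xy.
Qed.

Let S_mono i x y : 0 <= x -> x <= y -> y < rho -> S i x <= S i y.
Proof.
move=> x0 xy yr; apply: S_le => [|N]; first by rewrite x0 (le_lt_trans xy).
by apply: le_trans (psum_mono _ _ x0 xy) _; apply: psum_S; rewrite (le_trans x0).
Qed.

Let S_sys i x : 0 <= x < rho -> S i x = p i * x * exp (\sum_j W i j * S j x).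
Proof.
move=> /andP[x0 xr]; have := tree_system_disc p0 hT hrad i (z := RtoC x).
rewrite CmodR_ge0 // => /(_ xr); rewrite /Tc cpsR.
have -> : \sum_j RtoC (W i j) * cps (T j) (RtoC x) = RtoC (\sum_j W i j * S j x).
  by rewrite rmorph_sum; apply: eq_bigr => j _; rewrite rmorphM cpsR.
by rewrite cexpR -!rmorphM => /RtoC_inj.
Qed.

Let S_gt0 i x : 0 < x < rho -> 0 < S i x.
Proof.
by move=> /andP[x0 xr]; rewrite S_sys ?(ltW x0) // !mulr_gt0 ?p0 // expR_gt0.
Qed.

Let sumW_ge0 i (f : 'I_d -> R) : (forall j, 0 <= f j) -> 0 <= \sum_j W i j * f j.
Proof. by move=> f0; rewrite sumr_ge0 // => j _; rewrite mulr_ge0. Qed.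

(** Along an edge i -> j, S i >= p i x W_ij S j since exp t >= t. *)
Let S_compare i k : exists2 B, 0 < B & forall x, rho / 2 <= x < rho -> S k x <= B * S i x.
Proof.
have /connectP[q pq ->] := Wirr i k.
elim: q i pq => [|j q IH] i /=; first by exists 1 => // x _; rewrite mul1r.
case/andP=> Wij /IH[B B0 hB].
have c0 : 0 < p i * (rho / 2) * W i j by rewrite !mulr_gt0 ?p0 ?invr_gt0 ?ltr0n.
exists (B / (p i * (rho / 2) * W i j)) => [|x hx]; first by rewrite divr_gt0.
apply: le_trans (hB x hx) _; rewrite -mulrA ler_pM2l // mulrC ler_pdivlMr //.
case/andP: hx => h1 h2; have x0 : 0 < x by lra.
have hx : 0 <= x < rho by rewrite ltW.
rewrite [leRHS]S_sys //.
have -> : S j x * (p i * (rho / 2) * W i j) = p i * (rho / 2) * (W i j * S j x) by ring.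
have Sj : 0 <= S j x by apply/ltW/S_gt0; rewrite x0.
have h3 : W i j * S j x <= \sum_j W i j * S j x.
  rewrite (bigD1 j) //= lerDl sumr_ge0 // => l _; rewrite mulr_ge0 //.
  by apply/ltW/S_gt0; rewrite x0.
have h4 : \sum_j W i j * S j x <= exp (\sum_j W i j * S j x).
  by have := exp_ge1D (\sum_j W i j * S j x); lra.
apply: ler_pM; [|by rewrite mulr_ge0| |exact: le_trans h3 h4].
  by rewrite mulr_ge0 ?(ltW (p0 i)) //; lra.
by rewrite ler_pM2l ?p0.
Qed.

(** S i y / S i x is y / x times the exponential of the sum q, which is at least 1 + q. *)
Let expand i x y : 0 < x -> x < y -> y < rho ->
  (S i y - S i x) > S i x * \sum_j W i j * (S j y - S j x).
Proof.
move=> x0 xy yr; have y0 : 0 < y by lra.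
have hx : 0 <= x < rho by rewrite ltW //= (lt_trans xy).
have hy : 0 <= y < rho by rewrite ltW.
set q := \sum_j _.
have q0 : 0 <= q by apply: sumW_ge0 => j; rewrite subr_ge0; apply: S_mono => //; exact: ltW.
have E : S i y = S i x * (y / x) * exp q.
  rewrite [in LHS]S_sys // [in RHS]S_sys //.
  have -> : \sum_j W i j * S j y = \sum_j W i j * S j x + q.
    by rewrite -big_split; apply: eq_bigr => j _ /=; ring.
  by rewrite expRD; field; rewrite gt_eqF.
have Sx : 0 < S i x by apply: S_gt0; rewrite x0; case/andP: hx.
have h1 : 1 < y / x by rewrite ltr_pdivlMr // mul1r.
have h2 := exp_ge1D q.
rewrite E -subr_gt0.
have -> : S i x * (y / x) * exp q - S i x - S i x * q = S i x * (y / x * exp q - 1 - q) by ring.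
rewrite mulr_gt0 //; nra.
Qed.

(** Let D be the increments between x and some y > x.  At an index i where D i is
    minimal, expand gives D i > S i x * D i since W is stochastic, so S i x <= 1.
    The other S k x are bounded through S_compare. *)
Let S_bounded : exists2 B, 0 <= B & forall i x, 0 < x < rho -> S i x <= B.
Proof.
have [B hB0 hB] : exists2 B : 'I_d * 'I_d -> R, forall ij, 0 < B ij &
    forall ij x, rho / 2 <= x < rho -> S ij.2 x <= B ij * S ij.1 x.
  exact: fin_all_exists2 (fun ij => S_compare ij.1 ij.2).
have M0 : 0 <= \sum_ij B ij by rewrite sumr_ge0 // => ij _; apply: ltW.
have big k x : rho / 2 <= x < rho -> S k x <= \sum_ij B ij.
  move=> /andP[h1 h2]; have x0 : 0 < x by lra.
  pose y := (x + rho) / 2; have xy : x < y by rewrite /y; lra.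
  have yr : y < rho by rewrite /y; lra.
  pose D i := S i y - S i x.
  have D0 i : 0 < D i.
    apply: le_lt_trans (expand i x0 xy yr).
    rewrite mulr_ge0 ?(ltW (S_gt0 _ _)) ?x0 //.
    by apply: sumW_ge0 => j; rewrite subr_ge0; apply: S_mono => //; exact: ltW.
  have [i _ hi] := @arg_minP _ _ _ i0 predT D isT.
  have Si : S i x <= 1.
    rewrite leNgt; apply/negP => S1.
    have := expand i x0 xy yr; rewrite -/(D i) ltNge => /negP; apply.
    apply: (@le_trans _ _ (\sum_j W i j * D j)).
      apply: (@le_trans _ _ (\sum_j W i j * D i)); first by rewrite -mulr_suml W1 mul1r.
      by apply: ler_sum => j _; rewrite ler_wpM2l //; apply: hi.
    rewrite -[leLHS]mul1r ler_wpM2r ?(ltW S1) //.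
    by apply: sumW_ge0 => j; apply: ltW.
  have hxr : rho / 2 <= x < rho by rewrite h1.
  apply: le_trans (hB (i, k) x hxr) _ => /=.
  apply: le_trans (_ : B (i, k) <= _); first by rewrite -[leRHS]mulr1 ler_wpM2l // ltW.
  by rewrite (bigD1 (i, k)) //= lerDl sumr_ge0 // => ij _; apply: ltW.
exists (\sum_ij B ij) => // k x /andP[x0 xr].
have [h|h] := leP (rho / 2) x; first by apply: big; rewrite h.
apply: le_trans (_ : S k (rho / 2) <= _); last by apply: big; lra.
by apply: S_mono; lra.
Qed.

(** Bernoulli bounds (x / y) ^ N from below, uniformly in the degree n <= N. *)
Let psum_scale i x y N : 0 <= x -> x <= y -> 0 < y ->
  (1 - N%:R * (1 - x / y)) * psum (T i) y N <= psum (T i) x N.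
Proof.
move=> x0 xy y0; have t1 : x / y <= 1 by rewrite ler_pdivrMr // mul1r.
have t0 : 0 <= x / y by rewrite divr_ge0 // ltW.
apply: le_trans (_ : (x / y) ^+ N * psum (T i) y N <= _).
  apply: ler_wpM2r; first by rewrite psum_ge0 // ltW.
  have := @bernoulli (1 - x / y) N; rewrite subKr; apply.
  by rewrite subr_ge0 t1 gerBl.
rewrite mulr_sumr; apply: ler_sum => n _.
have -> : T i n * x ^+ n = (x / y) ^+ n * (T i n * y ^+ n).
  by rewrite expr_div_n; field; rewrite expf_neq0 // gt_eqF.
rewrite ler_wpM2r ?term_ge0 ?(ltW y0) //.
by rewrite ler_wiXn2l // -ltnS.
Qed.

Let psum_bounded : exists2 B, 0 <= B & forall i N, psum (T i) rho N <= B.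
Proof.
have [B B0 hB] := S_bounded; exists B => // i N; rewrite leNgt; apply/negP => h.
set P := psum (T i) rho N in h.
have P0 : 0 < P by lra.
(* With this s, Bernoulli loses at most half of the excess P - B. *)
pose s := (P - B) / (2 * (N.+1%:R * P)).
have k0 : 0 < 2 * (N.+1%:R * P) by rewrite !mulr_gt0 // ltr0n.
have s0 : 0 < s by rewrite divr_gt0 // subr_gt0.
have s1 : s < 1.
  rewrite ltr_pdivrMr // mul1r; have : P <= N.+1%:R * P by rewrite -[leLHS]mul1r ler_pM2r // ler1n.
  lra.
have hx : 0 <= rho * (1 - s) < rho.
  by rewrite mulr_ge0 ?subr_ge0 ?(ltW s1) ?(ltW rho0) //= -[ltRHS]mulr1 ltr_pM2l // gtrBl.
have hx0 : 0 < rho * (1 - s) by rewrite mulr_gt0 // subr_gt0.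
case/andP: hx => h1 h2.
have := psum_scale i N h1 (ltW h2) rho0; rewrite -/P mulrAC divff ?gt_eqF // mul1r subKr.
have h3 : psum (T i) (rho * (1 - s)) N <= S i (rho * (1 - s)) by apply: psum_S; rewrite h1.
have h4 : S i (rho * (1 - s)) <= B by apply: hB; rewrite hx0.
have : N%:R * s * P <= (P - B) / 2.
  apply: le_trans (_ : N.+1%:R * s * P <= _).
    by rewrite !ler_wpM2r ?ler_nat // ltW.
  by rewrite /s le_eqVlt; apply/orP; left; apply/eqP; field; rewrite gt_eqF //= gt_eqF // [1 + _]addrC natr1 ltr0n.
lra.
Qed.

Let tau i := Series (fun n => T i n * rho ^+ n).

Let tau_series i : is_series (fun n => T i n * rho ^+ n) (tau i).
Proof.
apply: Series_correct; have [B B0 hB] := psum_bounded.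
have [||l hl] := @ex_finite_lim_seq_incr (sum_n (fun n => T i n * rho ^+ n)) B.
- move=> n; rewrite sum_Sn; apply/RleP; rewrite -[plus _ _]/(Rplus _ _) RplusE lerDl.
  by apply: term_ge0; exact: ltW.
- by move=> n; rewrite sum_nE; apply/RleP/hB.
by exists l.
Qed.

Let psum_tau i N : psum (T i) rho N <= tau i.
Proof. by rewrite /psum; apply: (is_series_partial_le _ _ (@tau_series i)) => n; apply: term_ge0; exact: ltW. Qed.

Let tau_le i M : (forall N, psum (T i) rho N <= M) -> tau i <= M.
Proof.
move=> hM; apply/ler_addgt0Pr => e e0.
have /is_series_seq /(_ e e0)[N /(_ N (leqnn _))] := @tau_series i.
by rewrite -/(psum (T i) rho N) ltr_norml => /andP[h1 _]; have := hM N; lra.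
Qed.

Let tau_gt0 i : 0 < tau i.
Proof.
apply: lt_le_trans (psum_tau i 1); rewrite /psum big_ord_recr big_ord1 /=.
rewrite (tree0 hT) mul0r add0r (treeS hT) /fps_exp big_ord1 /=.
by rewrite !mulr_gt0 ?p0 // invr_gt0.
Qed.

Let S_tau i x : 0 <= x < rho -> S i x <= tau i.
Proof.
move=> hx; apply: S_le => // N; apply: le_trans (psum_tau i N).
by case/andP: hx => x0 xr; apply: psum_mono => //; exact: ltW.
Qed.

Let tau_near eta : 0 < eta -> exists2 dl, 0 < dl & forall i x,
  0 <= x < rho -> rho - dl <= x -> (1 - eta) * tau i <= S i x.
Proof.
move=> eta0; apply: common_radius => [i dl dl' dl'0 ll h x hx hd|i].
  by apply: h => //; lra.
have e0 : 0 < eta / 2 * tau i by rewrite mulr_gt0 // divr_gt0.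
have /is_series_seq /(_ _ e0)[N /(_ N (leqnn _))] := @tau_series i.
rewrite -/(psum (T i) rho N) ltr_norml => /andP[h1 _].
exists (rho * (eta / (2 * N.+1%:R))); first by rewrite mulr_gt0 // divr_gt0 // mulr_gt0 // ltr0n.
move=> x /andP[x0 xr] hd.
apply: le_trans (psum_S i N _); last by rewrite x0.
apply: le_trans (psum_scale i N x0 (ltW xr) rho0).
have hN : N%:R * (1 - x / rho) <= eta / 2.
  have h2 : 1 - x / rho <= eta / (2 * N.+1%:R).
    rewrite lerBlDl -lerBlDr ler_pdivlMr // mulrC mulrBr mulr1.
    by [].
  apply: le_trans (_ : N.+1%:R * (eta / (2 * N.+1%:R)) <= _).
    apply: ler_pM => //; rewrite ?ler_nat // subr_ge0 ler_pdivrMr // mul1r ltW //.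
  rewrite le_eqVlt; apply/orP; left; apply/eqP; field.
  by rewrite [1 + _]addrC natr1 pnatr_eq0.
have P0 : 0 <= psum (T i) rho N by rewrite psum_ge0 // ltW.
have t0 := tau_gt0 i; have pt := psum_tau i N.
have : N%:R * (1 - x / rho) * psum (T i) rho N <= eta / 2 * tau i.
  by apply: ler_pM => //; rewrite mulr_ge0 // subr_ge0 ler_pdivrMr // mul1r ltW.
lra.
Qed.

Let a_psum i x N : psum (fun n => \sum_j W i j * T j n) x N = \sum_j W i j * psum (T j) x N.
Proof.
rewrite /psum; under eq_bigr do rewrite mulr_suml.
rewrite exchange_big; apply: eq_bigr => j _ /=; rewrite mulr_sumr.
by apply: eq_bigr => n _; rewrite mulrA.
Qed.

Let psum_step i x N : 0 <= x ->
  psum (T i) x N.+1 <= p i * x * exp (\sum_j W i j * psum (T j) x N).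
Proof.
move=> x0; rewrite -a_psum.
apply: le_trans (_ : p i * x * psum (fps_exp (fun n => \sum_j W i j * T j n)) x N <= _).
  rewrite /psum big_ord_recl (tree0 hT) mul0r add0r mulr_sumr; apply: ler_sum => n _.
  by rewrite lift0 (treeS hT) exprS le_eqVlt; apply/orP; left; apply/eqP; ring.
rewrite ler_wpM2l ?mulr_ge0 ?(ltW (p0 i)) // psum_exp_le // => n.
by apply: sumW_ge0 => j; apply: T0.
Qed.

(** Partial sums give one inequality.  The other is the limit of S_sys as x tends
    to rho, made quantitative by tau_near and exp (- t) >= 1 - t. *)
Let tau_sys i : tau i = p i * rho * exp (\sum_j W i j * tau j).
Proof.
set q := \sum_j _; have pr0 : 0 < p i * rho by rewrite mulr_gt0 ?p0.
have q0 : 0 <= q by apply: sumW_ge0 => j; exact: ltW.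
apply/eqP; rewrite eq_le; apply/andP; split.
  apply: tau_le => -[|N].
    by rewrite /psum big_ord1 (tree0 hT) mul0r mulr_ge0 // ltW // expR_gt0.
  apply: le_trans (psum_step i N (ltW rho0)) _; rewrite ler_pM2l //.
  apply: exp_le_mono; apply: ler_sum => j _; by rewrite ler_wpM2l.
set E := p i * rho * exp q; have E0 : 0 < E by rewrite mulr_gt0 // expR_gt0.
rewrite leNgt; apply/negP => h.
(* The product (1 - eta) (1 - eta q) costs at most half of E - tau i. *)
pose eta := Num.min 2^-1 ((E - tau i) / (2 * (1 + q) * E)).
have q1 : 0 < 1 + q by lra.
have k0 : 0 < 2 * (1 + q) * E by apply: mulr_gt0 => //; apply: mulr_gt0.
have eta0 : 0 < eta by rewrite lt_min invr_gt0 ltr0n divr_gt0 // subr_gt0.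
have eta1 : eta <= 2^-1 by rewrite /eta ge_min lexx.
have eta2 : eta * (2 * (1 + q) * E) <= E - tau i.
  by rewrite -ler_pdivlMr // /eta ge_min lexx orbT.
have [dl dl0 hdl] := tau_near eta0.
pose x := Num.max (rho - dl) (rho * (1 - eta)).
have x1 : rho * (1 - eta) <= x by rewrite /x le_max lexx orbT.
have x2 : rho - dl <= x by rewrite /x le_max lexx.
have xr : x < rho by rewrite gt_max; apply/andP; split; [lra|rewrite -[ltRHS]mulr1 ltr_pM2l // gtrBl //].
have x0 : 0 < x by apply: lt_le_trans x1; rewrite mulr_gt0 //; lra.
have hx : 0 <= x < rho by rewrite ltW.
have H1 : tau i >= p i * x * exp ((1 - eta) * q).
  apply: le_trans (S_tau i hx); rewrite S_sys // ler_pM2l ?mulr_gt0 ?p0 //.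
  apply: exp_le_mono; rewrite /q mulr_sumr; apply: ler_sum => j _.
  by rewrite mulrCA ler_wpM2l // hdl.
have H2 : exp ((1 - eta) * q) >= exp q * (1 - eta * q).
  have -> : (1 - eta) * q = q + - (eta * q) by ring.
  by rewrite expRD ler_pM2l ?expR_gt0 //; have := exp_ge1D (- (eta * q)); lra.
have H3 : p i * x * exp ((1 - eta) * q) >= (p i * rho * (1 - eta)) * (exp q * (1 - eta * q)).
  apply: le_trans (_ : (p i * rho * (1 - eta)) * exp ((1 - eta) * q) <= _).
    by rewrite ler_wpM2l // mulr_ge0 ?(ltW pr0) //; lra.
  by rewrite ler_pM2r ?expR_gt0 // -mulrA ler_pM2l ?p0.
have H4 : (p i * rho * (1 - eta)) * (exp q * (1 - eta * q)) = E * ((1 - eta) * (1 - eta * q)).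
  by rewrite /E; ring.
have H5 : E * ((1 - eta) * (1 - eta * q)) >= E * (1 - eta * (1 + q)).
  rewrite ler_pM2l //; have : 0 <= eta * (eta * q) by rewrite !mulr_ge0 // ltW.
  lra.
have H6 : E * (1 - eta * (1 + q)) = E - eta * (2 * (1 + q) * E) / 2 by field.
lra.
Qed.

Let A := \matrix_(i, j) (tau i * W i j).

Let AE (w : 'cV[R]_d) i : (A *m w) i ord0 = tau i * \sum_j W i j * w j ord0.
Proof. by rewrite mxE mulr_sumr; apply: eq_bigr => j _; rewrite mxE mulrA. Qed.

(** The vector tau - S(x), for x close to rho. *)
Let Hsub eta : 0 < eta < 1 -> exists2 w : 'cV[R]_d,
  forall i, 0 < w i ord0 & forall i, (1 - eta) * (A *m w) i ord0 < w i ord0.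
Proof.
move=> /andP[eta0 eta1]; have [dl dl0 hdl] := tau_near eta0.
pose x := Num.max (rho - dl) (rho / 2).
have x1 : rho / 2 <= x by rewrite /x le_max lexx orbT.
have x2 : rho - dl <= x by rewrite /x le_max lexx.
have xr : x < rho by rewrite gt_max; apply/andP; split; [lra|by rewrite ltr_pdivrMr // mulr_natr mulr2n ltrDl].
have x0 : 0 < x by lra.
have hx : 0 <= x < rho by rewrite ltW.
pose D i := tau i - S i x.
have D0 i : 0 <= D i by rewrite subr_ge0 S_tau.
have key i : S i x * (\sum_j W i j * D j) < D i.
  set q := \sum_j _; have q0 : 0 <= q by apply: sumW_ge0.
  have E : tau i = S i x * (rho / x) * exp q.
    rewrite [in RHS]S_sys // tau_sys.
    have -> : \sum_j W i j * tau j = \sum_j W i j * S j x + q.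
      by rewrite -big_split; apply: eq_bigr => j _ /=; rewrite /D; ring.
    by rewrite expRD; field; rewrite gt_eqF.
  have Sx : 0 < S i x by apply: S_gt0; rewrite x0.
  have h1 : 1 < rho / x by rewrite ltr_pdivlMr // mul1r.
  have h2 := exp_ge1D q; rewrite /D E -subr_gt0.
  have -> : S i x * (rho / x) * exp q - S i x - S i x * q = S i x * (rho / x * exp q - 1 - q) by ring.
  rewrite mulr_gt0 //; nra.
have DW i : 0 <= \sum_j W i j * D j by apply: sumW_ge0.
exists (\col_i D i) => i; rewrite ?AE mxE.
  apply: le_lt_trans (key i); rewrite mulr_ge0 // ltW // S_gt0 // x0 //.
apply: le_lt_trans (key i); rewrite mulrA; under eq_bigr do rewrite mxE.
by rewrite ler_wpM2r // hdl.
Qed.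

(** For small e > 0 the vector tau + e w is a strict supersolution of the system at
    rho, hence still a supersolution at rho' slightly beyond rho.  It then bounds
    all the partial sums of the T i at rho', which exceeds the radius of
    convergence. *)
Let Hsuper (w : 'cV[R]_d) : (forall i, 0 < w i ord0) ->
  ~ (forall i, (A *m w) i ord0 < w i ord0).
Proof.
move=> w0 hw; pose q i := \sum_j W i j * w j ord0.
have q0 i : 0 <= q i by apply: sumW_ge0 => j; exact: ltW.
have hq i : tau i * q i < w i ord0 by rewrite -AE.
have [e e0 he] : exists2 e, 0 < e & forall i, tau i * exp (e * q i) < tau i + e * w i ord0.
  have [||e e0 he] := @common_radius _ (fun i e => forall e', 0 < e' -> e' <= e ->
      tau i * exp (e' * q i) < tau i + e' * w i ord0).
  - by move=> i e e1 e10 e1e h e' e'0 e'1; apply: h => //; apply: le_trans e1e.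
  - move=> i; have t0 := tau_gt0 i; have wi := w0 i; have qi := q0 i.
    have g0 : 0 < w i ord0 - tau i * q i by rewrite subr_gt0.
    have c1 : 0 < q i * w i ord0 + 1 by rewrite ltr_wpDl // mulr_ge0 // ltW.
    have c2 : 0 < q i + 1 by lra.
    exists (Num.min ((w i ord0 - tau i * q i) / (q i * w i ord0 + 1)) (2^-1 / (q i + 1))).
      by rewrite lt_min !divr_gt0 // invr_gt0 ltr0n.
    move=> e e0; rewrite le_min !ler_pdivlMr // => /andP[h1 h2].
    have eq0 : 0 <= e * q i by rewrite mulr_ge0 // ltW.
    have h3 : 0 < 1 - e * q i by lra.
    have h4 : exp (e * q i) * (1 - e * q i) <= 1.
      rewrite [leRHS](_ : _ = exp (e * q i) * exp (- (e * q i))); last by rewrite -expRD subrr exp_0.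
      by rewrite ler_pM2l ?expR_gt0 //; exact: exp_ge1D.
    rewrite -(ltr_pM2r h3); apply: le_lt_trans (_ : tau i < _).
      by rewrite -mulrA -[leRHS]mulr1 ler_pM2l.
    rewrite -subr_gt0.
    have -> : (tau i + e * w i ord0) * (1 - e * q i) - tau i = e * (w i ord0 - tau i * q i - e * (q i * w i ord0)) by ring.
    rewrite mulr_gt0 //; lra.
  by exists e => // i; apply: he.
have [dl dl0 hdl] : exists2 dl, 0 < dl & forall i,
    (1 + dl) * (tau i * exp (e * q i)) <= tau i + e * w i ord0.
  apply: common_radius => [i dl dl' dl'0 ll|i].
    by apply: le_trans; rewrite ler_pM2r ?lerD2l // mulr_gt0 // expR_gt0.
  have c0 : 0 < tau i * exp (e * q i) by rewrite mulr_gt0 // expR_gt0.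
  exists ((tau i + e * w i ord0) / (tau i * exp (e * q i)) - 1).
    by rewrite subr_gt0 ltr_pdivlMr // mul1r.
  by rewrite addrC subrK divfK // gt_eqF.
pose rho' := rho * (1 + dl).
have rho'0 : 0 < rho' by rewrite mulr_gt0 // ltr_wpDr // ltW.
have B i N : psum (T i) rho' N <= tau i + e * w i ord0.
  have pos k : 0 <= tau k + e * w k ord0 by rewrite addr_ge0 ?mulr_ge0 // ltW.
  elim: N i => [|N IH] i; first by rewrite /psum big_ord1 (tree0 hT) mul0r.
  apply: le_trans (psum_step i N (ltW rho'0)) _; apply: le_trans (hdl i).
  have -> : (1 + dl) * (tau i * exp (e * q i)) = p i * rho' * exp (\sum_j W i j * tau j + e * q i).
    by rewrite expRD [in LHS]tau_sys /rho'; ring.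
  rewrite ler_pM2l; last exact: mulr_gt0 (p0 i) rho'0; apply: exp_le_mono.
  have -> : \sum_j W i j * tau j + e * q i = \sum_j W i j * (tau j + e * w j ord0).
    by rewrite /q mulr_sumr -big_split; apply: eq_bigr => j _ /=; ring.
  by apply: ler_sum => j _; rewrite ler_wpM2l.
have := proj1 (CV_radius_bounded (T i0)) rho'; rewrite hrad /= => H.
have : (rho' <= rho).
  apply/RleP/H; exists (tau i0 + e * w i0 ord0) => n; apply/RleP.
  rewrite !RealsE ger0_norm ?term_ge0 ?(ltW rho'0) //; apply: le_trans (B i0 n).
  rewrite /psum big_ord_recr /= lerDr sumr_ge0 // => k _.
  by apply: term_ge0; exact: ltW.
by rewrite /rho' -[leRHS]mulr1 ler_pM2l // gerDl leNgt dl0.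
Qed.

(** Criticality: the matrix A(rho) has Perron eigenvalue 1.  The eigenvectors v and
    u are normalized by u v = 1. *)
Lemma critical_point : exists (tau : 'I_d -> R) (v : 'cV[R]_d) (u : 'rV[R]_d),
  let A := \matrix_(i, j) (tau i * W i j) in
  [/\ forall i, 0 < tau i /\ tau i = p i * rho * exp (\sum_j W i j * tau j),
      forall i N, psum (T i) rho N <= tau i,
      (forall i, 0 < v i ord0) /\ (forall i, 0 < u ord0 i),
      A *m v = v /\ u *m A = u &
      (u *m v) ord0 ord0 = 1 /\
      forall y : 'cV[R]_d, A *m y = y -> exists c : R, y = c *: v].
Proof.
have A0 i j : 0 <= A i j by rewrite mxE mulr_ge0 // ltW.
have Airr i j : connect (fun k l => 0 < A k l) i j.
  rewrite (@eq_connect _ _ (fun k l => 0 < W k l)) => [|k l]; first exact: Wirr.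
  by rewrite mxE pmulr_rgt0.
have [v [u [v0 u0 Av uA [uv ker]]]] := perron i0 A0 Airr Hsub Hsuper.
by exists tau, v, u.
Qed.

End Critical.

(** * The cycle series inside the disc of convergence *)

Lemma cderiv_unique f z l m : cderiv f z l -> cderiv f z m -> l = m.
Proof.
move=> hl hm; apply/eqP; rewrite -subr_eq0 -Cmod_eq0 eq_le Cmod_ge0 andbT.
apply/ler_addgt0Pr => e e0; rewrite add0r; have e20 : 0 < e / 2 by lra.
have [r r0 hr] := hl _ e20; have [r' r'0 hr'] := hm _ e20.
have m0 : 0 < Num.min r r' by rewrite lt_min r0.
pose t := Num.min r r' / 2; have t0 : 0 < t by rewrite divr_gt0.
have tr : t < Num.min r r' by rewrite ltr_pdivrMr // mulr_natr mulr2n ltrDl.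
have wt : Cmod (z + RtoC t - z) = t by rewrite addrC addKr CmodR_ge0 // ltW.
have := hr (z + RtoC t); have := hr' (z + RtoC t); rewrite wt.
move: tr; rewrite lt_min => /andP[-> ->] /(_ isT) h1 /(_ isT) h2.
have : Cmod (RtoC t * (l - m)) <= e * t.
  set D := f (z + RtoC t) - f z in h1 h2.
  have wz : z + RtoC t - z = RtoC t by rewrite addrC addKr.
  rewrite wz in h1 h2.
  have -> : RtoC t * (l - m) = (D - m * RtoC t) - (D - l * RtoC t) by ring.
  by apply: le_trans (CmodDB _ _) _; lra.
by rewrite CmodM CmodR_ge0 ?(ltW t0) // mulrC ler_pM2r.
Qed.

Lemma cderiv_prod (I : eqType) (r : seq I) (f : I -> C -> C) (l : I -> C) z :
  uniq r -> (forall i, cderiv (f i) z (l i)) ->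
  cderiv (fun w => \prod_(i <- r) f i w) z
    (\sum_(k <- r) l k * \prod_(i <- r | i != k) f i z).
Proof.
move=> + h; elim: r => [_|j r IH /= /andP[jr ur]].
  by rewrite big_nil; apply: cderiv_ext ltr01 _ (cderiv_const 1 z) => w _; rewrite big_nil.
apply: cderiv_ext ltr01 _ (cderiv_eq (cderivM (h j) (IH ur)) _) => [w _|].
  by rewrite big_cons.
rewrite big_cons big_cons eqxx /=; congr (_ * _ + _).
  rewrite [RHS]big_seq_cond [LHS]big_seq_cond; apply: eq_bigl => i.
  by case: (boolP (i \in r)) => //= ir; rewrite (memPn jr).
rewrite mulr_sumr [LHS]big_seq [RHS]big_seq; apply: eq_bigr => k kr.
by rewrite big_cons (memPnC jr) // mulrCA.
Qed.

(** By the product rule the derivative of the determinant is the sum over k of the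
    determinants in which row k is differentiated; expand them along that row. *)
Lemma jacobi_formula n (N : C -> 'M[C]_n) (N' : 'M[C]_n) z :
  (forall i j, cderiv (fun w => N w i j) z (N' i j)) ->
  cderiv (fun w => \det (N w)) z (\tr (\adj (N z) *m N')).
Proof.
move=> h.
pose B k := \matrix_(i, j) (if i == k then N' i j else N z i j).
have E : \tr (\adj (N z) *m N') = \sum_k \det (B k).
  rewrite /mxtrace; under eq_bigr do rewrite mxE.
  rewrite exchange_big; apply: eq_bigr => k _ /=; rewrite (expand_det_row _ k).
  apply: eq_bigr => j _; rewrite !mxE eqxx mulrC; congr (_ * _).
  rewrite /cofactor; congr (_ * \det _); apply/matrixP => a b; rewrite !mxE.
  by rewrite eq_sym (negbTE (neq_lift _ _)).
rewrite E {E} /B /determinant exchange_big.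
apply: cderiv_sum => s _.
apply: cderiv_eq (cderivZ _ (cderiv_prod (index_enum_uniq _) (fun i => h i ((s : {perm 'I_n}) i)))) _.
rewrite mulr_sumr; apply: eq_bigr => k _.
rewrite [in RHS](bigD1 k) //= mxE eqxx; congr (_ * (_ * _)).
by apply: eq_bigr => i /negbTE ik; rewrite mxE ik.
Qed.

Lemma cps_sum (I : finType) (a : I -> nat -> R) z :
  (forall i, incv (a i) z) -> incv (fun n => \sum_i a i n) z ->
  cps (fun n => \sum_i a i n) z = \sum_i cps (a i) z.
Proof.
have E n : \sum_i a i n = \sum_i 1 * a i n by apply: eq_bigr => i _; rewrite mul1r.
move=> h1 h2; rewrite (cps_ext z E) cps_lin //.
  by apply: eq_bigr => i _; rewrite rmorph1 mul1r.
by move: h2; rewrite /incv (CV_radius_ext _ _ E).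
Qed.

Lemma psum_sum (I : finType) (a : I -> nat -> R) x N :
  psum (fun n => \sum_i a i n) x N = \sum_i psum (a i) x N.
Proof. by rewrite /psum exchange_big; apply: eq_bigr => n _; rewrite mulr_suml. Qed.

Lemma rad_le rho (a b : nat -> R) : (forall n, `|a n| <= `|b n|) -> rad rho b -> rad rho a.
Proof.
move=> ab h r hr; have [M hM] := h r hr; exists M => n; apply: le_trans (hM n).
by rewrite ler_wpM2r // exprn_ge0 //; case/andP: hr.
Qed.

Lemma rad_CV (rho : R) a : rad rho a -> Rbar_le rho (CV_radius a).
Proof.
move=> h; apply: Rbar_not_lt_le => hlt; have c0 := CV_radius_ge_0 a.
have [c [E cr]] : exists c : R, CV_radius a = Rbar.Finite c /\ 0 <= c < rho.
  move: hlt c0; case: (CV_radius a) => [c /= /RltP h1 /RleP h2| |] //.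
  by exists c; rewrite h1 h2.
case/andP: cr => c1 cr; have [|M hM] := h ((c + rho) / 2); first by apply/andP; split; lra.
have := proj1 (CV_radius_bounded a) ((c + rho) / 2); rewrite E /= => H.
have : ((c + rho) / 2 <= c).
  apply/RleP/H; exists M => n; apply/RleP; rewrite !RealsE normrM normrX.
  by rewrite (ger0_norm (_ : 0 <= (c + rho) / 2)); [exact: hM|lra].
lra.
Qed.

Lemma rad_derive rho a : rad rho a -> rad rho (PS_derive a).
Proof. by move=> h; apply: incv_rad; rewrite CV_radius_derive; apply: rad_CV. Qed.

Lemma rad_scal rho a c : rad rho a -> rad rho (fun n => a n * c).
Proof.
move=> h r hr; have [M hM] := h r hr; exists (M * `|c|) => n.
by rewrite normrM mulrAC ler_wpM2r.
Qed.

Lemma cps_scal rho a c z : rad rho a -> Cmod z < rho ->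
  cps (fun n => a n * c) z = cps a z * RtoC c.
Proof.
move=> h hz; apply: ccvg_unique (cps_cvg (rad_incv (rad_scal c h) hz)) _.
rewrite mulrC; apply: ccvg_ext (ccvgZ _ (cps_cvg (rad_incv h hz))) _ => n.
by rewrite /csum mulr_sumr; apply: eq_bigr => k _; rewrite rmorphM; ring.
Qed.

Section Disc.
Variables (d : nat) (p : 'I_d -> R) (W : 'M[R]_d) (T : 'I_d -> nat -> R) (rho : R).
Hypothesis p0 : forall i, 0 < p i.
Hypothesis W0 : forall i j, 0 <= W i j.
Hypothesis hT : tree_system p W T.
Hypothesis rho0 : 0 < rho.
Hypothesis hrad : forall i, CV_radius (T i) = Rbar.Finite rho.
Variables (tau : 'I_d -> R) (v : 'cV[R]_d) (u : 'rV[R]_d).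
Let A := \matrix_(i, j) (tau i * W i j).
Hypothesis tau0 : forall i, 0 < tau i.
Hypothesis tauE : forall i, tau i = p i * rho * exp (\sum_j W i j * tau j).
Hypothesis hpsum : forall i N, psum (T i) rho N <= tau i.
Hypothesis v0 : forall i, 0 < v i ord0.
Hypothesis u0 : forall i, 0 < u ord0 i.
Hypothesis Av : A *m v = v.
Hypothesis uA : u *m A = u.

Let T0 := tree_ge0 p0 W0 hT.

Lemma Tc_bound i z : Cmod z < rho -> Cmod (Tc T i z) <= tau i.
Proof.
move=> hz; apply: (cps_bound (r := rho)) => [||N]; last 1 first.
- by apply: le_trans (hpsum i N); apply: ler_sum => n _; rewrite ger0_norm // T0.
- exact: rad_incv (tree_rad hrad i) hz.
- exact: ltW.
Qed.

(** The map on the right-hand side maps the polydisc to itself and its Lipschitz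
    matrix is |z| / rho times A, so it contracts the distance with weights u. *)
Lemma polydisc_unique z (y y' : 'I_d -> C) : Cmod z < rho ->
  (forall i, Cmod (y i) <= tau i) -> (forall i, Cmod (y' i) <= tau i) ->
  (forall i, y i = RtoC (p i) * z * cexp (\sum_j RtoC (W i j) * y j)) ->
  (forall i, y' i = RtoC (p i) * z * cexp (\sum_j RtoC (W i j) * y' j)) ->
  forall i, y i = y' i.
Proof.
move=> hz yt y't hy hy'; pose D i := Cmod (y i - y' i).
have ReW (x : 'I_d -> C) i : (forall j, Cmod (x j) <= tau j) ->
    Re (\sum_j RtoC (W i j) * x j) <= \sum_j W i j * tau j.
  move=> hx; apply: le_trans (Re_le_Cmod _) _; apply: le_trans (Cmod_sum _ _ _) _.
  by apply: ler_sum => j _; rewrite CmodM CmodR_ge0 // ler_wpM2l.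
have DA i : D i <= Cmod z / rho * \sum_j A i j * D j.
  rewrite /D {1}hy {1}hy' -mulrBr CmodM CmodM CmodR_ge0 ?(ltW (p0 i)) //.
  apply: le_trans (_ : p i * Cmod z * (exp (\sum_j W i j * tau j) * \sum_j W i j * D j) <= _).
    rewrite ler_wpM2l ?mulr_ge0 ?Cmod_ge0 ?(ltW (p0 i)) //.
    apply: le_trans (cexp_lip (ReW _ _ y't) (ReW _ _ yt)) _.
    rewrite ler_pM2l ?expR_gt0 // -sumrB; apply: le_trans (Cmod_sum _ _ _) _.
    by apply: ler_sum => j _; rewrite -mulrBr CmodM CmodR_ge0.
  rewrite le_eqVlt; apply/orP; left; apply/eqP.
  have -> : \sum_j A i j * D j = tau i * \sum_j W i j * D j.
    by rewrite mulr_sumr; apply: eq_bigr => j _; rewrite mxE mulrA.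
  by rewrite (tauE i); move: (exp _) (\sum_j W i j * D j) => e s; field; rewrite gt_eqF.
have sE : \sum_i u ord0 i * D i = 0.
  have s0 : 0 <= \sum_i u ord0 i * D i.
    by rewrite sumr_ge0 // => i _; rewrite mulr_ge0 ?Cmod_ge0 // ltW.
  have : \sum_i u ord0 i * D i <= Cmod z / rho * \sum_i u ord0 i * D i.
    have {2}-> : \sum_i u ord0 i * D i = \sum_i u ord0 i * \sum_j A i j * D j.
      have -> : \sum_i u ord0 i * D i = \sum_i (u *m A) ord0 i * D i by rewrite uA.
      under eq_bigr do rewrite mxE mulr_suml.
      rewrite exchange_big; apply: eq_bigr => i _ /=; rewrite mulr_sumr.
      by apply: eq_bigr => j _; rewrite mulrA.
    rewrite mulr_sumr; apply: ler_sum => i _.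
    by rewrite mulrCA ler_wpM2l ?DA // ltW.
  have h : Cmod z / rho < 1 by rewrite ltr_pdivrMr // mul1r.
  by move=> h2; apply/eqP; rewrite eq_le s0 andbT; nra.
move=> i; apply/eqP; rewrite -subr_eq0 -Cmod_eq0 -/(D i).
move/eqP: sE; rewrite psumr_eq0 => [/allP h|j _]; last by rewrite mulr_ge0 ?Cmod_ge0 // ltW.
by have := h i (mem_index_enum _); rewrite /= mulf_eq0 gt_eqF.
Qed.

Let M := transfer_matrix W T.

Let ME n i j : M n i j = T i n * W i j.
Proof. by rewrite /M /transfer_matrix mul_diag_mx !mxE. Qed.

Let M0 : M 0%N = 0.
Proof. by apply/matrixP => i j; rewrite ME (tree0 hT) mul0r mxE. Qed.

Let powE k i j n : (fps_pow M k.+1 n) i j = \sum_l fps_mul (fun n => M n i l) (fun n => fps_pow M k n l j) n.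
Proof.
rewrite fps_powS /fps_mul summxE exchange_big; apply: eq_bigr => m _ /=.
by rewrite mxE.
Qed.

Let pow_ge0 k i j n : 0 <= (fps_pow M k n) i j.
Proof.
elim: k i j n => [|k IH] i j n.
  by rewrite /fps_pow /= /fps_one; case: n => [|n]; rewrite mxE ?ler0n.
rewrite powE sumr_ge0 // => l _; rewrite sumr_ge0 // => m _.
by rewrite mulr_ge0 // ME mulr_ge0 // T0.
Qed.

(** The partial sums of A(z)^k at rho, applied to v, stay below v because v is
    fixed by A(rho).  This bounds the coefficients of all powers at once. *)
Let pow_bound k i N : \sum_j psum (fun n => fps_pow M k n i j) rho N * v j ord0 <= v i ord0.
Proof.
elim: k i => [|k IH] i.
  rewrite (bigD1 i) //= big1 ?addr0 => [|j ji].
    rewrite /psum big_ord_recl big1 => [|n _]; rewrite /fps_pow /= /fps_one /=; last by rewrite mxE mul0r.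
    by rewrite mxE eqxx expr0 mulr1 addr0 mul1r.
  rewrite /psum big1 ?mul0r // => n _; rewrite /fps_pow /= /fps_one.
  by case: (nat_of_ord n) => [|m]; rewrite !mxE ?mul0r // eq_sym (negbTE ji) mul0r.
apply: (@le_trans _ _ (\sum_j (\sum_l psum (fun n => M n i l) rho N * psum (fun n => fps_pow M k n l j) rho N) * v j ord0)).
  apply: ler_sum => j _; rewrite ler_wpM2r ?(ltW (v0 _)) //.
  have -> : psum (fun n => fps_pow M k.+1 n i j) rho N =
     psum (fun n => \sum_l fps_mul (fun n => M n i l) (fun n => fps_pow M k n l j) n) rho N.
    by apply: eq_bigr => n _; rewrite powE.
  rewrite psum_sum; apply: ler_sum => l _; apply: psum_mul_le => // [n|]; last exact: ltW.
  by rewrite ME mulr_ge0 // T0.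
have -> : \sum_j (\sum_l psum (fun n => M n i l) rho N * psum (fun n => fps_pow M k n l j) rho N) * v j ord0 =
  \sum_l psum (fun n => M n i l) rho N * \sum_j psum (fun n => fps_pow M k n l j) rho N * v j ord0.
  under eq_bigr do rewrite mulr_suml.
  rewrite exchange_big; apply: eq_bigr => l _ /=; rewrite mulr_sumr.
  by apply: eq_bigr => j _; rewrite mulrA.
rewrite -[in leRHS]Av [leRHS]mxE; apply: ler_sum => l _.
have ml : psum (fun n => M n i l) rho N <= A i l.
  have -> : psum (fun n => M n i l) rho N = psum (T i) rho N * W i l.
    by rewrite /psum mulr_suml; apply: eq_bigr => n _; rewrite ME mulrAC.
  by rewrite mxE ler_wpM2r.
apply: le_trans (_ : A i l * (\sum_j psum (fun n => fps_pow M k n l j) rho N * v j ord0) <= _).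
  rewrite ler_wpM2r // sumr_ge0 // => j _; rewrite mulr_ge0 ?(ltW (v0 _)) //.
  by rewrite psum_ge0 // ltW.
by rewrite ler_wpM2l // mxE mulr_ge0 // ltW.
Qed.

Let pow_term k i j n : (fps_pow M k n) i j * rho ^+ n <= v i ord0 / v j ord0.
Proof.
rewrite ler_pdivlMr //; apply: le_trans (pow_bound k i n).
rewrite (bigD1 j) //=; apply: (@le_trans _ _ (psum (fun n => fps_pow M k n i j) rho n * v j ord0)).
  rewrite ler_wpM2r ?(ltW (v0 _)) // /psum big_ord_recr /= lerDr.
  by rewrite sumr_ge0 // => m _; rewrite mulr_ge0 ?exprn_ge0 // ltW.
rewrite lerDl sumr_ge0 // => l _; rewrite mulr_ge0 ?(ltW (v0 _)) // psum_ge0 // ltW //.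
Qed.

Let g i j n := (fps_geom M n) i j.

Let g_sum i j n : g i j n = \sum_(k < n.+1) (fps_pow M k n) i j.
Proof. by rewrite /g /fps_geom summxE. Qed.

Let g_ge0 i j n : 0 <= g i j n.
Proof. by rewrite g_sum sumr_ge0. Qed.

Let g_rad i j : rad rho (g i j).
Proof.
apply: (@rad_poly _ _ (v i ord0 / v j ord0)) => // [|n]; first by rewrite divr_ge0 // ltW.
rewrite ger0_norm // g_sum mulr_suml.
apply: (@le_trans _ _ (\sum_(k < n.+1) v i ord0 / v j ord0)).
  by apply: ler_sum => k _; apply: pow_term.
by rewrite sumr_const card_ord mulr_natr.
Qed.

Let M_rad i j : rad rho (fun n => M n i j).
Proof.
apply: rad_le (rad_scal (W i j) (tree_rad hrad i)) => n.
by rewrite ME.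
Qed.

Let cps_M i j z : Cmod z < rho -> cps (fun n => M n i j) z = Tc T i z * RtoC (W i j).
Proof.
move=> hz; rewrite /Tc -(cps_scal (W i j) (tree_rad hrad i) hz).
by apply: cps_ext => n; rewrite ME.
Qed.

Let h i j n := \sum_l fps_mul (fun n => M n i l) (g l j) n.

Let gE i j n : g i j n = ((n == 0%N) && (i == j))%:R + h i j n.
Proof.
rewrite /g (fps_geomE M0) mxE; congr (_ + _).
  by rewrite /fps_one; case: n => [|n]; rewrite mxE //=.
rewrite /h /fps_mul summxE exchange_big; apply: eq_bigr => m _ /=.
by rewrite mxE.
Qed.

Let fmul_ge0 i l j n : 0 <= fps_mul (fun n => M n i l) (g l j) n.
Proof. by rewrite sumr_ge0 // => m _; rewrite mulr_ge0 // ME mulr_ge0 // T0. Qed.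

Let h_ge0 i j n : 0 <= h i j n.
Proof. by rewrite sumr_ge0. Qed.

Let h_rad i j : rad rho (h i j).
Proof. by apply: rad_le (@g_rad i j) => n; rewrite !ger0_norm // gE lerDr ler0n. Qed.

Let fmul_rad i l j : rad rho (fps_mul (fun n => M n i l) (g l j)).
Proof.
apply: rad_le (@h_rad i j) => n; rewrite !ger0_norm //.
by rewrite /h (bigD1 l) //= lerDl sumr_ge0.
Qed.

Definition transfer_fun z : 'M[C]_d := \matrix_(i, j) (Tc T i z * RtoC (W i j)).

Let Rc z : 'M[C]_d := \matrix_(i, j) cps (g i j) z.

Let resolvent z : Cmod z < rho -> (1%:M - transfer_fun z) *m Rc z = 1%:M.
Proof.
move=> hz; rewrite mulmxBl mul1mx; apply/eqP; rewrite subr_eq; apply/eqP/matrixP => i j.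
rewrite !mxE; have := rad_incv (@g_rad i j) hz => hg.
have := rad_incv (@h_rad i j) hz => hh.
transitivity ((i == j)%:R + cps (h i j) z).
  apply: ccvg_unique (cps_cvg hg) _.
  apply: ccvg_ext (ccvgD (ccvg_const _) (cps_cvg hh)) _ => n.
  rewrite /csum [in RHS]big_ord_recl [in LHS]big_ord_recl [in RHS]gE addrA /=.
  congr (_ + _); first by rewrite !expr0 !mulr1 rmorphD rmorph_nat.
  by apply: eq_bigr => k _; rewrite gE add0r.
congr (_ + _); rewrite /h cps_sum => [|l|]; [|exact: rad_incv (@fmul_rad i l j) hz|exact: hh].
apply: eq_bigr => l _; rewrite cps_mul ?cps_M // ?mxE //.
  exact: rad_incv (@M_rad i l) hz.
exact: rad_incv (@g_rad l j) hz.
Qed.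

Let c := cycle_egf W T.

Let cE n : c n = \sum_(k < n) (\sum_i fps_pow M k.+1 n i i) / k.+1%:R.
Proof. by rewrite /c /cycle_egf big_add1 big_mkord. Qed.

Let c_ge0 n : 0 <= c n.
Proof. by rewrite cE sumr_ge0 // => k _; rewrite divr_ge0 ?sumr_ge0 ?ler0n. Qed.

Lemma cycle_rad : rad rho c.
Proof.
apply: (@rad_poly _ _ d%:R) => // n; rewrite ger0_norm // cE mulr_suml.
apply: (@le_trans _ _ (\sum_(k < n) d%:R)).
  apply: ler_sum => k _; rewrite mulrAC ler_pdivrMr ?ltr0n //.
  apply: (@le_trans _ _ (d%:R)); last by rewrite ler_peMr ?ler0n // ler1n.
  rewrite mulr_suml; apply: (@le_trans _ _ (\sum_(i < d) 1)).
    by apply: ler_sum => i _; apply: le_trans (pow_term _ _ _ _) _; rewrite divff // gt_eqF.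
  by rewrite sumr_const card_ord.
by rewrite sumr_const card_ord -[leLHS]mulr_natr ler_wpM2l ?ler0n // ler_nat.
Qed.

Lemma cycle_incv z : Cmod z < rho -> incv c z.
Proof. exact: rad_incv cycle_rad. Qed.

(** Written with scalar Cauchy products, whose sums are products of functions. *)
Let cdE n : PS_derive c n = \sum_i \sum_l fps_mul (g i l) (PS_derive (fun n => M n l i)) n.
Proof.
rewrite /PS_derive !RealsE mulr_natl -[LHS]/(fps_deriv c n) (cycle_egf_deriv _ _ (tree0 hT)).
rewrite /mxtrace; apply: eq_bigr => i _; rewrite /fps_mul summxE exchange_big.
apply: eq_bigr => m _; rewrite mxE; apply: eq_bigr => l _.
by rewrite /fps_deriv !RealsE mulr_natl mulmxnE.
Qed.

Let fd_ge0 i l n : 0 <= fps_mul (g i l) (PS_derive (fun n => M n l i)) n.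
Proof.
rewrite sumr_ge0 // => m _; rewrite mulr_ge0 // /PS_derive !RealsE mulr_ge0 ?ler0n //.
by rewrite ME mulr_ge0 // T0.
Qed.

Let fd1_rad i : rad rho (fun n => \sum_l fps_mul (g i l) (PS_derive (fun n => M n l i)) n).
Proof.
apply: rad_le (rad_derive cycle_rad) => n; rewrite cdE.
rewrite !ger0_norm ?sumr_ge0 // => [|k _]; last by rewrite sumr_ge0.
by rewrite [leRHS](bigD1 i) //= lerDl sumr_ge0 // => k _; rewrite sumr_ge0.
Qed.

Let fd_rad i l : rad rho (fps_mul (g i l) (PS_derive (fun n => M n l i))).
Proof.
apply: rad_le (@fd1_rad i) => n; rewrite (ger0_norm (fd_ge0 _ _ _)) ger0_norm.
  by rewrite [leRHS](bigD1 l) //= lerDl; apply: sumr_ge0 => k _; apply: fd_ge0.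
by apply: sumr_ge0 => k _; apply: fd_ge0.
Qed.

Let Ad z : 'M[C]_d := \matrix_(i, j) (cps (PS_derive (T i)) z * RtoC (W i j)).

Let cps_cd z : Cmod z < rho -> cps (PS_derive c) z = \tr (Rc z *m Ad z).
Proof.
move=> hz; rewrite (cps_ext z cdE) cps_sum => [|i|].
- apply: eq_bigr => i _; rewrite mxE cps_sum => [|l|].
  + apply: eq_bigr => l _; rewrite cps_mul ?mxE.
    * congr (_ * _); rewrite -(cps_scal _ (rad_derive (tree_rad hrad l)) hz).
      by apply: cps_ext => n; rewrite /PS_derive !RealsE ME mulrA.
    * exact: rad_incv (@g_rad i l) hz.
    * exact: rad_incv (rad_derive (@M_rad l i)) hz.
  + exact: rad_incv (@fd_rad i l) hz.
  + exact: rad_incv (@fd1_rad i) hz.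
- exact: rad_incv (@fd1_rad i) hz.
- by have := incv_derive (cycle_incv hz); rewrite /incv (CV_radius_ext _ _ cdE).
Qed.

(** The functions det(1 - A) and exp(- C) both satisfy y' = - C' y: the former by
    Jacobi's formula, since adj(1 - A) is det(1 - A) times the resolvent Rc. *)
Lemma det_transfer_disc z : Cmod z < rho ->
  \det (1%:M - transfer_fun z) = cexp (- cps c z).
Proof.
move=> hz; pose f w := \det (1%:M - transfer_fun w) * cexp (cps c w).
suff E : f z = 1.
  by rewrite cexpN -[LHS](mulfK (cexp_neq0 (cps c z))) -/(f z) E div1r.
have A0 : transfer_fun 0 = 0.
  by apply/matrixP => i j; rewrite !mxE /Tc cps0 (tree0 hT) rmorph0 mul0r.
have f0 : f 0 = 1.
  rewrite /f A0 subr0 det1 mul1r cps0 cE big_ord0 rmorph0 cexp0 //.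
rewrite -f0; apply: cderiv0_const => t /andP[t0 t1]; set w := 0 + _.
have hw : Cmod w < rho.
  rewrite /w add0r subr0 CmodM CmodR_ge0 //; apply: le_lt_trans hz.
  by rewrite -[leRHS]mul1r ler_wpM2r ?Cmod_ge0.
have dP := cps_deriv (cycle_incv hw).
have dD : cderiv (fun w => \det (1%:M - transfer_fun w)) w (\tr (\adj (1%:M - transfer_fun w) *m (- Ad w))).
  apply: jacobi_formula => i j.
  have dT := cps_deriv (rad_incv (tree_rad hrad i) hw).
  have := cderivB (cderiv_const ((1%:M : 'M[C]_d) i j) w) (cderivM dT (cderiv_const (RtoC (W i j)) w)).
  move=> /(cderiv_ext ltr01) dd; apply: cderiv_eq (dd _ _) _ => [w' _|].
    by rewrite !mxE.
  by rewrite !mxE mulr0 addr0 sub0r.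
apply: cderiv_eq (cderivM dD (cderiv_comp dP (cexp_deriv _))) _.
rewrite cps_cd //.
have -> : \adj (1%:M - transfer_fun w) = \det (1%:M - transfer_fun w) *: Rc w.
  transitivity (\adj (1%:M - transfer_fun w) *m ((1%:M - transfer_fun w) *m Rc w)).
    by rewrite resolvent // mulmx1.
  by rewrite mulmxA mul_adj_mx mul_scalar_mx.
rewrite mulmxN -scalemxAl raddfN /= mxtraceZ; ring.
Qed.

End Disc.

(** * Uniformization at the critical point *)

(** Two factorizations of the block matrix with rows (Q, v) and (u, 1). *)
Lemma det_rank1 (F : fieldType) n (Q : 'M[F]_n) (v : 'cV[F]_n) (u : 'rV[F]_n) :
  Q \in unitmx -> \det (Q - v *m u) = \det Q * (1 - (u *m invmx Q *m v) ord0 ord0).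
Proof.
move=> Qu.
have E1 : block_mx Q v u (1%:M : 'M_1) =
    block_mx 1%:M v 0 1%:M *m block_mx (Q - v *m u) 0 u 1%:M.
  by rewrite mulmx_block !mul1mx !mul0mx !mulmx1 ?mulmx0 ?add0r ?addr0 subrK.
have E2 : block_mx Q v u (1%:M : 'M_1) =
    block_mx 1%:M 0 (u *m invmx Q) 1%:M *m block_mx Q v 0 (1%:M - u *m invmx Q *m v).
  rewrite mulmx_block !mul1mx ?mul0mx ?mulmx0 ?addr0 ?add0r.
  by rewrite -mulmxA mulVmx // mulmx1 addrC subrK.
have := congr1 determinant E1; rewrite {1}E2 !det_mulmx det_lblock !det_ublock det_lblock !det1 !mul1r mulr1 => <-.
by rewrite det_mx11 !mxE.
Qed.

Lemma hol_adj n (Q : C -> 'M[C]_n) z i j :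
  (forall i j, hol (fun w => Q w i j) z) -> hol (fun w => (\adj (Q w)) i j) z.
Proof.
move=> h; apply: (@hol_ext (fun w => cofactor (Q w) j i) _ _ 1) => // [w _|]; first by rewrite mxE.
apply: holM; first exact: hol_const.
apply: hol_det => k l; apply: hol_ext ltr01 _ (h (lift j k) (lift i l)) => w _.
by rewrite !mxE.
Qed.

Section Uniformization.
Variables (d : nat) (i0 : 'I_d) (p : 'I_d -> R) (W : 'M[R]_d) (rho : R).
Variables (tau : 'I_d -> R) (v : 'cV[R]_d) (u : 'rV[R]_d).
Let A := \matrix_(i, j) (tau i * W i j).
Hypothesis tau0 : forall i, 0 < tau i.
Hypothesis tauE : forall i, tau i = p i * rho * exp (\sum_j W i j * tau j).
Hypothesis v0 : forall i, 0 < v i ord0.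
Hypothesis u0 : forall i, 0 < u ord0 i.
Hypothesis Av : A *m v = v.
Hypothesis uA : u *m A = u.
Hypothesis uv : (u *m v) ord0 ord0 = 1.
Hypothesis Aker : forall y : 'cV[R]_d, A *m y = y -> exists c : R, y = c *: v.

Let Wv i := \sum_j W i j * v j ord0.

Let tauWv i : tau i * Wv i = v i ord0.
Proof.
rewrite -[in RHS]Av mxE mulr_sumr; apply: eq_bigr => j _.
by rewrite mxE mulrA.
Qed.

Let Wv0 i : 0 < Wv i.
Proof. by rewrite -(pmulr_rgt0 _ (tau0 i)) tauWv. Qed.

Let sum_gt0 (f : 'I_d -> R) : (forall i, 0 < f i) -> 0 < \sum_i f i.
Proof.
move=> f0; rewrite (bigD1 i0) //= ltr_pwDl // sumr_ge0 // => i _; exact: ltW.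
Qed.

(** The positive root of the quadratic equation u m(0, - al v) = 0; the first order
    of the solution branch x is - al v, negative because T increases to tau. *)
Let al := Num.sqrt ((\sum_i u ord0 i * tau i) / \sum_i u ord0 i * tau i * (Wv i ^+ 2 / 2)).

Let den_gt0 : 0 < \sum_i u ord0 i * tau i * (Wv i ^+ 2 / 2).
Proof. by apply: sum_gt0 => i; rewrite !mulr_gt0 ?divr_gt0 ?exprn_gt0 // invr_gt0 ltr0n. Qed.

Let al0 : 0 < al.
Proof. by rewrite sqrtr_gt0 divr_gt0 //; apply: sum_gt0 => i; rewrite mulr_gt0. Qed.

Let alE : \sum_i u ord0 i * (tau i * (al ^+ 2 * Wv i ^+ 2 / 2 - 1)) = 0.
Proof.
have -> : \sum_i u ord0 i * (tau i * (al ^+ 2 * Wv i ^+ 2 / 2 - 1)) =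
  al ^+ 2 * (\sum_i u ord0 i * tau i * (Wv i ^+ 2 / 2)) - \sum_i u ord0 i * tau i.
  by rewrite mulr_sumr -sumrB; apply: eq_bigr => i _; ring.
rewrite sqr_sqrtr; first by rewrite divfK ?subrr // gt_eqF.
by rewrite ltW // divr_gt0 //; apply: sum_gt0 => i; rewrite mulr_gt0.
Qed.

(** Put z = rho (1 - s ^ 2) and y = tau + s x in the system, use cexp2 to remove the
    terms of order 0 and 1 in s, and divide by s: what remains is
    x = A x + s m(s, x).  As 1 - A is singular, this is degenerate at s = 0, and H
    adds the term v (u m).  Applying u to H = 0 gives (1 - s) (u m) = 0, so that
    the added term vanishes on the solutions with |s| < 1.  The functions lw, ls,
    lm and lH are the gradients. *)
Let w i (b : option 'I_d -> C) := \sum_j RtoC (W i j) * b (Some j).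
Let m i b := RtoC (tau i) *
  (w i b * w i b * cexp2 (b None * w i b) - cexp (b None * w i b)).
Let H i (b : option 'I_d -> C) := b (Some i) - \sum_j RtoC (A i j) * b (Some j)
  - b None * m i b + RtoC (v i ord0) * \sum_k RtoC (u ord0 k) * m k b.

Let lw i (o : option 'I_d) := \sum_j RtoC (W i j) * (o == Some j)%:R.
Let ls i b (o : option 'I_d) := (o == None)%:R * w i b + b None * lw i o.
Let lm i b o := RtoC (tau i) * ((lw i o * w i b + w i b * lw i o) * cexp2 (b None * w i b)
  + w i b * w i b * (cexp2' (b None * w i b) * ls i b o)
  - cexp (b None * w i b) * ls i b o).
Let lH i b o := (o == Some i)%:R - \sum_j RtoC (A i j) * (o == Some j)%:R
  - ((o == None)%:R * m i b + b None * lm i b o)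
  + RtoC (v i ord0) * \sum_k RtoC (u ord0 k) * lm k b o.

Let sdiffZ (J : finType) (f : (J -> C) -> C) a l (c : C) : sdiff f a l ->
  sdiff (fun b => c * f b) a (fun j => c * l j).
Proof.
move=> h; apply: sdiff_eq (sdiffM (sdiff_const c a) h) _ => j.
by rewrite mul0r add0r.
Qed.

Let sdiffB (J : finType) (f g : (J -> C) -> C) a l l' : sdiff f a l -> sdiff g a l' ->
  sdiff (fun b => f b - g b) a (fun j => l j - l' j).
Proof.
move=> hf hg; apply: sdiff_ext (sdiff_eq (sdiffD hf (sdiffZ (-1) hg)) _) _ => [j|b]; ring.
Qed.

Let w_sdiff i a : sdiff (w i) a (lw i).
Proof. by apply: sdiff_sum => j; apply: sdiffZ; apply: sdiff_proj. Qed.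

Let m_sdiff i a : sdiff (m i) a (lm i a).
Proof.
have hw := @w_sdiff i a.
have hs : sdiff (fun b => b None * w i b) a (ls i a) := sdiffM (sdiff_proj None a) hw.
apply: sdiffZ; apply: sdiffB.
  apply: sdiffM; first exact: (sdiffM hw hw).
  by apply: sdiff_comp hs; [exact: cexp2_deriv|exact: cexp2'_cont].
by apply: sdiff_comp hs; [exact: cexp_deriv|exact: cexp_cont].
Qed.

Let H_sdiff i a : sdiff (H i) a (lH i a).
Proof.
apply: sdiffD; last first.
  by apply: sdiffZ; apply: sdiff_sum => k; apply: sdiffZ; apply: m_sdiff.
apply: sdiffB; last exact: sdiffM (sdiff_proj None a) (@m_sdiff i a).
apply: sdiffB; first exact: sdiff_proj.
by apply: sdiff_sum => j; apply: sdiffZ; apply: sdiff_proj.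
Qed.

Let x0 i := RtoC (- (al * v i ord0)).
Let a0 := cpt 0 x0.

Let w_a0 i : w i a0 = RtoC (- (al * Wv i)).
Proof.
rewrite /w /Wv mulr_sumr -sumrN rmorph_sum; apply: eq_bigr => j _ /=.
by rewrite /x0 -rmorphM; congr RtoC; ring.
Qed.

Let m_a0 i : m i a0 = RtoC (tau i * (al ^+ 2 * Wv i ^+ 2 / 2 - 1)).
Proof.
rewrite /m /= !mul0r cexp0 cexp2_0 w_a0 -(rmorph1 RtoC) -!rmorphM -rmorphB -rmorphM.
by congr RtoC; ring.
Qed.

Let um_a0 : \sum_k RtoC (u ord0 k) * m k a0 = 0.
Proof.
rewrite -[RHS](rmorph0 RtoC) -alE rmorph_sum; apply: eq_bigr => k _.
by rewrite m_a0 -rmorphM.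
Qed.

Let A_x0 i : x0 i - \sum_j RtoC (A i j) * x0 j = 0.
Proof.
have -> : \sum_j RtoC (A i j) * x0 j = RtoC (\sum_j A i j * - (al * v j ord0)).
  by rewrite rmorph_sum; apply: eq_bigr => j _; rewrite rmorphM.
have -> : \sum_j A i j * - (al * v j ord0) = - (al * (A *m v) i ord0).
  by rewrite [in RHS]mxE mulr_sumr -sumrN; apply: eq_bigr => j _; ring.
by rewrite Av subrr.
Qed.

Let H_a0 i : H i a0 = 0.
Proof. by rewrite /H um_a0 mulr0 addr0 /= mul0r subr0 A_x0. Qed.

Let r j := \sum_k u ord0 k * v k ord0 * W k j.
Let Jr : 'M[R]_d := \matrix_(i, j) ((i == j)%:R - A i j - al * v i ord0 * r j).

Let uAy (y : 'cV[R]_d) : u *m (A *m y) = u *m y.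
Proof. by rewrite mulmxA uA. Qed.

(** If Jr y = 0, applying u gives r y = 0, then y = A y is a multiple of v, and r v
    is positive. *)
Let Jr_unit : Jr \in unitmx.
Proof.
have [//|/notunit_ker[y y0 Jy]] := boolP (Jr \in unitmx); exfalso.
pose t := \sum_j r j * y j ord0.
have E : y - A *m y = (al * t) *: v.
  apply/matrixP => i j; rewrite ord1 !mxE.
  move/matrixP: Jy => /(_ i ord0); rewrite !mxE => Jy.
  have : \sum_j Jr i j * y j ord0 = y i ord0 - \sum_j A i j * y j ord0 - al * v i ord0 * t.
    rewrite /t mulr_sumr.
    have -> : y i ord0 = \sum_j (i == j)%:R * y j ord0.
      rewrite (bigD1 i) //= eqxx mul1r big1 ?addr0 // => k ki.
      by rewrite eq_sym (negbTE ki) mul0r.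
    by rewrite -!sumrB; apply: eq_bigr => k _; rewrite mxE; ring.
  rewrite Jy => /esym/eqP; rewrite subr_eq0 => /eqP ->; ring.
have t0 : t = 0.
  have := congr1 (fun z : 'cV_d => (u *m z) ord0 ord0) E.
  rewrite mulmxBr uAy subrr -scalemxAr [LHS]mxE [RHS]mxE uv mulr1 => /esym/eqP.
  by rewrite mulf_eq0 gt_eqF //= => /eqP.
have [|c yc] := Aker (y := y).
  by apply/esym/eqP; rewrite -subr_eq0 E t0 mulr0 scale0r.
have rv : \sum_j r j * v j ord0 = \sum_k u ord0 k * v k ord0 * Wv k.
  under eq_bigr do rewrite mulr_suml.
  rewrite exchange_big; apply: eq_bigr => k _; rewrite mulr_sumr.
  by apply: eq_bigr => j _; rewrite mulrA.
have : c * \sum_k u ord0 k * v k ord0 * Wv k = 0.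
  rewrite -rv -[RHS]t0 /t yc mulr_sumr; apply: eq_bigr => j _.
  by rewrite mxE mulrCA.
have sp : 0 < \sum_k u ord0 k * v k ord0 * Wv k by apply: sum_gt0 => k; rewrite !mulr_gt0.
move/eqP; rewrite mulf_eq0 [X in _ || X]gt_eqF // orbF => /eqP c0.
by move: y0; rewrite yc c0 scale0r eqxx.
Qed.

Let lw_Some i j : lw i (Some j) = RtoC (W i j).
Proof.
rewrite /lw (bigD1 j) //= eqxx mulr1 big1 ?addr0 // => k kj.
by rewrite (inj_eq Some_inj) eq_sym (negbTE kj) mulr0.
Qed.

Let ls_a0 i j : ls i a0 (Some j) = 0.
Proof. by rewrite /ls /= mul0r mul0r addr0. Qed.

Let lm_a0 i j : lm i a0 (Some j) = RtoC (- (al * v i ord0 * W i j)).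
Proof.
rewrite /lm ls_a0 !mulr0 subr0 addr0 lw_Some /= mul0r cexp2_0 w_a0.
rewrite -!(rmorphM, rmorphD); congr RtoC; rewrite -(tauWv i); by field.
Qed.

Let lH_a0 : \matrix_(i, j) lH i a0 (Some j) = map_mx RtoC Jr.
Proof.
apply/matrixP => i j; rewrite !mxE /lH !(inj_eq Some_inj).
have -> : \sum_k RtoC (A i k) * (Some j == Some k)%:R = RtoC (A i j).
  rewrite (bigD1 j) //= eqxx mulr1 big1 ?addr0 // => k kj.
  by rewrite (inj_eq Some_inj) eq_sym (negbTE kj) mulr0.
have -> : \sum_k RtoC (u ord0 k) * lm k a0 (Some j) = RtoC (- al * r j).
  rewrite /r mulr_sumr rmorph_sum; apply: eq_bigr => k _.
  by rewrite lm_a0 -rmorphM; congr RtoC; ring.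
rewrite /= !mul0r addr0 subr0 eq_sym -(rmorph_nat RtoC) -!rmorphM -!rmorphB -rmorphD.
by congr RtoC; rewrite /A !mxE; ring.
Qed.

Lemma uniformization : exists dl al (X : C -> 'I_d -> C), [/\ 0 < dl, 0 < al,
  forall i, X 0 i = RtoC (- (al * v i ord0)),
  forall s, Cmod s < dl -> forall i, hol (fun s => X s i) s &
  forall s, Cmod s < dl -> forall i, let Y i := RtoC (tau i) + s * X s i in
    Y i = RtoC (p i) * (RtoC rho * (1 - s ^+ 2)) * cexp (\sum_j RtoC (W i j) * Y j)].
Proof.
have [|dl [X [dl0 X0 HX holX]]] := @implicit_function d H 0 x0 (fun i => lH i a0)
  (fun i a => ex_intro _ _ (@H_sdiff i a)) (fun i => @H_sdiff i a0) _ H_a0.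
  by rewrite lH_a0 map_unitmx Jr_unit.
exists (Num.min dl 1), al, X; split=> //.
- by rewrite lt_min dl0 ltr01.
- by move=> s; rewrite lt_min => /andP[hs _] i; apply: holX; rewrite subr0.
move=> s; rewrite lt_min => /andP[hs s1].
have {}HX i : H i (cpt s (X s)) = 0 by apply: HX; rewrite subr0.
set b := cpt s (X s) in HX.
have um : \sum_k RtoC (u ord0 k) * m k b = 0.
  set Um := \sum_k _.
  have : \sum_i RtoC (u ord0 i) * H i b = (1 - s) * Um.
    have -> : \sum_i RtoC (u ord0 i) * H i b =
      (\sum_i RtoC (u ord0 i) * X s i - \sum_i RtoC (u ord0 i) * \sum_j RtoC (A i j) * X s j)
      - s * Um + RtoC (\sum_i u ord0 i * v i ord0) * Um.
      rewrite rmorph_sum mulr_suml {1}/Um mulr_sumr -!sumrB -big_split.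
      by apply: eq_bigr => i _; rewrite /H -/Um /b /= rmorphM; ring.
    have -> : \sum_i u ord0 i * v i ord0 = 1 by rewrite -uv mxE.
    have -> : \sum_i RtoC (u ord0 i) * (\sum_j RtoC (A i j) * X s j) = \sum_i RtoC (u ord0 i) * X s i.
      have uAj j : u ord0 j = \sum_i u ord0 i * A i j by rewrite -[in LHS]uA mxE.
      under eq_bigr do rewrite mulr_sumr.
      rewrite exchange_big; apply: eq_bigr => j _; rewrite [in RHS]uAj rmorph_sum mulr_suml.
      by apply: eq_bigr => i _; rewrite rmorphM mulrA.
    by rewrite rmorph1; ring.
  rewrite big1 => [/esym/eqP|i _]; last by rewrite HX mulr0.
  rewrite mulf_eq0 subr_eq0 => /orP[/eqP s1'|/eqP //].
  by move: s1; rewrite -s1' Cmod1 ltxx.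
have eqX i : X s i = RtoC (tau i) * w i b + s * m i b.
  have := HX i; rewrite /H um mulr0 addr0 /b /= -/b => /eqP; rewrite subr_eq0 subr_eq => /eqP ->.
  rewrite addrC; congr (_ + _); rewrite /w mulr_sumr; apply: eq_bigr => j _.
  by rewrite mxE rmorphM mulrA.
move=> i /=.
have -> : \sum_j RtoC (W i j) * (RtoC (tau j) + s * X s j) = RtoC (\sum_j W i j * tau j) + s * w i b.
  rewrite rmorph_sum /w mulr_sumr -big_split; apply: eq_bigr => j _ /=.
  by rewrite rmorphM; ring.
rewrite cexpD cexpR.
have -> : RtoC (p i) * (RtoC rho * (1 - s ^+ 2)) * (RtoC (exp (\sum_j W i j * tau j)) * cexp (s * w i b)) =
  RtoC (p i * rho * exp (\sum_j W i j * tau j)) * (1 - s ^+ 2) * cexp (s * w i b).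
  by rewrite !rmorphM; ring.
rewrite -tauE eqX /m -/b /=.
have := cexp2E (s * w i b).
move: (cexp (s * w i b)) (cexp2 (s * w i b)) (w i b) (RtoC (tau i)) => e e2 wi ti ->.
ring.
Qed.

Let Cm m n (B : 'M[R]_(m, n)) : 'M[C]_(m, n) := map_mx RtoC B.
Let N : 'M[R]_d := 1%:M - A + v *m u.

Let Nv : N *m v = v.
Proof.
rewrite mulmxDl mulmxBl mul1mx Av subrr add0r -mulmxA.
by rewrite (mx11_scalar (u *m v)) uv mulmx1.
Qed.

Let uN : u *m N = u.
Proof.
rewrite mulmxDr mulmxBr mulmx1 uA subrr add0r mulmxA.
by rewrite (mx11_scalar (u *m v)) uv mul1mx.
Qed.

Let N_unit : N \in unitmx.
Proof.
have [//|/notunit_ker[y y0 Ny]] := boolP (N \in unitmx); exfalso.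
have uy : u *m y = 0 by rewrite -uN -mulmxA Ny mulmx0.
have [|c yc] := Aker (y := y).
  move: Ny; rewrite mulmxDl mulmxBl mul1mx -mulmxA uy mulmx0 addr0 => /eqP.
  by rewrite subr_eq0 => /eqP.
move: uy; rewrite yc -scalemxAr => /matrixP /(_ ord0 ord0); rewrite mxE uv mxE mulr1 => c0.
by move: y0; rewrite yc c0 scale0r eqxx.
Qed.

(** With N = 1 - A(rho) + v u, which is invertible, N v = v and u N = u, the matrix
    1 - A(s) is a perturbation by v u of Q = N - s diag(x) W.  The formula for
    rank one perturbations then makes the factor s explicit:
    det(1 - A(s)) = - s u adj(Q) diag(x) W v. *)
Lemma simple_zero be (X : C -> 'I_d -> C) dl : 0 < dl -> 0 < be ->
  (forall i, X 0 i = RtoC (- (be * v i ord0))) ->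
  (forall s, Cmod s < dl -> forall i, hol (fun s => X s i) s) ->
  exists dl' (E : C -> C), [/\ 0 < dl',
    exists2 e0 : R, e0 != 0 & E 0 = RtoC e0,
    forall s, Cmod s < dl -> hol E s &
    forall s, Cmod s < dl' ->
      \det (1%:M - \matrix_(i, j) ((RtoC (tau i) + s * X s i) * RtoC (W i j))) = s * E s].
Proof.
move=> dl0 a_gt0 X0 holX.
pose Xm s : 'M[C]_d := \matrix_(i, j) (X s i * RtoC (W i j)).
pose Q s := Cm N - s *: Xm s.
have holXm s i j : Cmod s < dl -> hol (fun s => Xm s i j) s.
  move=> hs; apply: hol_ext ltr01 _ (holM (holX s hs i) (hol_const (RtoC (W i j)) s)) => t _.
  by rewrite mxE.
have holQ s i j : Cmod s < dl -> hol (fun s => Q s i j) s.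
  move=> hs; apply: hol_ext ltr01 _ (holB (hol_const (Cm N i j) s) (holM (hol_id s) (holXm s i j hs))) => t _.
  by rewrite !mxE.
pose E s := - (Cm u *m \adj (Q s) *m (Xm s *m Cm v)) ord0 ord0.
have h0 : Cmod 0 < dl by rewrite Cmod0.
have Q0 : Q 0 = Cm N by rewrite /Q scale0r subr0.
have detN : \det (Cm N) != 0 by rewrite -unitfE -unitmxE map_unitmx N_unit.
have [dl1 dl10 Qu] : exists2 dl1, 0 < dl1 & forall s, Cmod s < dl1 -> Q s \in unitmx.
  have n0 : 0 < Cmod (\det (Q 0)) by rewrite Cmod_gt0 Q0.
  have [dl1 dl10 h] := hol_cont (hol_det (fun i j => holQ 0 i j h0)) n0.
  exists dl1 => // s hs; have := h s; rewrite subr0 => /(_ hs).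
  rewrite unitmxE unitfE => h1; apply: contraTneq h1 => ->.
  by rewrite sub0r CmodN ltxx.
exists dl1, E; split=> //.
- exists (\det N * be * \sum_i u ord0 i * v i ord0 * Wv i).
    have dN : \det N != 0 by rewrite -unitfE -unitmxE N_unit.
    apply: mulf_neq0; first by rewrite mulf_neq0 // gt_eqF.
    by rewrite gt_eqF //; apply: sum_gt0 => k; rewrite !mulr_gt0.
  rewrite /E Q0.
  have -> : Cm u *m \adj (Cm N) = \det (Cm N) *: Cm u.
    rewrite -{1}uN /Cm map_mxM -mulmxA mul_mx_adj mul_mx_scalar //.
  rewrite -scalemxAl mxE [X in _ * X]mxE -mulrN -mulrA rmorphM /Cm det_map_mx; congr (_ * _).
  rewrite -sumrN mulr_sumr rmorph_sum; apply: eq_bigr => i _.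
  rewrite mxE [(Xm 0 *m _) i ord0]mxE.
  have -> : \sum_j Xm 0 i j * (map_mx RtoC v) j ord0 = RtoC (- (be * v i ord0) * Wv i).
    rewrite /Wv mulr_sumr rmorph_sum; apply: eq_bigr => j _.
    by rewrite !mxE X0 -!rmorphM; congr RtoC; ring.
  by rewrite -rmorphM -rmorphN; congr RtoC; ring.
- move=> s hs; apply: hol_ext ltr01 _ (holN (_ : hol (fun s => \sum_k (\sum_j RtoC (u ord0 j) * (\adj (Q s)) j k) * (\sum_l Xm s k l * RtoC (v l ord0))) s)) => [t _|].
    rewrite /E mxE; congr (- _); apply: eq_bigr => k _; rewrite !mxE.
    by congr (_ * _); apply: eq_bigr => l _; rewrite !mxE.
  apply: hol_sum => k _; apply: holM; apply: hol_sum => l _.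
    by apply: holM; [exact: hol_const|apply: hol_adj => i j; apply: holQ].
  by apply: holM; [exact: holXm|exact: hol_const].
move=> s hs.
have -> : 1%:M - \matrix_(i, j) ((RtoC (tau i) + s * X s i) * RtoC (W i j)) = Q s - Cm v *m Cm u.
  rewrite /Q /Cm -map_mxM; apply/matrixP => i j; rewrite /N !mxE !(rmorphD, rmorphB, rmorphN) /=.
  by rewrite rmorph_nat !rmorphM; ring.
rewrite det_rank1 ?Qu //.
have Qv : Cm v = invmx (Q s) *m Cm v - s *: (invmx (Q s) *m (Xm s *m Cm v)).
  rewrite scalemxAr -mulmxBr scalemxAl.
  have -> : Cm v - s *: Xm s *m Cm v = Q s *m Cm v.
    by rewrite mulmxBl /Cm -map_mxM Nv.
  by rewrite mulKmx ?Qu.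
have : (Cm u *m Cm v) ord0 ord0 = 1 by rewrite /Cm -map_mxM mxE uv rmorph1.
rewrite {1}Qv mulmxBr -scalemxAr mulmxA mxE [X in _ + X]mxE [X in - X]mxE => E1.
have -> : (Cm u *m invmx (Q s) *m Cm v) ord0 ord0 =
    1 + s * (Cm u *m (invmx (Q s) *m (Xm s *m Cm v))) ord0 ord0.
  by rewrite -E1; ring.
rewrite /E /invmx Qu // !mulmxA -!scalemxAr -!scalemxAl [X in s * X]mxE.
have := Qu s hs; rewrite unitmxE unitfE => dq.
rewrite -[_ *m Xm s *m _]mulmxA; move: dq ((_ *m (Xm s *m _)) _ _) => dq t.
by field.
Qed.

End Uniformization.

(** * From a simple zero to a logarithmic singularity *)

(** The inequality |1 - s ^ 2| < 1 forces |Im s| < Re s, so that s x, with x close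
    to a negative real number, points to the left and makes the modulus of
    tau + s x decrease at first order. *)
Lemma uniformized_in_polydisc d (tau : 'I_d -> R) (x0 : 'I_d -> R) (X : C -> 'I_d -> C) :
  (forall i, 0 < tau i) -> (forall i, 0 < x0 i) ->
  (forall i, X 0 i = RtoC (- x0 i)) -> (forall i, ccont (fun s => X s i) 0) ->
  exists2 dl, 0 < dl & forall s, Cmod s < dl -> 0 < Re s -> Cmod (1 - s ^+ 2) < 1 ->
    forall i, Cmod (RtoC (tau i) + s * X s i) <= tau i.
Proof.
move=> tau0 x00 X0 Xc.
have [||dl dl0 hdl] := @common_radius _ (fun i dl => forall s, Cmod s < dl ->
   Cmod (X s i - RtoC (- x0 i)) <= x0 i / 4 /\ 8 * Cmod s * x0 i <= tau i).
- by move=> i e e' _ ee h s hs; apply: h; apply: lt_le_trans ee.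
- move=> i; have x4 : 0 < x0 i / 4 by rewrite divr_gt0.
  have [e e0 he] := Xc i _ x4.
  exists (Num.min e (tau i / (8 * x0 i))); first by rewrite lt_min e0 divr_gt0 ?mulr_gt0.
  move=> s; rewrite lt_min ltr_pdivlMr ?mulr_gt0 // => /andP[h1 h2]; split.
    by have := he s; rewrite subr0 X0 => /(_ h1) /ltW.
  by rewrite mulrAC mulrC ltW.
exists dl => // s hs Re0 h1 i; have [hX ht] := hdl i s hs.
set a := Re s in Re0; set b := Im s; set m := Cmod s in hs ht.
have m2 : m ^+ 2 = a ^+ 2 + b ^+ 2 by rewrite /m Cmod_sqr.
have m0 : 0 <= m := Cmod_ge0 s.
have ab : b ^+ 2 < a ^+ 2.
  have : Cmod (1 - s ^+ 2) ^+ 2 < 1 by rewrite expr_lt1 ?Cmod_ge0.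
  have -> : Cmod (1 - s ^+ 2) ^+ 2 = 1 - 2 * (a ^+ 2 - b ^+ 2) + (m ^+ 2) ^+ 2.
    rewrite Cmod_sqr m2 expr2 !ReD !ImD !ReN !ImN ReM ImM -/a -/b.
    rewrite -[Re 1]/(1 : R) -[Im 1]/(0 : R); ring.
  have := sqr_ge0 (m ^+ 2); lra.
have ma : m <= 3 / 2 * a.
  rewrite -(@ler_pXn2r _ 2) ?nnegrE //; last by rewrite mulr_ge0 ?divr_ge0 // ltW.
  have -> : (3 / 2 * a) ^+ 2 = 9 / 4 * a ^+ 2 by field.
  by rewrite m2; have := sqr_ge0 a; lra.
set x := X s i in hX *; set y := x0 i in hX ht; set t := tau i in ht *.
have y0 : 0 < y := x00 i; have t0 : 0 < t := tau0 i.
pose e := x - RtoC (- y); have ex : x = RtoC (- y) + e by rewrite /e addrC subrK.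
have eb : Cmod e <= y / 4 by [].
have xb : Cmod x <= 2 * y.
  rewrite ex; apply: le_trans (CmodD _ _) _; rewrite CmodR normrN gtr0_norm //; lra.
have Rsx : Re (s * x) <= - (y * a) + m * (y / 4).
  rewrite ex mulrDr ReD; apply: lerD.
    by rewrite ReM ReR ImR mulr0 subr0 -/a; lra.
  by apply: le_trans (Re_le_Cmod _) _; rewrite CmodM ler_wpM2l.
rewrite -(@ler_pXn2r _ 2) ?nnegrE ?Cmod_ge0 ?(ltW t0) //.
have -> : Cmod (RtoC t + s * x) ^+ 2 = t ^+ 2 + 2 * t * Re (s * x) + Cmod (s * x) ^+ 2.
  by rewrite !Cmod_sqr ReD ImD ReR ImR add0r; ring.
rewrite CmodM -/m.
have H1 : (m * Cmod x) ^+ 2 <= (m * (2 * y)) ^+ 2.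
  apply: lerXn2r; rewrite ?nnegrE ?mulr_ge0 ?Cmod_ge0 ?(ltW y0) //; exact: ler_wpM2l.
have H2 : (m * (2 * y)) ^+ 2 = (8 * m * y) * (m * y / 2) by field.
have H3 : (8 * m * y) * (m * y / 2) <= t * (m * y / 2).
  by rewrite ler_wpM2r // divr_ge0 // mulr_ge0 // ltW.
have H4 : 2 * t * Re (s * x) <= 2 * t * (- (y * a) + m * (y / 4)) by rewrite ler_pM2l ?mulr_gt0.
have H5 : m * y <= 3 / 2 * a * y by rewrite ler_pM2r.
have H6 : t * (m * y) <= t * (3 / 2 * a * y) by rewrite ler_pM2l.
have H7 : 0 <= t * (a * y) by rewrite !mulr_ge0 // ltW.
lra.
Qed.

Lemma slit_offcut rho r z : 0 < rho -> slit_disc rho r z -> offcut (1 - z / RtoC rho).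
Proof.
move=> rho0 [_ hs].
have E : 1 - z / RtoC rho = (1 - Re z / rho, - (Im z / rho)).
  have nz : RtoC rho != 0 by rewrite -Cmod_gt0 CmodR_ge0 ?ltW.
  apply: (mulIf nz); rewrite mulrBl mul1r divfK //.
  apply: C_ext; rewrite ?ReD ?ImD ?ReN ?ImN ?ReM ?ImM ?ReR ?ImR /= ?RealsE.
    by rewrite mulr0 subr0; field; rewrite gt_eqF.
  by rewrite mulr0 add0r; field; rewrite gt_eqF.
rewrite /offcut E; set w : C := (_, _).
have cw := Cmod_Re w; have := ler_norm (- Re w); rewrite normrN => h.
have h0 : 0 <= Cmod w + Re w by lra.
rewrite lt0r h0 andbT; apply/eqP => h1; apply: hs.
have w2 := Cmod_sqr w; have wE : Cmod w = - Re w by lra.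
have im0 : Im w = 0.
  by move: w2; rewrite wE sqrrN => /eqP; rewrite -subr_eq0 opprD addrA subrr sub0r oppr_eq0 sqrf_eq0 => /eqP.
have re0 : Re w <= 0 by have := Cmod_ge0 w; lra.
move: im0 re0; rewrite /w /= => /eqP; rewrite oppr_eq0 mulf_eq0 invr_eq0 (gt_eqF rho0) orbF => /eqP im0.
by rewrite subr_le0 ler_pdivlMr // mul1r => /RleP.
Qed.

Lemma convex_lt (a b c m : R) : 0 <= c -> c <= 1 -> a < m -> b < m -> (1 - c) * a + c * b < m.
Proof.
move=> c0 c1 am bm; apply: le_lt_trans (_ : Num.max a b < m); last by rewrite gt_max am.
have h1 : (1 - c) * a <= (1 - c) * Num.max a b by rewrite ler_wpM2l ?subr_ge0 // le_max lexx.
have h2 : c * b <= c * Num.max a b by rewrite ler_wpM2l // le_max lexx orbT.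
by move: h1 h2; set mx := Num.max a b; lra.
Qed.

Lemma Log_real (x : R) : 0 < x -> Log (RtoC x) = RtoC (ln x).
Proof.
by move=> x0; rewrite /Log CmodR_ge0 ?(ltW x0) // /= !RealsE mul0r atan_0.
Qed.

Lemma Csqrt_real (x : R) : 0 < x -> Im (Csqrt (RtoC x)) = 0.
Proof. by move=> x0; rewrite /Csqrt /= mul0r. Qed.

(** In the application P is the cycle series and s E(s) is det(1 - A), so that PE is
    the identity exp(- C) = det(1 - A) in the variable s. *)
Section LogSingularity.
Variables (rho dl0 : R) (P DT E : C -> C) (e0 : R).
Hypothesis rho0 : 0 < rho.
Hypothesis dl00 : 0 < dl0.
Hypothesis Phol : forall z, Cmod z < rho -> hol P z.
Hypothesis Preal : forall x : R, 0 <= x < rho -> Im (P (RtoC x)) = 0.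
Hypothesis Ehol : forall s, Cmod s < dl0 -> hol E s.
Hypothesis E0 : E 0 = RtoC e0.
Hypothesis e0n : e0 != 0.
Hypothesis PE : forall z s, Cmod z < rho -> Cmod s < dl0 -> 0 < Re s ->
  s ^+ 2 = 1 - z / RtoC rho -> cexp (- P z) = s * E s.

Let nz : RtoC rho != 0.
Proof. by rewrite -Cmod_gt0 CmodR_ge0 ?ltW. Qed.

Let real_point (t : R) : 0 < t -> t < dl0 -> t < 1 ->
  let x := rho * (1 - t ^+ 2) in 0 <= x < rho /\ cexp (- P (RtoC x)) = RtoC t * E (RtoC t).
Proof.
move=> t0 td t1 x; have t2 : 0 < t ^+ 2 by rewrite exprn_gt0.
have t21 : t ^+ 2 < 1 by rewrite expr_lt1 // ltW.
have hx : 0 <= x < rho.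
  by rewrite mulr_ge0 ?(ltW rho0) ?subr_ge0 ?(ltW t21) //= -[ltRHS]mulr1 ltr_pM2l // gtrBl.
split=> //; case/andP: hx => x0 xr.
apply: PE; rewrite ?CmodR_ge0 ?(ltW t0) //.
rewrite /x !rmorphM rmorphB rmorph1 rmorphXn; by field.
Qed.

(** For real s > 0 the number s E(s) = exp(- P) is positive; let s tend to 0. *)
Let e0_gt0 : 0 < e0.
Proof.
rewrite lt0r e0n /= leNgt; apply/negP => en.
have ep : 0 < - e0 by rewrite oppr_gt0.
have [dl dlp hdl] := hol_cont (Ehol (s := 0) ltac:(by rewrite Cmod0)) ep.
pose t := Num.min (Num.min dl dl0) 1 / 2.
have m0 : 0 < Num.min (Num.min dl dl0) 1 by rewrite !lt_min dlp dl00 ltr01.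
have t0 : 0 < t by rewrite divr_gt0.
have : t < Num.min (Num.min dl dl0) 1 by rewrite ltr_pdivrMr // mulr_natr mulr2n ltrDl.
rewrite !lt_min => /andP[/andP[h1 h2] h3].
have [hx hE] := real_point t0 h2 h3.
have := hdl (RtoC t); rewrite subr0 CmodR_ge0 ?(ltW t0) // => /(_ h1).
rewrite E0 => /(le_lt_trans (Re_le_Cmod _)); rewrite ReD ReN ReR => h4.
have : Re (E (RtoC t)) < 0 by lra.
have : 0 < t * Re (E (RtoC t)).
  have := congr1 Re hE; rewrite [in RHS]ReM ReR ImR mul0r subr0 => <-.
  have PR x : 0 <= x < rho -> P (RtoC x) = RtoC (Re (P (RtoC x))).
    by move=> hx'; apply: C_ext => //; rewrite ImR Preal.
  by rewrite PR // -rmorphN cexpR ReR expR_gt0.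
by rewrite pmulr_rgt0 // => h5 h6; have := lt_trans h5 h6; rewrite ltxx.
Qed.

Let s_of z := Csqrt (1 - z / RtoC rho).
Let F2 z := - Log (s_of z) - Log (E (s_of z)).

(** Both - Log s - Log E(s) and P are logarithms of 1 / (s E(s)).  On the overlap of
    their domains, which is convex, their difference has zero derivative, and it
    vanishes at a real point, where both are real.  For the equivalent, Re (- Log s)
    is exactly 1/2 ln |1 / (1 - z / rho)|, and all the other terms are bounded. *)
Lemma log_singularity_of_simple_zero : exists r F, [/\ 0 < r,
  (forall z, Cmod z < rho -> F z = P z),
  (forall z, Cmod z < rho \/ slit_disc rho r z -> hol F z) &
  log_singularity (1 / 2)%R rho r F].
Proof.
have e20 : 0 < e0 / 2 by rewrite divr_gt0 // e0_gt0.
have [dl1 dl1p hdl1] := hol_cont (Ehol (s := 0) ltac:(by rewrite Cmod0)) e20.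
pose dl := Num.min dl0 dl1.
have dlp : 0 < dl by rewrite lt_min dl00.
pose r := rho * dl ^+ 2.
have rp : 0 < r by rewrite mulr_gt0 // exprn_gt0.
have Eest s : Cmod s < dl -> e0 / 2 < Re (E s) /\ Cmod (E s) < 2 * e0.
  rewrite lt_min => /andP[_ h]; have := hdl1 s; rewrite subr0 => /(_ h).
  rewrite E0 => hE; split.
    have := le_lt_trans (Cmod_Re _) hE; rewrite ReD ReN ReR ltr_norml => /andP[h1 _]; lra.
  have -> : E s = (E s - RtoC e0) + RtoC e0 by rewrite subrK.
  apply: le_lt_trans (CmodD _ _) _; rewrite CmodR_ge0 ?(ltW e0_gt0) //; have := e0_gt0; lra.
have slitP z : slit_disc rho r z -> [/\ offcut (1 - z / RtoC rho), s_of z ^+ 2 = 1 - z / RtoC rho,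
    Cmod (s_of z) < dl & 0 < Re (s_of z)].
  move=> hz; have ho := slit_offcut rho0 hz; split=> //.
  - exact: Csqrt_sqr.
  - have := Csqrt_mod ho; rewrite -/(s_of z) => h.
    rewrite -(@ltr_pXn2r _ 2) ?nnegrE ?Cmod_ge0 ?(ltW dlp) // h.
    have -> : 1 - z / RtoC rho = (RtoC rho - z) / RtoC rho by field.
    rewrite CmodM CmodV CmodR_ge0 ?(ltW rho0) // ltr_pdivrMr // CmodB mulrC.
    by case: hz => /RltP.
  - exact: Csqrt_Re.
have F2hol z : slit_disc rho r z -> hol F2 z.
  move=> /slitP[ho s2 sd sr]; have [E1 E2] := Eest _ sd.
  have hs : hol s_of z.
    apply: hol_comp; last exact: Csqrt_hol.
    exact: holB (hol_const 1 z) (holM (hol_id z) (hol_const _ z)).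
  have sd0 : Cmod (s_of z) < dl0 by move: sd; rewrite lt_min => /andP[].
  apply: holB; first apply: holN.
    by apply: (hol_comp hs); eexists; apply: Log_deriv.
  apply: (hol_comp (f := Log) (g := fun z => E (s_of z))); first exact: (hol_comp hs (Ehol sd0)).
  by eexists; apply: Log_deriv; apply: lt_trans E1.
have F2exp z : slit_disc rho r z -> cexp (- F2 z) = s_of z * E (s_of z).
  move=> /slitP[ho s2 sd sr]; have [E1 E2] := Eest _ sd.
  rewrite /F2 opprB opprK addrC cexpD !cexp_Log //; exact: lt_trans E1.
have slit_in z : Cmod z < rho -> Cmod (z - RtoC rho) < r -> slit_disc rho r z.
  move=> h1 h2; split; first exact/RltP.
  case=> _ /RleP h3; have := le_trans h3 (Re_le_Cmod z); lra.
have agree z : Cmod z < rho -> Cmod (z - RtoC rho) < r -> F2 z = P z.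
  move=> hz1 hz2.
  have step w : Cmod w < rho -> Cmod (w - RtoC rho) < r -> cderiv (fun w => P w - F2 w) w 0.
    move=> hw1 hw2; have hw := slit_in w hw1 hw2.
    have [g hg] := holB (Phol hw1) (F2hol w hw).
    have k1 : 0 < Num.min (rho - Cmod w) (r - Cmod (w - RtoC rho)) by rewrite lt_min !subr_gt0 hw1.
    have h0 : cderiv (fun w => cexp (P w - F2 w)) w 0.
      apply: cderiv_ext k1 _ (cderiv_const 1 w) => y; rewrite lt_min => /andP[y1 y2].
      have yw : y = w + (y - w) by ring.
      have hy1 : Cmod y < rho by rewrite yw; apply: le_lt_trans (CmodD _ _) _; lra.
      have hy2 : Cmod (y - RtoC rho) < r.
        have -> : y - RtoC rho = (w - RtoC rho) + (y - w) by ring.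
        by apply: le_lt_trans (CmodD _ _) _; lra.
      have hy := slit_in y hy1 hy2; have [_ s2 sd sr] := slitP y hy.
      have sd0 : Cmod (s_of y) < dl0 by move: sd; rewrite lt_min => /andP[].
      have h1 := PE hy1 sd0 sr s2; have h2 := F2exp y hy.
      have -> : P y - F2 y = - F2 y - - P y by ring.
      by rewrite cexpD [cexp (- - _)]cexpN h1 h2 divff // -h2 cexp_neq0.
    have := cderiv_unique h0 (cderiv_comp hg (cexp_deriv _)) => /esym/eqP.
    rewrite mulf_eq0 (negbTE (cexp_neq0 _)) /= => /eqP g0.
    by apply: cderiv_eq hg g0.
  pose t := Num.min dl 1 / 2.
  have m0 : 0 < Num.min dl 1 by rewrite lt_min dlp ltr01.
  have t0 : 0 < t by rewrite divr_gt0.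
  have : t < Num.min dl 1 by rewrite ltr_pdivrMr // mulr_natr mulr2n ltrDl.
  rewrite lt_min => /andP[td t1].
  have td0 : t < dl0 by move: td; rewrite lt_min => /andP[].
  have [/andP[x0 xr] hE] := real_point t0 td0 t1; set x := rho * (1 - t ^+ 2) in x0 xr hE.
  have hx1 : Cmod (RtoC x) < rho by rewrite CmodR_ge0.
  have xx : rho - x = rho * t ^+ 2 by rewrite /x; ring.
  have hx2 : Cmod (RtoC x - RtoC rho) < r.
    rewrite CmodB -rmorphB CmodR_ge0; last by rewrite subr_ge0 ltW.
    by rewrite xx ltr_pM2l // ltrXn2r ?nnegrE ?ltW.
  have base : P (RtoC x) - F2 (RtoC x) = 0.
    have hxs := slit_in _ hx1 hx2; have [ho s2 sd sr] := slitP _ hxs.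
    have wE : 1 - RtoC x / RtoC rho = RtoC (t ^+ 2).
      by rewrite /x rmorphM rmorphB rmorph1; field.
    have sE : s_of (RtoC x) = RtoC (Re (s_of (RtoC x))).
      apply: C_ext => //; rewrite ImR /s_of wE Csqrt_real // exprn_gt0 //.
    have sd0 : Cmod (s_of (RtoC x)) < dl0 by move: sd; rewrite lt_min => /andP[].
    have h1 := PE hx1 sd0 sr s2; have h2 := F2exp _ hxs.
    have PR : P (RtoC x) = RtoC (Re (P (RtoC x))).
      by apply: C_ext => //; rewrite ImR Preal // x0.
    set s := Re (s_of (RtoC x)) in sE sr; set a := Re (P (RtoC x)) in PR.
    have EE : E (s_of (RtoC x)) = RtoC (exp (- a) / s).
      apply: (mulfI (_ : RtoC s != 0)); first by rewrite -Cmod_gt0 CmodR_ge0 ?ltW.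
      rewrite -{1}sE -h1 PR -rmorphN cexpR -rmorphM; congr RtoC; field.
      by rewrite gt_eqF.
    have [E1 _] := Eest _ sd; rewrite EE ReR in E1.
    have F2R : F2 (RtoC x) = RtoC (- ln s - ln (exp (- a) / s)).
      rewrite /F2 EE sE !Log_real //; last by lra.
      by rewrite rmorphB rmorphN.
    have h3 : cexp (- F2 (RtoC x)) = cexp (- P (RtoC x)) by rewrite h1 h2.
    move: h3; rewrite F2R PR -!rmorphN !cexpR => /RtoC_inj/exp_inv E3.
    by rewrite -rmorphD E3 subrr.
  suff : P z - F2 z = 0 by move/eqP; rewrite subr_eq0 => /eqP.
  rewrite -base; apply: (@cderiv0_const (fun z => P z - F2 z)) => c /andP[c0 c1].
  set w := _ + _; have wE : w = RtoC (1 - c) * RtoC x + RtoC c * z.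
    by rewrite /w rmorphB rmorph1; ring.
  apply: step.
    rewrite wE; apply: le_lt_trans (CmodD _ _) _; rewrite !CmodM !(CmodR_ge0 (a := c)) // (CmodR_ge0 (a := 1 - c)) ?subr_ge0 //.
    exact: convex_lt.
  have -> : w - RtoC rho = RtoC (1 - c) * (RtoC x - RtoC rho) + RtoC c * (z - RtoC rho).
    by rewrite wE rmorphB rmorph1; ring.
  apply: le_lt_trans (CmodD _ _) _; rewrite !CmodM !(CmodR_ge0 (a := c)) // (CmodR_ge0 (a := 1 - c)) ?subr_ge0 //.
  exact: convex_lt.
pose F z := if Cmod z < rho then P z else F2 z.
have FF2 z : slit_disc rho r z -> F z = F2 z.
  by move=> [/RltP h1 h2]; rewrite /F; case: ifP => // h3; rewrite agree.
exists r, F; split=> //.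
- by move=> z hz; rewrite /F hz.
- move=> z [hz|hz].
    apply: (@hol_ext P _ _ (rho - Cmod z)) => [|w hw|]; first by rewrite subr_gt0.
      rewrite /F ifT //; have -> : w = z + (w - z) by ring.
      by apply: le_lt_trans (CmodD _ _) _; lra.
    exact: Phol.
  have [q q0 hq] := rcont_offcut (slit_offcut rho0 hz).
  have hz1 : Cmod (z - RtoC rho) < r by case: hz => /RltP.
  have k1 : 0 < Num.min (q * rho) (r - Cmod (z - RtoC rho)).
    by rewrite lt_min mulr_gt0 // subr_gt0.
  apply: hol_ext k1 _ (F2hol z hz) => w; rewrite lt_min => /andP[w1 w2].
  rewrite FF2 //; split.
    apply/RltP; rewrite -[Cminus _ _]/(w - RtoC rho).
    have -> : w - RtoC rho = (z - RtoC rho) + (w - z) by ring.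
    by apply: le_lt_trans (CmodD _ _) _; lra.
  have : offcut (1 - w / RtoC rho).
    apply: hq; have -> : 1 - w / RtoC rho - (1 - z / RtoC rho) = (z - w) / RtoC rho by field.
    by rewrite CmodM CmodV CmodR_ge0 ?(ltW rho0) // ltr_pdivrMr // CmodB.
  rewrite /offcut => ho [im0 /RleP re0]; move: ho.
  have -> : 1 - w / RtoC rho = RtoC (1 - Re w / rho).
    have -> : w = RtoC (Re w) by apply: C_ext => //; rewrite im0.
    by rewrite rmorphB rmorph1 rmorphM fmorphV.
  rewrite CmodR ReR ler0_norm ?addNr ?ltxx //.
  by rewrite subr_le0 ler_pdivlMr // mul1r.
pose B := `|ln (e0 / 2)| + `|ln (2 * e0)| + 6.
have B0 : 0 < B by rewrite /B ltr_wpDl ?addr_ge0.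
have key z : slit_disc rho r z ->
    let G := RtoC (1 / 2) * Clog (1 / (1 - z / RtoC rho)) in
    Cmod (G - F z) <= B /\ - ln (Cmod (1 - z / RtoC rho)) / 2 <= Cmod G.
  move=> hz G; have [ho s2 sd sr] := slitP z hz; have [E1 E2] := Eest _ sd.
  set w := 1 - z / RtoC rho in ho s2 G *; set s := s_of z in s2 sd sr E1 E2 *.
  have m0 : 0 < Cmod s := Re_gt0_Cmod sr.
  have wm : Cmod w = Cmod s ^+ 2 by rewrite -s2 CmodX.
  have w0 : 0 < Cmod w by rewrite wm exprn_gt0.
  have lnw : ln (Cmod w) = 2 * ln (Cmod s).
    rewrite wm expr2 -[_ * _]/(Rmult _ _) ln_mult; try exact/RltP.
    by rewrite RplusE; ring.
  have em0 : 0 < Cmod (E s) by apply: Re_gt0_Cmod; lra.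
  have ReG : Re G = - ln (Cmod s).
    rewrite /G ReM ReR ImR mul0r subr0 /Clog [Re (_, _)]/= CmodM Cmod1 !mul1r CmodV.
    have -> : ln (Cmod w)^-1 = - ln (Cmod w) := ln_Rinv _ (elimT RltP w0).
    by rewrite lnw; field.
  have ImG : `|Im G| <= 2.
    rewrite /G ImM ReR ImR mul0r addr0 /Clog [Im (_, _)]/= normrM.
    have : `|Carg (1 / w)| <= 4.
      rewrite /Carg ler_norml; set t := (Rdiv (Re _) (Cmod _)); have [/RleP h1 h2] := acos_bound t.
      have /RleP := Rle_trans _ _ _ h2 PI_4; rewrite !RealsE -[nat_of_pos 4]/4%N => h3.
      rewrite R0E in h1.
      by case: (Rlt_dec _ _) => _h; rewrite /= ?RoppE; apply/andP; split; lra.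
    by rewrite (ger0_norm (_ : 0 <= 1 / 2)); lra.
  split; last first.
    apply: le_trans (_ : Re G <= _); last exact: Re_le_Cmod.
    by rewrite ReG lnw; lra.
  rewrite FF2 //; apply: le_trans (Cmod_le_ReIm _) _.
  have -> : Re (G - F2 z) = ln (Cmod (E s)).
    rewrite ReD ReN ReG /F2 -/s ReD !ReN [Re (Log s)]/= [Re (Log _)]/= ; ring.
  have hI : `|Im (G - F2 z)| <= 6.
    rewrite /F2 -/s ImD ImN ImD !ImN.
    have i1 := Log_Im s; have i2 := Log_Im (E s).
    have -> : Im G - (- Im (Log s) - Im (Log (E s))) = Im G + (Im (Log s) + Im (Log (E s))) by ring.
    apply: le_trans (ler_normD _ _) _; have := ler_normD (Im (Log s)) (Im (Log (E s))); lra.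
  have hR : `|ln (Cmod (E s))| <= `|ln (e0 / 2)| + `|ln (2 * e0)|.
    have c1 : ln (e0 / 2) <= ln (Cmod (E s)).
      apply/RleP/ln_le; first exact/RltP.
      by apply/RleP; have := Re_le_Cmod (E s); lra.
    have c2 : ln (Cmod (E s)) <= ln (2 * e0).
      by apply/RleP/ln_le; [exact/RltP|apply/RleP/ltW].
    have n1 := ler_norm (- ln (e0 / 2)); have n2 := ler_norm (ln (2 * e0)).
    rewrite normrN in n1; have n3 := normr_ge0 (ln (e0 / 2)); have n4 := normr_ge0 (ln (2 * e0)).
    by rewrite ler_norml; apply/andP; split; lra.
  by rewrite /B; lra.
move=> eps; have ep : 0 < (eps : R) := introT RltP (cond_pos eps).
(* Within eta of rho, the logarithm exceeds B / eps. *)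
pose eta := rho * exp (- (2 * (B / (eps : R)))).
have eta0 : 0 < eta by rewrite mulr_gt0 // expR_gt0.
have eta2 : 0 < eta / 2 by rewrite divr_gt0.
exists (mkposreal _ (elimT RltP eta2)) => z hz hs.
have [k1 k2] := key z hs.
have zr : Cmod (z - RtoC rho) < eta.
  case: hz; rewrite /ball /= /AbsRing_ball /= => /RltP b1 /RltP b2.
  apply: le_lt_trans (Cmod_le_ReIm _) _.
  move: b1 b2; rewrite /abs /= !RabsE -[minus z.1 rho]/(Re (z - RtoC rho)) -[minus z.2 _]/(Im (z - RtoC rho)).
  lra.
have [ho s2 sd sr] := slitP z hs.
have w0 : 0 < Cmod (1 - z / RtoC rho) by rewrite -s2 CmodX exprn_gt0 // Re_gt0_Cmod.
have k3 : B / (eps : R) <= - ln (Cmod (1 - z / RtoC rho)) / 2.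
  have : ln (Cmod (1 - z / RtoC rho)) <= - (2 * (B / (eps : R))).
    rewrite -[leRHS]ln_exp; apply/RleP/ln_le; first exact/RltP.
    apply/RleP/ltW; have -> : 1 - z / RtoC rho = (RtoC rho - z) / RtoC rho by field.
    by rewrite CmodM CmodV CmodR_ge0 ?(ltW rho0) // ltr_pdivrMr // CmodB mulrC.
  lra.
suff h : Cmod (RtoC (1 / 2) * Clog (1 / (1 - z / RtoC rho)) - F z) <=
    (eps : R) * Cmod (RtoC (1 / 2) * Clog (1 / (1 - z / RtoC rho))).
  exact: (elimT RleP h).
apply: le_trans k1 _; rewrite mulrC -ler_pdivrMr //.
exact: le_trans k3 k2.
Qed.
End LogSingularity.

Theorem theorem4p4 (d : nat) (hd : (2 <= d)%N)
    (p : 'I_d -> R) (hp : forall i, 0 < p i < 1) (hp1 : \sum_i p i = 1)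
    (W : 'M[R]_d) (hW : stochastic W) (hirr : irreducible W)
    (T : 'I_d -> nat -> R) (hT : tree_system p W T)
    (rho : R) (hrho : 0 < rho) (hrad : forall i, CV_radius (T i) = Rbar.Finite rho) :
  exists (r : R) (F : C -> C),
    [/\ 0 < r,
        slit_continuation (cycle_egf W T) rho r F
      & log_singularity (1 / 2)%R rho r F].
Proof.
have [W0 W1] := hW; have p0 i : 0 < p i by have /andP[] := hp i.
have i0 : 'I_d := Ordinal (ltnW hd).
have [tau [v [u [tauP hpsum [v0 u0] [Av uA] [uv Aker]]]]] :=
  critical_point i0 p0 W0 W1 hirr hT hrho hrad.
have tau0 i : 0 < tau i := (tauP i).1; have tauE i := (tauP i).2.
have [dl [al [X [dl_gt0 al0 X0 holX Ysys]]]] :=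
  uniformization i0 tau0 tauE v0 u0 Av uA uv Aker.
have [dl1 [E [dl1_gt0 [e0 e0n E0] holE detE]]] :=
  simple_zero i0 tau0 v0 u0 Av uA uv Aker dl_gt0 al0 X0 holX.
have [||dl2 dl2_gt0 Ybound] := @uniformized_in_polydisc d tau (fun i => al * v i ord0) X tau0 _ X0.
- by move=> i; rewrite mulr_gt0.
- by move=> i; apply/hol_cont/holX; rewrite Cmod0.
pose dl0 := Num.min (Num.min dl dl1) dl2.
have dl0_gt0 : 0 < dl0 by rewrite !lt_min dl_gt0 dl1_gt0.
have nz : RtoC rho != 0 by rewrite -Cmod_gt0 CmodR_ge0 ?ltW.
pose c := cycle_egf W T.
have cin z : Cmod z < rho -> incv c z.
  exact: (cycle_incv p0 W0 hT hrho tau0 hpsum v0 Av).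
have [||||r [F [r0 FP Fhol Flog]]] :=
  @log_singularity_of_simple_zero rho dl0 (cps c) E e0 hrho dl0_gt0 _ _ _ E0 e0n _.
- by move=> z /cin; apply: cps_hol.
- by move=> x _; rewrite cpsR.
- by move=> s; rewrite !lt_min => /andP[/andP[hs _] _]; apply: holE.
- move=> z s hz; rewrite !lt_min => /andP[/andP[s1 s2] s3] sr sz.
  have zs : z = RtoC rho * (1 - s ^+ 2) by rewrite sz; field.
  have h1 : Cmod (1 - s ^+ 2) < 1.
    by move: hz; rewrite zs CmodM CmodR_ge0 ?(ltW hrho) // -[ltRHS]mulr1 ltr_pM2l.
  rewrite -(det_transfer_disc p0 W0 hT hrho hrad tau0 hpsum v0 Av hz) -detE //.
  congr (\det (_ - _)); apply/matrixP => i j; rewrite !mxE; congr (_ * _).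
  apply: (polydisc_unique p0 W0 hrho tauE u0 uA
    (y := fun k => Tc T k z) (y' := fun k => RtoC (tau k) + s * X s k) hz) => // k.
  - by apply: (Tc_bound p0 W0 hT hrad hpsum).
  - exact: Ybound.
  - by apply: (tree_system_disc p0 hT hrad).
  - by rewrite [LHS](Ysys s s1 k) zs.
exists r, F; split=> //; split=> [z /RltP hz|z hz].
  by rewrite FP //; apply: cps_is_pseries; apply: cin.
by apply/hol_ex_derive/Fhol; case: hz => [/RltP|]; [left|right].
Qed.
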